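(* Let $(\lambda,\mu)$ be a measured geodesic lamination on the closed hyperbolic surface $(M,g)$ and let $dw=B\,d\mu$ be the associated Lie algebra valued transverse measure. Then the mass (total variation) of $dw$ satisfies $$\|dw\|_{meas}=2\,l_g(\lambda),$$ where $l_g(\lambda)$ is the length of $(\lambda,\mu)$.
   Context: Hyperboloid model: on $\mathbb R^{2,1}$ let $e^\sharp=\mathrm{diag}(1,1,-1)$, $X^\sharp=(e^\sharp X)^T$, $(X,Y)^\sharp=X^\sharp Y$, and $\mathbb H=\{X:(X,X)^\sharp=-1,\ X_3\ge1\}$. $G=SO^+(2,1)$, $\mathfrak g=so(2,1)$, with pairing $(A,B)^\sharp=\mathrm{Tr}(AB)$. Cross product: $X\times Y=YX^\sharp-XY^\sharp\in\mathfrak g$. For $X\in\mathbb H$, $\beta_X:T_X\mathbb H\to\mathfrak g$, $\beta_X(v)=v\times X$; $(v\times X,v\times X)^\sharp=2|v|^2$. $M=\mathbb H/\sigma(\pi_1(M))$ with $\sigma:\pi_1(M)\to G$ discrete and faithful; $ad(E_\sigma)=\tilde M\times_{Ad(\sigma)}\mathfrak g$; the $\beta_X$ descend to $\beta:TM\to ad(E_\sigma)$, on whose image $(,)^\sharp$ is positive definite. For $\phi\in\Omega^1(M,ad(E_\sigma))$, $\phi_{id}$ is the pointwise orthogonal projection to the image of $\beta$. For $\phi=\phi_{id}$, $s(\phi)$ is the pointwise largest singular value of $\phi_x:T_xM\to \mathrm{Im}\,\beta$ (with metrics $g$ and $(,)^\sharp$); the condition $s(\phi)\le c$ is required at every point.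 Mass: for a distribution $\zeta$ with values in $T^*M\otimes ad(E_\sigma)$, $\|\zeta\|_{meas}=\sup\{\zeta(\phi):\phi\in\Omega^1(M,ad(E_\sigma)),\ \phi=\phi_{id},\ s(\phi)\le\sqrt2\}$. Laminations: a flow-box of a geodesic lamination $\lambda$ is a bi-Lipschitz homeomorphism $F:[a,b]\times[c,d]\to R\subset M$, $F=F(t,s)$, with $F^{-1}(\lambda)=[a,b]\times C$, $C\subset(c,d)$ closed of Hausdorff dimension $0$, where $t\mapsto F(t,s)$, $s\in C$, parametrize leaf segments. A transverse measure $\mu$ is a family of positive measures $\mu(s)$ on $[c,d]$ supported in $C$ and compatible with changes of flow-boxes; $(\lambda,\mu)$ is then a measured geodesic lamination. $B=\partial_t\times id$ is the generator of the geodesic flow, with $\partial_t$ the local unit tangent field to $\lambda$. $B\,d\mu$ is the functional $\phi\mapsto\sum_i\int_{c_i}^{d_i}\int_{(a_i,b_i)\times\{s\}}(\phi_i,B)^\sharp\,d\mu(s)$, where $\phi=\sum_i\phi_i$ with $\phi_i$ supported in flow-boxes $R_i$ and the 1-form $(\phi_i,B)^\sharp$ is integrated along the leaf segments; it does not depend on the local orientation of $\lambda$. Length: if $F_i:[a_i,b_i]\times[c_i,d_i]\to R_i$ are finitely many flow-boxes whose interiors cover $\lambda$ and $\psi_i$ is a partition of unity subordinate to the cover by the interiors, then $l_g(\lambda)=\sum_i\int_{c_i}^{d_i}\int_{[a_i,b_i]\times\{s\}}\psi_i\left|\frac{\partial F_i}{\partial t}\right|dt\,d\mu(s)$. *)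

(* Defs.v *)
From HB Require Import structures.
From mathcomp Require Import all_boot all_order all_algebra.
From mathcomp Require Import all_classical all_reals all_analysis.
Set Implicit Arguments.
Unset Strict Implicit.
Unset Printing Implicit Defensive.
Import Order.TTheory GRing.Theory Num.Theory.
Import numFieldNormedType.Exports.
Local Open Scope classical_set_scope.
Local Open Scope ring_scope.

(* The surface M = H / sigma(pi_1 M) is handled through its universal cover:
   points, functions, forms and leaves on M are represented by their
   sigma-equivariant lifts to the hyperboloid H in R^{2,1} = 'cV_3.  Functions
   defined on H (or on TH) are represented by functions on the ambient space
   whose values off H (off TH) are never used. *)

Section Hyperboloid.
Variable R : realType.
Implicit Types (X Y u v w : 'cV[R]_3) (A B P : 'M[R]_3).

Definition esharp : 'M[R]_3 := diag_mx (\row_i (if i == ord_max then -1 else 1)).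
Definition sharp X : 'rV[R]_3 := (esharp *m X)^T.
Definition ip X Y : R := (sharp X *m Y) 0 0.

Definition hyperboloid : set 'cV[R]_3 :=
  [set X | ip X X = -1 /\ 1 <= X ord_max 0].
Definition tangent X : set 'cV[R]_3 := [set v | ip X v = 0].
Definition hnorm v : R := Num.sqrt (ip v v).

Definition arccosh (x : R) : R := ln (x + Num.sqrt (x ^+ 2 - 1)).
Definition distH X Y : R := arccosh (- ip X Y).

Definition cosh (t : R) : R := (expR t + expR (- t)) / 2.
Definition sinh (t : R) : R := (expR t - expR (- t)) / 2.
Definition geodesic_line X v : set 'cV[R]_3 :=
  range (fun t => cosh t *: X + sinh t *: v).

Definition SOplus21 : set 'M[R]_3 :=
  [set A | [/\ A^T *m esharp *m A = esharp, \det A = 1 & 0 < A ord_max ord_max]].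
Definition so21 : set 'M[R]_3 := [set A | A^T *m esharp + esharp *m A = 0].
Definition pairing A B : R := \tr (A *m B).
Definition cross X Y : 'M[R]_3 := Y *m sharp X - X *m sharp Y.
Definition beta X v : 'M[R]_3 := cross v X.

(* P is the orthogonal projection of A to the image of beta_X. *)
Definition is_projection X A P :=
  (exists2 w, tangent X w & P = beta X w) /\
  (forall w, tangent X w -> pairing (A - P) (beta X w) = 0).

(* c^2 is an eigenvalue of f^* f, the adjoint being taken with respect to the
   metric on the tangent plane and the pairing on the image of beta_X. *)
Definition singular_value X (f : 'cV[R]_3 -> 'M[R]_3) (c : R) :=
  0 <= c /\ exists v, [/\ tangent X v, v != 0 &
    forall w, tangent X w -> pairing (f v) (f w) = c ^+ 2 * ip v w].
Definition largest_singular_value X f : R := sup (singular_value X f).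

End Hyperboloid.

Section Smoothness.
Variable R : realType.

Fixpoint Ck (k : nat) (f : R * R -> R) : Prop :=
  continuous f /\
  if k is k'.+1 then
    (forall x v, derivable f x v) /\ (forall v, Ck k' (fun x => 'D_v f x))
  else True.
Definition smooth2 (f : R * R -> R) := forall k, Ck k f.

(* The global chart (x, y) |-> (x, y, sqrt (1 + x^2 + y^2)) of the hyperboloid
   and its differential. *)
Definition hchart (p : R * R) : 'cV[R]_3 :=
  \col_i [:: p.1; p.2; Num.sqrt (1 + p.1 ^+ 2 + p.2 ^+ 2)]`_i.
Definition dhchart (p w : R * R) : 'cV[R]_3 :=
  \col_i [:: w.1; w.2;
    (p.1 * w.1 + p.2 * w.2) / Num.sqrt (1 + p.1 ^+ 2 + p.2 ^+ 2)]`_i.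

End Smoothness.

Section HausdorffDimension.
Variable R : realType.
Implicit Types (a d : R) (E : set R).

(* r i stands for an upper bound of the diameter of the i-th covering set;
   passing to the infimum this is the same as using the diameters. *)
Definition hausdorff_content a d E : \bar R :=
  ereal_inf [set (\sum_(0 <= i <oo) (r i `^ a)%:E)%E | r in
    [set r : nat -> R | exists U : nat -> set R,
      E `<=` \bigcup_i U i /\
      forall i, 0 <= r i <= d /\ forall x y, U i x -> U i y -> `|x - y| <= r i]].
Definition hausdorff_measure a E : \bar R :=
  ereal_sup [set hausdorff_content a d E | d in [set d | 0 < d]].
Definition hausdorff_dim E : \bar R :=
  ereal_inf [set a%:E | a in [set a : R | 0 < a /\ hausdorff_measure a E = 0%E]].

End HausdorffDimension.

Section Surface.
Variables (R : realType) (pi1 : groupType) (sigma : pi1 -> 'M[R]_3).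

(* sigma is a discrete faithful representation of pi1 in SO^+(2,1), and the
   quotient of H is a closed surface with fundamental group pi1: pi1 acts
   freely (this implies faithfulness) and cocompactly. *)
Record closed_hyperbolic_surface : Prop := ClosedHyperbolicSurface {
  chs_range : forall g, SOplus21 (sigma g);
  chs_hom : forall g h, sigma (g * h)%g = sigma g *m sigma h;
  chs_faithful : injective sigma;
  chs_discrete : exists2 e : R, 0 < e &
    forall g, (forall i j, `|sigma g i j - (1%:M : 'M[R]_3) i j| < e) -> g = 1%g;
  chs_free : forall g X, hyperboloid X -> sigma g *m X = X -> g = 1%g;
  chs_cocompact : exists K : set 'cV[R]_3,
    [/\ compact K, K `<=` hyperboloid (R := R) &
        forall X, hyperboloid X -> exists g, K (sigma g *m X)]
}.

Definition distM (X Y : 'cV[R]_3) : R :=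
  inf [set distH X (sigma g *m Y) | g in [set: pi1]].

(* Real functions on M. *)
Record smooth_function (psi : 'cV[R]_3 -> R) : Prop := SmoothFunction {
  sf_inv : forall g X, hyperboloid X -> psi (sigma g *m X) = psi X;
  sf_smooth : smooth2 (fun p => psi (hchart p))
}.

(* Omega^1(M, ad(E_sigma)): phi X v is the value at X of the lifted form on the
   tangent vector v; smoothness is that of the coefficients of its pullback by
   the chart. *)
Record ad_form (phi : 'cV[R]_3 -> 'cV[R]_3 -> 'M[R]_3) : Prop := AdForm {
  af_so21 : forall X v, hyperboloid X -> tangent X v -> so21 (phi X v);
  af_linear : forall X (a : R) v w, hyperboloid X -> tangent X v -> tangent X w ->
    phi X (a *: v + w) = a *: phi X v + phi X w;
  af_equiv : forall g X v, hyperboloid X -> tangent X v ->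
    phi (sigma g *m X) (sigma g *m v) = sigma g *m phi X v *m invmx (sigma g);
  af_smooth : forall (w : R * R) i j,
    smooth2 (fun p => phi (hchart p) (dhchart p w) i j)
}.

(* phi' = phi_id *)
Definition is_id_part (phi phi' : 'cV[R]_3 -> 'cV[R]_3 -> 'M[R]_3) :=
  forall X v, hyperboloid X -> tangent X v ->
    is_projection X (phi X v) (phi' X v).

Definition mass (zeta : ('cV[R]_3 -> 'cV[R]_3 -> 'M[R]_3) -> R) : \bar R :=
  ereal_sup [set (zeta phi)%:E | phi in
    [set phi | [/\ ad_form phi, is_id_part phi phi &
      forall X, hyperboloid X ->
        largest_singular_value X (phi X) <= Num.sqrt 2]]].

End Surface.

Section Lamination.
Variables (R : realType) (pi1 : groupType) (sigma : pi1 -> 'M[R]_3).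
Variable leaf : set (set 'cV[R]_3).

(* leaf is the set of lifts to H of the leaves.  Disjointness of distinct lifts
   says both that the leaves are simple and that they are pairwise disjoint. *)
Definition lam_support : set 'cV[R]_3 := \bigcup_(l in leaf) l.

Record geodesic_lamination : Prop := GeodesicLamination {
  gl_geodesic : forall l, leaf l -> exists X v,
    [/\ hyperboloid X, tangent X v, ip v v = 1 & l = geodesic_line X v];
  gl_disjoint : forall l l', leaf l -> leaf l' -> l `&` l' !=set0 -> l = l';
  gl_inv : forall g l, leaf l -> leaf [set sigma g *m X | X in l];
  gl_closed : closed lam_support
}.

(* fb_F is a lift to H of a map F from [a,b] x [c,d] to M.  Such a lift exists as
   the rectangle is simply connected, and it is K-Lipschitz if and only if F
   is, as the rectangle is convex and H -> M is a local isometry. *)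
Record flow_box : Type := FlowBox {
  fb_a : R; fb_b : R; fb_c : R; fb_d : R;
  fb_F : R -> R -> 'cV[R]_3;
  fb_C : set R;
  fb_ab : fb_a < fb_b;
  fb_cd : fb_c < fb_d;
  fb_H : forall t s, t \in `[fb_a, fb_b] -> s \in `[fb_c, fb_d] ->
    hyperboloid (fb_F t s);
  fb_bilip : exists2 K : R, 0 < K &
    forall t s t' s', t \in `[fb_a, fb_b] -> s \in `[fb_c, fb_d] ->
      t' \in `[fb_a, fb_b] -> s' \in `[fb_c, fb_d] ->
      distH (fb_F t s) (fb_F t' s') <= K * Num.max `|t - t'| `|s - s'| /\
      Num.max `|t - t'| `|s - s'| <= K * distM sigma (fb_F t s) (fb_F t' s');
  fb_support : forall t s, t \in `[fb_a, fb_b] -> s \in `[fb_c, fb_d] ->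
    lam_support (fb_F t s) <-> fb_C s;
  fb_leaf : forall s, fb_C s -> exists2 l, leaf l &
    forall t, t \in `[fb_a, fb_b] -> l (fb_F t s);
  fb_C_sub : fb_C `<=` `]fb_c, fb_d[;
  fb_C_closed : closed fb_C;
  fb_C_dim : hausdorff_dim fb_C = 0%E
}.

(* Full preimages in H of the image R of a flow-box and of its interior. *)
Definition fb_region (B : flow_box) : set 'cV[R]_3 :=
  [set X | exists g t s, [/\ t \in `[fb_a B, fb_b B], s \in `[fb_c B, fb_d B] &
    X = sigma g *m fb_F B t s]].
Definition fb_interior (B : flow_box) : set 'cV[R]_3 :=
  [set X | exists g t s, [/\ t \in `]fb_a B, fb_b B[, s \in `]fb_c B, fb_d B[ &
    X = sigma g *m fb_F B t s]].

(* A change of flow-boxes has the form (t, s) |-> (tau (t, s), h s) along the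
   lamination; compatibility says that such an h preserves the measures.  The
   plaques s and h s lie along each other in M as they meet in the interior of
   both boxes. *)
Record transverse_measure : Type := TransverseMeasure {
  tm_measure :> flow_box -> {finite_measure set (measurableTypeR R) -> \bar R};
  tm_supp : forall B, tm_measure B (~` fb_C B) = 0%E;
  tm_compat : forall (B1 B2 : flow_box) (K : set R) (h : R -> R),
    compact K -> K `<=` fb_C B1 -> h @` K `<=` fb_C B2 ->
    {within K, continuous h} -> set_inj K h ->
    (forall s, K s -> exists t1 t2 g, [/\ t1 \in `]fb_a B1, fb_b B1[,
      t2 \in `]fb_a B2, fb_b B2[ & fb_F B1 t1 s = sigma g *m fb_F B2 t2 (h s)]) ->
    tm_measure B1 K = tm_measure B2 (h @` K)
}.

(* The partial derivative of F in t exists for almost all t, as F is Lipschitz. *)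
Definition fb_dF (B : flow_box) (t s : R) : 'cV[R]_3 :=
  \col_i derive1 (fun t' : R => fb_F B t' s i 0) t.

(* The unit tangent field to the leaves, oriented by the flow-box. *)
Definition fb_unit (B : flow_box) (t s : R) : 'cV[R]_3 :=
  (hnorm (fb_dF B t s))^-1 *: fb_dF B t s.
Definition fb_generator (B : flow_box) (t s : R) : 'M[R]_3 :=
  cross (fb_unit B t s) (fb_F B t s).

Definition fb_form_integral (mu : transverse_measure) (B : flow_box)
    (phi : 'cV[R]_3 -> 'cV[R]_3 -> 'M[R]_3) : R :=
  \int[mu B]_(s in `[fb_c B, fb_d B])
    \int[lebesgue_measure]_(t in `]fb_a B, fb_b B[)
      pairing (phi (fb_F B t s) (fb_dF B t s)) (fb_generator B t s).

Definition fb_length_integral (mu : transverse_measure) (B : flow_box)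
    (psi : 'cV[R]_3 -> R) : R :=
  \int[mu B]_(s in `[fb_c B, fb_d B])
    \int[lebesgue_measure]_(t in `[fb_a B, fb_b B])
      (psi (fb_F B t s) * hnorm (fb_dF B t s)).

(* r is computed from a decomposition of phi into forms supported in
   flow-boxes.  Flow-boxes need only cover the lamination, so the decomposition
   is required along the lamination; on the rest of M one could complete it by
   forms supported in flow-boxes with empty C, which contribute 0. *)
Definition Bdmu_value (mu : transverse_measure)
    (phi : 'cV[R]_3 -> 'cV[R]_3 -> 'M[R]_3) (r : R) : Prop :=
  exists n (B : 'I_n -> flow_box) (phi_ : 'I_n -> 'cV[R]_3 -> 'cV[R]_3 -> 'M[R]_3),
  [/\ forall i, ad_form sigma (phi_ i),
      forall i X v, hyperboloid X -> tangent X v -> ~ fb_region (B i) X ->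
        phi_ i X v = 0,
      forall X v, lam_support X -> tangent X v -> phi X v = \sum_(i < n) phi_ i X v &
      r = \sum_(i < n) fb_form_integral mu (B i) (phi_ i)].

(* The functional B dmu; its value is independent of the decomposition. *)
Definition Bdmu (mu : transverse_measure)
    (phi : 'cV[R]_3 -> 'cV[R]_3 -> 'M[R]_3) : R :=
  xget 0 [set r | Bdmu_value mu phi r].

(* Finitely many flow-boxes whose interiors cover the lamination, with a
   partition of unity subordinate to the cover. *)
Record flow_box_cover (n : nat) (B : 'I_n -> flow_box)
    (psi : 'I_n -> 'cV[R]_3 -> R) : Prop := FlowBoxCover {
  fc_cover : lam_support `<=` \bigcup_i fb_interior (B i);
  fc_smooth : forall i, smooth_function sigma (psi i);
  fc_ge0 : forall i X, hyperboloid X -> 0 <= psi i X;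
  fc_supp : forall i,
    closure [set X | hyperboloid X /\ psi i X != 0] `<=` fb_interior (B i);
  fc_sum : forall X, lam_support X -> \sum_(i < n) psi i X = 1
}.

Definition lamination_length (mu : transverse_measure) (n : nat)
    (B : 'I_n -> flow_box) (psi : 'I_n -> 'cV[R]_3 -> R) : R :=
  \sum_(i < n) fb_length_integral mu (B i) (psi i).

End Lamination.

(* Main.v *)
Require Import Defs.
From HB Require Import structures.
From mathcomp Require Import all_boot all_order all_algebra.
From mathcomp Require Import all_classical all_reals all_analysis.
From mathcomp Require Import measurable_realfun ring lra.
Import Order.TTheory GRing.Theory Num.Theory.
Import numFieldNormedType.Exports.
Local Open Scope classical_set_scope.
Local Open Scope ring_scope.

Set Implicit Arguments.
Unset Strict Implicit.
Unset Printing Implicit Defensive.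

(** The mass is a maximum, attained at the tautological form [beta].

    A leaf has a unit tangent vector e at each of its points X, up to sign, and
    a Lie algebra valued form [phi] has a [density] along the lamination, the
    pairing of [phi X e] with [beta X e].  The functional integrates this density
    against arclength along the leaves and against the transverse measure.  The
    image of [beta X] carries twice the metric of the tangent plane, so [beta]
    has density 2 and singular values equal to the square root of 2: it is
    admissible, and its value is twice the length.  Conversely, if [phi] takes
    its values in the image of [beta] and has singular values at most the square
    root of 2, then its density is at most 2 ([density_le2]).  Since the
    functions of the partition of unity are nonnegative, no value of the
    functional exceeds twice the length ([cover_value_le]).

    For this the value of the functional has to be computed with the cover that
    defines the length, while an arbitrary decomposition of the form may have
    been used.  Cutting the pieces of a decomposition by the partition of unity
    reduces the question to a form that is supported in two flow-boxes A and B at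
    once, whose integrals over A and B have to agree ([box_change]).

    That comparison has an analytic and a geometric part.  The analytic part
    deals with boxes that are only Lipschitz.  On a plaque the arclength parameter
    is a monotone Lipschitz function, hence the integral of its derivative
    ([lipschitz_FTC]); so the box integral is an iterated integral of the density
    against a speed whose integral over a segment is hyperbolic length
    ([fb_speed_ex], [form_integralE]).  The density is continuous in the
    parameters of the box, because the direction of a leaf is determined by the
    two ends of its plaque ([density_extE]).

    In the geometric part A is divided into small cells.  On a cell where the
    density is not small, the form does not vanish, so the cell lies in the
    region of B.  Each of its plaques then runs along a single plaque of B, because
    the transversal contains no interval, and up to a single element of the group,
    because the action is properly discontinuous and free ([plaque_transition]).
    The cell becomes a strip of B with the same lengths and, by compatibility, the
    same transverse measure ([piece_transfer]).  Hence one Riemann sum over the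
    cells of A approximates both integrals ([box_estimate]). *)

(** * Integrals of functions altered on a null set *)

Section NullSet.
Context d (T : measurableType d) (R : realType) (mu : {measure set T -> \bar R}).

Import HBNNSimple.

(** The integral is a supremum over the simple functions below the integrand,
    and cutting a simple function to the complement of [N] does not change its
    integral. The integrands met below contain derivatives that exist only
    almost everywhere, so their measurability is not at hand. *)
Lemma le_integral_off_null (N : set T) (f g : T -> \bar R) :
  measurable N -> mu N = 0%E ->
  (forall x, 0 <= f x)%E -> (forall x, 0 <= g x)%E ->
  (forall x, ~ N x -> (f x <= g x)%E) ->
  (\int[mu]_x f x <= \int[mu]_x g x)%E.
Proof.
move=> mN N0 f0 g0 fg.
rewrite [leLHS]ge0_integralTE//; apply: ge_ereal_sup => _ [h /= hf <-].
rewrite -integralT_nnsfun.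
have mCN : measurable (~` N) by exact: measurableC.
have -> : (\int[mu]_x (h x)%:E = \int[mu]_(x in ~` N) (h x)%:E)%E.
  rewrite -setTD; apply: ge0_negligible_integral => //.
    exact/measurable_EFinP/measurable_funP.
  by move=> x _; rewrite lee_fin.
rewrite integral_mkcond [leRHS]ge0_integralTE//.
have -> : (EFin \o h) \_ (~` N) = EFin \o (proj_nnsfun h mCN).
  by apply/funext => x; rewrite patchE /= /proj_nnsfun /= mindicE /=; case: ifPn => xN;
    rewrite ?mulr1 ?mulr0.
rewrite integralT_nnsfun; apply: ereal_sup_ubound.
exists (proj_nnsfun h mCN) => // x /=; rewrite mindicE.
case: (boolP (x \in ~` N)) => [/set_mem xN|_]; rewrite ?mulr1 ?mulr0 //.
exact: le_trans (hf x) (fg x xN).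
Qed.

Lemma eq_integral_off_null (N D : set T) (f g : T -> \bar R) :
  measurable N -> mu N = 0%E ->
  (forall x, D x -> ~ N x -> f x = g x) ->
  (\int[mu]_(x in D) f x = \int[mu]_(x in D) g x)%E.
Proof.
move=> mN N0 fg.
have E x : ~ N x -> (f \_ D) x = (g \_ D) x.
  by move=> Nx; rewrite !patchE; case: ifPn => // /set_mem Dx; exact: fg.
rewrite integral_mkcond [RHS]integral_mkcond integralE [RHS]integralE.
congr (_ - _)%E; apply/eqP; rewrite eq_le; apply/andP; split;
  apply: (le_integral_off_null mN N0) => // x Nx; by rewrite ?funeposE ?funenegE E.
Qed.

Lemma eq_Rintegral_ae (D : set T) (f g : T -> R) :
  {ae mu, forall x, D x -> f x = g x} ->
  \int[mu]_(x in D) f x = \int[mu]_(x in D) g x.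
Proof.
move=> [N [mN N0 sub]]; rewrite /Rintegral; congr fine.
apply: eq_integral_off_null mN N0 _ => x Dx Nx; congr EFin.
by apply: contrapT => nfg; apply: Nx; apply: sub => /= h; apply: nfg; exact: h.
Qed.

End NullSet.

(** * Monotone Lipschitz functions are integrals of their derivatives *)

Section LipschitzFTC.
Variable R : realType.
Local Notation leb := (@lebesgue_measure R).

Lemma stieltjes_itv (U : cumulative R R) (x y : R) : x <= y ->
  lebesgue_stieltjes_measure U `]x, y]%classic = (U y - U x)%:E.
Proof.
move=> xy; rewrite /lebesgue_stieltjes_measure /measure_extension measurable_mu_extE /=;
  last by exists (x, y).
by rewrite wlength_itv_bnd.
Qed.

(** A half-open interval has Stieltjes measure at most [K] times its length,
    and both outer measures are infima over covers by half-open intervals. *)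
Lemma stieltjes_dominates (U : cumulative R R) (K : R) : 0 <= K ->
  (forall x y, x <= y -> U y - U x <= K * (y - x)) ->
  forall A, leb A = 0%E -> lebesgue_stieltjes_measure U A = 0%E.
Proof.
move=> K0 lipU A A0; apply/eqP; rewrite eq_le measure_ge0 andbT.
apply/lee_addgt0Pr => e e0; rewrite add0e.
have eK : 0 < e / (K + 1) by rewrite divr_gt0 // ltr_wpDl.
have : (leb A < (e / (K + 1))%:E)%E by rewrite A0 lte_fin.
rewrite {1}/lebesgue_measure /= /lebesgue_stieltjes_measure /= /measure_extension.
move=> /ereal_inf_lt [_ [F [mF AF] <-] Fe].
apply: (@le_trans _ _ (\sum_(k <oo) wlength U (F k))%E).
  by apply: ereal_inf_lbound; exists F.
apply: (@le_trans _ _ (\sum_(k <oo) K%:E * wlength idfun (F k))%E).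
  apply: lee_nneseries => [k _ _|k _]; first exact: wlength_ge0.
  have /ocitvP[->|[[x y] /= xy ->]] := mF k; first by rewrite !wlength0 mule0.
  by rewrite !wlength_itv_bnd ?(ltW xy) // -EFinM lee_fin lipU // ltW.
rewrite nneseriesZl; last by move=> k _; exact: wlength_ge0.
apply: (@le_trans _ _ (K%:E * (e / (K + 1))%:E)%E).
  by apply: lee_wpmul2l; rewrite ?lee_fin // ltW.
rewrite -EFinM lee_fin mulrA ler_pdivrMr; last by rewrite ltr_wpDl.
by rewrite mulrC ler_pM2l // lerDl ler01.
Qed.

(** The Stieltjes measure of [u], restricted to the interval, is absolutely
    continuous, so it has a Radon-Nikodym density [r]; by the Lebesgue
    differentiation theorem [r] is almost everywhere the derivative of [u]. *)
Lemma lipschitz_FTC (u : R -> R) (K a b : R) : a < b -> 0 <= K ->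
  {homo u : x y / x <= y} ->
  (forall x y, x <= y -> u y - u x <= K * (y - x)) ->
  exists r : R -> R, [/\ measurable_fun [set: R] r,
    forall x, 0 <= r x,
    forall x y, a <= x -> x <= y -> y <= b ->
      leb.-integrable `[x, y]%classic (EFin \o r) /\
      \int[leb]_(t in `[x, y]%classic) r t = u y - u x &
    {ae leb, forall t, `]a, b[%classic t -> derivable u t 1 /\ derive1 u t = r t}].
Proof.
move=> ab K0 und ulip.
have uc : continuous u.
  move=> x; apply/cvgrPdist_lt => e e0.
  have eK : 0 < e / (K + 1) by rewrite divr_gt0 // ltr_wpDl.
  near=> y.
  have xy : `|x - y| < e / (K + 1) by near: y; exact: cvgr_dist_lt.
  have le1 : `|u x - u y| <= K * `|x - y|.
    case: (leP x y) => h.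
      by rewrite distrC (distrC x) !ger0_norm ?subr_ge0 ?und ?ulip.
    by rewrite !ger0_norm ?subr_ge0 ?ulip ?und // ltW.
  apply: le_lt_trans le1 _.
  have : `|x - y| * (K + 1) < e by rewrite -ltr_pdivlMr // ltr_wpDl.
  apply: le_lt_trans; rewrite mulrDr mulr1 mulrC lerDl; exact: normr_ge0.
pose U : cumulative R R :=
  HB.pack u (isCumulative.Build R _ R u und (right_continuousW uc)).
have muab : (lebesgue_stieltjes_measure U `]a, b]%classic < +oo)%E.
  by rewrite stieltjes_itv ?(ltW ab) // ltry.
have mab : measurable (`]a, b]%classic : set (measurableTypeR R)) by [].
pose nu : {finite_measure set (measurableTypeR R) -> \bar R} := mfrestr mab muab.
have dom : nu `<< leb.
  apply/null_content_dominatesP => A mA A0.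
  rewrite /nu /= /mfrestr /mrestr /=; apply: (@stieltjes_dominates U K K0 ulip).
  apply: subset_measure0 A0 => //; exact: measurableI.
have [f [f0 ffin intf fE]] := radon_nikodym_sigma_finite dom.
pose r := fine \o f.
have rE x : (r x)%:E = f x by rewrite /r /= fineK.
have intr (D : set R) : measurable D -> leb.-integrable D (EFin \o r).
  move=> mD; rewrite (_ : EFin \o r = f); last by apply/funext => x; exact: rE.
  exact: integrableS intf.
have intE x y : a <= x -> x <= y -> y <= b ->
   \int[leb]_(t in `]x, y]%classic) r t = u y - u x.
  move=> ax xy yb; rewrite /Rintegral.
  under eq_integral do rewrite rE.
  rewrite -fE // /nu /= /mfrestr /mrestr setIidl ?stieltjes_itv //.
  by apply: subset_itv; rewrite bnd_simp.
exists r; split => //.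
- by apply/measurable_EFinP; case/integrableP: (intr setT measurableT).
- by move=> x; rewrite fine_ge0.
- move=> x y ax xy yb; split; first exact: intr.
  rewrite -intE //.
  rewrite -(@Rintegral_itv_obnd_cbnd _ x (BRight y)) //.
  exact: intr.
have /= := @FTC1 R r (BRight a) (fun y => intr _ (measurable_itv _))
  (open_integrable_locally openT (intr _ measurableT)).
apply: filterS; first exact: (ae_filter_ringOfSetsType leb).
move=> t ht; rewrite /= in_itv /= => /andP[at_ tb].
have {ht}[dF F'] := ht at_.
have E : {near t, (fun y => \int[leb]_(t in `]a, y]%classic) r t) =1 (fun y => u y - u a)}.
  near=> y; apply: intE => //; apply: ltW; near: y.
    exact: lt_nbhsr.
  exact: lt_nbhsl.
have dF2 : derivable (fun y => u y - u a) t 1.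
  by apply: near_eq_derivable E dF.
have uE : u = (fun y => u y - u a) + cst (u a).
  by apply/funext => y; rewrite /= fctE subrK.
have dcst : derivable (cst (u a) : R -> R) t 1 by exact: derivable_cst.
split; first by rewrite uE; apply: derivableD.
rewrite derive1E uE deriveD // derive_cst addr0 -F' derive1E.
by apply/esym; apply: near_eq_derive.
Unshelve. all: by end_near. Qed.

End LipschitzFTC.

(** * Minkowski space, the hyperboloid and its geodesics *)

Section Minkowski.
Variable R : realType.
Implicit Types (X Y Z u v w : 'cV[R]_3) (A B : 'M[R]_3) (s t a b : R).

Lemma sum_ord3 (V : nmodType) (f : 'I_3 -> V) :
  \sum_(i < 3) f i = f 0 + f 1 + f ord_max.
Proof.
rewrite !big_ord_recl big_ord0 addr0 addrA.
by congr (f _ + f _ + f _); apply: val_inj.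
Qed.

Lemma esharpE i j : (@esharp R) i j =
  (if i == ord_max then -1 else 1) *+ (i == j).
Proof. by rewrite /esharp !mxE. Qed.

Lemma sharpE X j : sharp X 0 j = (if j == ord_max then - X j 0 else X j 0).
Proof.
rewrite /sharp mxE mxE (bigD1 j) //= big1 ?addr0; last first.
  by move=> i ij; rewrite esharpE [j == i]eq_sym (negPf ij) mulr0n mul0r.
by rewrite esharpE eqxx mulr1n; case: ifP; rewrite ?mulN1r ?mul1r.
Qed.

Lemma ipE X Y : ip X Y =
  X 0 0 * Y 0 0 + X 1 0 * Y 1 0 - X ord_max 0 * Y ord_max 0.
Proof. by rewrite /ip mxE sum_ord3 !sharpE /= mulNr. Qed.

Lemma ipC X Y : ip X Y = ip Y X.
Proof. by rewrite !ipE; ring. Qed.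
Lemma ipDl X Y Z : ip (X + Y) Z = ip X Z + ip Y Z.
Proof. by rewrite !ipE !mxE; ring. Qed.
Lemma ipDr X Y Z : ip X (Y + Z) = ip X Y + ip X Z.
Proof. by rewrite !ipE !mxE; ring. Qed.
Lemma ipZl a X Y : ip (a *: X) Y = a * ip X Y.
Proof. by rewrite !ipE !mxE; ring. Qed.
Lemma ipZr a X Y : ip X (a *: Y) = a * ip X Y.
Proof. by rewrite !ipE !mxE; ring. Qed.
Lemma ipNl X Y : ip (- X) Y = - ip X Y.
Proof. by rewrite !ipE !mxE; ring. Qed.
Lemma ipNr X Y : ip X (- Y) = - ip X Y.
Proof. by rewrite !ipE !mxE; ring. Qed.
Lemma ip0r X : ip X 0 = 0.
Proof. by rewrite !ipE !mxE; ring. Qed.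
Definition ip_lin := (ipDl, ipDr, ipZl, ipZr, ipNl, ipNr).

Lemma cV3P X Y : X 0 0 = Y 0 0 -> X 1 0 = Y 1 0 -> X ord_max 0 = Y ord_max 0 -> X = Y.
Proof.
move=> h0 h1 h2; apply/matrixP => i j; rewrite ord1; case: i => -[|[|[|//]]] hi.
- by rewrite (_ : Ordinal hi = 0) //; apply: val_inj.
- by rewrite (_ : Ordinal hi = 1) //; apply: val_inj.
- by rewrite (_ : Ordinal hi = ord_max) //; apply: val_inj.
Qed.

Lemma hyp_ip X : hyperboloid X -> ip X X = -1. Proof. by case. Qed.
Lemma hyp_ge1 X : hyperboloid X -> 1 <= X ord_max 0. Proof. by case. Qed.

Lemma hyp_sq X : hyperboloid X ->
  X ord_max 0 ^+ 2 = 1 + X 0 0 ^+ 2 + X 1 0 ^+ 2.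
Proof. by move=> [+ _]; rewrite ipE => h; rewrite !expr2; lra. Qed.

(** Orthogonality to [X] expresses the third coordinate of [v] as an inner
    product of the first two with those of [X] divided by the height of [X];
    Cauchy-Schwarz then bounds it. In particular the Minkowski form is
    positive definite on tangent planes. *)
Lemma tangent_sq_le X v : hyperboloid X -> tangent X v ->
  v 0 0 ^+ 2 + v 1 0 ^+ 2 <= X ord_max 0 ^+ 2 * ip v v /\
  v ord_max 0 ^+ 2 <= v 0 0 ^+ 2 + v 1 0 ^+ 2.
Proof.
move=> hX; rewrite /tangent /= ipE => tv.
have := hyp_sq hX; have := hyp_ge1 hX; rewrite !ipE.
set x := X 0 0 in tv *; set y := X 1 0 in tv *; set z := X ord_max 0 in tv *.
set a := v 0 0 in tv *; set b := v 1 0 in tv *; set c := v ord_max 0 in tv *.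
move=> z1 zE.
have e : z * c = x * a + y * b by lra.
have CS : (z * c) ^+ 2 <= (z ^+ 2 - 1) * (a ^+ 2 + b ^+ 2).
  rewrite e -subr_ge0 zE.
  rewrite (_ : _ - _ = (x * b - y * a) ^+ 2); last by ring.
  exact: sqr_ge0.
rewrite exprMn in CS.
split; first by rewrite -subr_ge0 (_ : _ - _ =
   (z ^+ 2 - 1) * (a ^+ 2 + b ^+ 2) - z ^+ 2 * c ^+ 2); [rewrite subr_ge0 | ring].
have z2 : 1 <= z ^+ 2 by rewrite expr_ge1 // (le_trans _ z1).
have ab : 0 <= a ^+ 2 + b ^+ 2 by rewrite addr_ge0 ?sqr_ge0.
have c0 : 0 <= c ^+ 2 by rewrite sqr_ge0.
have z0 : 0 < z ^+ 2 by lra.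
by rewrite -(ler_pM2l z0); lra.
Qed.

Lemma tangent_ip_ge0 X v : hyperboloid X -> tangent X v -> 0 <= ip v v.
Proof.
move=> hX tv; have [h _] := tangent_sq_le hX tv.
have z2 : 0 < X ord_max 0 ^+ 2 by rewrite exprn_gt0 // (lt_le_trans _ (hyp_ge1 hX)).
rewrite -(pmulr_rge0 _ z2); apply: le_trans h.
by rewrite addr_ge0 ?sqr_ge0.
Qed.

Lemma tangent_ip_eq0 X v : hyperboloid X -> tangent X v -> ip v v = 0 -> v = 0.
Proof.
move=> hX tv v0; have [] := tangent_sq_le hX tv; rewrite v0 mulr0 => h1 h2.
have a2 := sqr_ge0 (v 0 0); have b2 := sqr_ge0 (v 1 0).
have c2 := sqr_ge0 (v ord_max 0).
have sq0 (a : R) : a ^+ 2 = 0 -> a = 0 by move/eqP; rewrite sqrf_eq0 => /eqP.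
by apply: cV3P; rewrite !mxE; apply: sq0; lra.
Qed.

Lemma tangent_ip_gt0 X v : hyperboloid X -> tangent X v -> v != 0 -> 0 < ip v v.
Proof.
move=> hX tv v0; rewrite lt_neqAle (tangent_ip_ge0 hX tv) andbT eq_sym.
by apply: contra v0 => /eqP /(tangent_ip_eq0 hX tv) ->.
Qed.

(** Reversed Cauchy-Schwarz inequality for unit timelike vectors: after
    squaring, the two sides differ by a sum of three squares. *)
Lemma ip_hyp_le X Y : hyperboloid X -> hyperboloid Y -> ip X Y <= -1.
Proof.
move=> hX hY; have := hyp_sq hX; have := hyp_sq hY.
have := hyp_ge1 hX; have := hyp_ge1 hY; rewrite ipE.
set x := X 0 0; set y := X 1 0; set z := X ord_max 0.
set a := Y 0 0; set b := Y 1 0; set c := Y ord_max 0 => c1 z1 cE zE.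
suff : 1 + x * a + y * b <= z * c by lra.
have zc : 0 <= z * c by apply: mulr_ge0; lra.
case: (leP 0 (1 + x * a + y * b)) => [h|]; last by lra.
rewrite -(ler_pXn2r (n := 2)) // ?nnegrE // exprMn cE zE -subr_ge0.
rewrite (_ : _ - _ = (x - a) ^+ 2 + (y - b) ^+ 2 + (x * b - y * a) ^+ 2); last by ring.
by rewrite !addr_ge0 ?sqr_ge0.
Qed.

Lemma proj_tangent X Y : hyperboloid X -> tangent X (Y + ip X Y *: X).
Proof. by move=> hX; rewrite /tangent /= !ip_lin hyp_ip //; lra. Qed.

Lemma ip_proj X Y : hyperboloid X -> hyperboloid Y ->
  ip (Y + ip X Y *: X) (Y + ip X Y *: X) = ip X Y ^+ 2 - 1.
Proof. by move=> hX hY; rewrite !ip_lin !hyp_ip // (ipC Y X); ring. Qed.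

(** The tangential component of [Y] at [X] has square norm [ip X Y ^+ 2 - 1],
    hence vanishes. *)
Lemma hyp_eq X Y : hyperboloid X -> hyperboloid Y -> ip X Y = -1 -> X = Y.
Proof.
move=> hX hY e.
have /(_ _) := tangent_ip_eq0 hX (@proj_tangent X Y hX).
rewrite ip_proj // e => /(_ ltac:(ring)); rewrite scaleN1r => /eqP.
by rewrite subr_eq0 => /eqP.
Qed.

Lemma ip_hyp_neq X Y : hyperboloid X -> hyperboloid Y -> X <> Y -> ip X Y < -1.
Proof.
move=> hX hY XY; rewrite lt_neqAle ip_hyp_le // andbT.
by apply/eqP => /hyp_eq; auto.
Qed.

Lemma coshE t : cosh t = (expR t + (expR t)^-1) / 2.
Proof. by rewrite /cosh expRN. Qed.
Lemma sinhE t : sinh t = (expR t - (expR t)^-1) / 2.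
Proof. by rewrite /sinh expRN. Qed.

Lemma cosh_add s t : cosh (s + t) = cosh s * cosh t + sinh s * sinh t.
Proof.
rewrite !coshE !sinhE expRD; have := expR_gt0 s; have := expR_gt0 t => a b.
by field; rewrite !gt_eqF.
Qed.
Lemma sinh_add s t : sinh (s + t) = sinh s * cosh t + cosh s * sinh t.
Proof.
rewrite !coshE !sinhE expRD; have := expR_gt0 s; have := expR_gt0 t => a b.
by field; rewrite !gt_eqF.
Qed.
Lemma coshN t : cosh (- t) = cosh t.
Proof. by rewrite /cosh opprK addrC. Qed.
Lemma sinhN t : sinh (- t) = - sinh t.
Proof. by rewrite /sinh opprK -mulNr opprB. Qed.
Lemma cosh0 : cosh 0 = 1 :> R.
Proof. by rewrite /cosh oppr0 expR0; field. Qed.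
Lemma sinh0 : sinh 0 = 0 :> R.
Proof. by rewrite /sinh oppr0 expR0; field. Qed.
Lemma cosh2 t : cosh t ^+ 2 = 1 + sinh t ^+ 2.
Proof. have := cosh_add t (- t); rewrite subrr cosh0 coshN sinhN => h; rewrite !expr2; lra. Qed.
Lemma cosh_ge1 t : 1 <= cosh t.
Proof.
have c0 : 0 <= cosh t by rewrite divr_ge0 // addr_ge0 // expR_ge0.
rewrite -(ler_pXn2r (n := 2)) ?nnegrE // expr1n cosh2 lerDl sqr_ge0 //.
Qed.
Lemma sinh_ge0 t : 0 <= t -> 0 <= sinh t.
Proof. by move=> t0; rewrite divr_ge0 // subr_ge0 ler_expR; lra. Qed.
Lemma sinh_gt0 t : 0 < t -> 0 < sinh t.
Proof. by move=> t0; rewrite divr_gt0 // subr_gt0 ltr_expR; lra. Qed.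
Lemma sinh_neq0 t : t != 0 -> sinh t != 0.
Proof.
move=> t0; case: (ltP 0 t) => h; first by rewrite gt_eqF // sinh_gt0.
rewrite -oppr_eq0 -sinhN gt_eqF // sinh_gt0 // oppr_gt0 lt_neqAle t0 h //.
Qed.

Lemma arccosh_cosh t : arccosh (cosh t) = `|t|.
Proof.
rewrite /arccosh.
have -> : cosh t ^+ 2 - 1 = sinh t ^+ 2 by rewrite cosh2; ring.
have sE (s : R) : 0 <= s -> ln (cosh s + sinh s) = s.
  move=> s0; have -> : cosh s + sinh s = expR s by rewrite /cosh /sinh; field.
  by rewrite expRK.
rewrite sqrtr_sqr; case: (leP 0 t) => t0.
  by rewrite ger0_norm ?sinh_ge0 // sE // ger0_norm.
rewrite -normrN -sinhN ger0_norm ?sinh_ge0 ?oppr_ge0 ?ltW //.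
by rewrite -coshN sE ?oppr_ge0 ?ltW // ltr0_norm.
Qed.

(** The unit speed geodesic from [X] with initial velocity [v]; [dgam] is its
    velocity. *)
Definition gam X v t : 'cV[R]_3 := cosh t *: X + sinh t *: v.
Definition dgam X v t : 'cV[R]_3 := sinh t *: X + cosh t *: v.

Lemma gam_add X v s t : gam X v (s + t) = cosh t *: gam X v s + sinh t *: dgam X v s.
Proof.
by rewrite /gam /dgam cosh_add sinh_add; apply/matrixP => i j; rewrite !mxE; ring.
Qed.
Definition unit_tangent X v := [/\ hyperboloid X, tangent X v & ip v v = 1].

Lemma ip_gam X v s t : unit_tangent X v -> ip (gam X v s) (gam X v t) = - cosh (s - t).
Proof.
move=> [hX tv v1]; rewrite /gam !ip_lin (ipC v X) tv v1 (hyp_ip hX).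
by rewrite cosh_add coshN sinhN; ring.
Qed.
Lemma ip_gam_dgam X v t : unit_tangent X v -> ip (gam X v t) (dgam X v t) = 0.
Proof.
move=> [hX tv v1]; rewrite /gam /dgam !ip_lin (ipC v X) tv v1 (hyp_ip hX); ring.
Qed.
Lemma ip_dgam X v t : unit_tangent X v -> ip (dgam X v t) (dgam X v t) = 1.
Proof.
move=> [hX tv v1]; rewrite /gam /dgam !ip_lin (ipC v X) tv v1 (hyp_ip hX).
have := cosh2 t => h; rewrite -[RHS](addrK (sinh t ^+ 2)) -h; ring.
Qed.

(** Unit timelike vectors form two sheets, and a point on the lower one has a
    product at least 1 with [X]. *)
Lemma upper_sheet X Y : hyperboloid X -> ip Y Y = -1 -> ip X Y < 0 -> hyperboloid Y.
Proof.
move=> hX Y1 XY; split => //.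
have : 1 <= Y ord_max 0 ^+ 2.
  move: Y1; rewrite ipE => Y1; have := sqr_ge0 (Y 0 0); have := sqr_ge0 (Y 1 0).
  rewrite !expr2; lra.
have -> : 1 <= Y ord_max 0 ^+ 2 = (1 <= `|Y ord_max 0|).
  by rewrite -(real_normK (num_real _)) expr_ge1.
case: (leP 0 (Y ord_max 0)) => h; first by rewrite ger0_norm.
rewrite ltr0_norm // => h1.
have hN : hyperboloid (- Y) by split; rewrite ?mxE // !ip_lin opprK.
by have := ip_hyp_le hX hN; rewrite !ip_lin; lra.
Qed.

Lemma gam_unit X v t : unit_tangent X v -> unit_tangent (gam X v t) (dgam X v t).
Proof.
move=> uXv; split; [|exact: ip_gam_dgam|exact: ip_dgam].
have [hX tv v1] := uXv.
apply: (upper_sheet hX); first by rewrite ip_gam // subrr cosh0.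
rewrite /gam !ip_lin tv (hyp_ip hX); have := cosh_ge1 t; lra.
Qed.

Lemma gam0 X v : gam X v 0 = X.
Proof. by rewrite /gam cosh0 sinh0 scale1r scale0r addr0. Qed.

Lemma geodesic_line_shift X v t :
  geodesic_line (gam X v t) (dgam X v t) = geodesic_line X v.
Proof.
apply/seteqP; split => _ [s _ <-].
  by exists (t + s) => //; rewrite -/(gam X v (t + s)) gam_add.
exists (s - t) => //.
by rewrite -/(gam (gam X v t) (dgam X v t) (s - t)) /gam -gam_add addrC subrK.
Qed.

(** The point at parameter 1 of the first line is at parameter [t] on the
    second; comparing products with [X] gives [cosh t = cosh 1], so that [sinh
    t] is [sinh 1] up to sign. *)
Lemma line_dir_uniq X v w : unit_tangent X v -> unit_tangent X w ->
  geodesic_line X v `<=` geodesic_line X w -> v = w \/ v = - w.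
Proof.
move=> uv uw sub.
have [t _ ht] : geodesic_line X w (gam X v 1) by apply: sub; exists 1.
rewrite -/(gam X w t) in ht.
have [hX tv v1] := uv; have [_ tw w1] := uw.
have c1 : cosh t = cosh 1.
  have := congr1 (fun z => ip X z) ht.
  by rewrite /gam !ip_lin tv tw (hyp_ip hX); lra.
have s1 : sinh 1 != 0 :> R by rewrite sinh_neq0 // oner_eq0.
have vE : sinh t *: w = sinh 1 *: v.
  by move: ht; rewrite /gam c1 => /addrI.
have : sinh t ^+ 2 = sinh 1 ^+ 2.
  by have := cosh2 t; have := cosh2 1; rewrite c1; lra.
move/eqP; rewrite eqf_sqr => /orP[] /eqP e; rewrite e in vE.
  by left; apply/esym; exact: (scalerI s1 vE).
by right; apply: (scalerI s1); rewrite -vE scaleNr scalerN.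
Qed.

Lemma distH_gam X v s t : unit_tangent X v ->
  distH (gam X v s) (gam X v t) = `|s - t|.
Proof. by move=> u; rewrite /distH ip_gam // opprK arccosh_cosh. Qed.

Lemma exp_arccosh (c : R) : 1 <= c -> expR (arccosh c) = c + Num.sqrt (c ^+ 2 - 1).
Proof.
move=> c1; rewrite /arccosh lnK // posrE ltr_wpDr ?sqrtr_ge0 //.
exact: lt_le_trans c1.
Qed.

Lemma distH_ge0 X Y : hyperboloid X -> hyperboloid Y -> 0 <= distH X Y.
Proof.
move=> hX hY; have h := ip_hyp_le hX hY; rewrite -ler_expR expR0 exp_arccosh; last by lra.
by have := sqrtr_ge0 ((- ip X Y) ^+ 2 - 1); lra.
Qed.

(** Let d be the distance of [X] and [Y]. The components of [Y] along [X] and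
    tangent to [X] have sizes cosh d and sinh d, and both cosh d - 1 and sinh
    d are at most exp d - 1; the coordinates of tangent vectors are controlled
    by [tangent_sq_le]. The bound depends on [X] through its height only, so
    it is uniform on bounded sets. *)
Lemma coord_distH X Y i : hyperboloid X -> hyperboloid Y ->
  `|Y i 0 - X i 0| <= 2 * X ord_max 0 * (expR (distH X Y) - 1).
Proof.
move=> hX hY; have XY := ip_hyp_le hX hY.
rewrite exp_arccosh; last by lra.
set c := - ip X Y; set q := Num.sqrt _.
have c1 : 1 <= c by rewrite /c; lra.
have q0 : 0 <= q by exact: sqrtr_ge0.
have z1 := hyp_ge1 hX.
set z := X ord_max 0 in z1 *.
set w := Y + ip X Y *: X.
have tw : tangent X w by exact: proj_tangent.
have ww : ip w w = q ^+ 2.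
  rewrite ip_proj // sqr_sqrtr /c ?sqrrN // subr_ge0.
  by rewrite -sqrrN expr_ge1 //; lra.
have [w1 w2] := tangent_sq_le hX tw.
rewrite -/z ww -exprMn in w1.
have zq : 0 <= z * q by apply: mulr_ge0; lra.
have sqn (a b : R) : 0 <= b -> a ^+ 2 <= b ^+ 2 -> `|a| <= b.
  by move=> b0 ab; rewrite -(ler_pXn2r (n := 2)) ?nnegrE // real_normK // num_real.
have i3 : i = 0 \/ i = 1 \/ i = ord_max.
  by case: i => -[|[|[|//]]] hi; [left|right;left|right;right]; apply: val_inj.
have wi : `|w i 0| <= z * q.
  apply: sqn => //; have a0 := sqr_ge0 (w 0 0); have a1 := sqr_ge0 (w 1 0).
  by case: i3 => [|[]] ->; lra.
have Xi : `|X i 0| <= z.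
  apply: sqn; first by lra.
  have := hyp_sq hX; rewrite -/z; have a0 := sqr_ge0 (X 0 0); have a1 := sqr_ge0 (X 1 0).
  by case: i3 => [|[]] ->; rewrite -?/z; lra.
have -> : Y i 0 - X i 0 = w i 0 + (c - 1) * X i 0.
  by rewrite /w /c !mxE; ring.
apply: (le_trans (ler_normD _ _)); rewrite normrM (ger0_norm (_ : 0 <= c - 1)); last by lra.
have h1 : (c - 1) * `|X i 0| <= (c - 1) * z by apply: ler_wpM2l => //; lra.
have h2 : 0 <= z * (c - 1) by apply: mulr_ge0; lra.
by lra.
Qed.

End Minkowski.

(** * Isometries, the pairing of matrices and tangent frames *)

Section Isometries.
Variable R : realType.
Implicit Types (X Y Z u v w : 'cV[R]_3) (A P Q S : 'M[R]_3) (a : R).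

Lemma esharp_tr : (esharp R)^T = esharp R.
Proof. by rewrite /esharp tr_diag_mx. Qed.

Lemma so_unit A : SOplus21 A -> A \in unitmx.
Proof. by move=> [_ dA _]; rewrite unitmxE dA unitr1. Qed.

Lemma so_inv_tr A : SOplus21 A -> A^T *m esharp R = esharp R *m invmx A.
Proof.
by move=> hA; case: (hA) => e _ _; rewrite -[in RHS]e mulmxK // so_unit.
Qed.

Lemma sharp_mul A X : SOplus21 A -> sharp (A *m X) = sharp X *m invmx A.
Proof.
move=> hA; rewrite /sharp !trmx_mul esharp_tr -!mulmxA so_inv_tr //.
Qed.

Lemma ip_mul A X Y : SOplus21 A -> ip (A *m X) (A *m Y) = ip X Y.
Proof.
by move=> hA; rewrite /ip sharp_mul // mulmxA -(mulmxA _ (invmx A)) mulVmx ?so_unit // mulmx1.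
Qed.

Lemma tangent_mul A X v : SOplus21 A -> tangent X v -> tangent (A *m X) (A *m v).
Proof. by move=> hA; rewrite /tangent /= ip_mul. Qed.

Lemma hyp_mul A X : SOplus21 A -> hyperboloid X -> hyperboloid (A *m X).
Proof.
move=> hA hX; have [_ _ A33] := hA.
pose e3 : 'cV[R]_3 := \col_i (i == ord_max)%:R.
have he : hyperboloid e3.
  by split; rewrite ?ipE !mxE /= ?mulr0 ?mulr1 ?add0r.
have hAe : hyperboloid (A *m e3).
  split; first by rewrite ip_mul // (hyp_ip he).
  have z0 : 0 < (A *m e3) ord_max 0.
    by rewrite !mxE sum_ord3 !mxE /= !mulr0 mulr1 !add0r.
  have := ip_mul e3 e3 hA; rewrite (hyp_ip he) ipE.
  set x := (A *m e3) 0 0; set y := (A *m e3) 1 0; set z := (A *m e3) ord_max 0 in z0 *.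
  move=> h; rewrite -(ler_pXn2r (n := 2)) ?nnegrE ?(ltW z0) // expr1n.
  by have := sqr_ge0 x; have := sqr_ge0 y; rewrite !expr2; lra.
apply: (upper_sheet hAe); first by rewrite ip_mul // (hyp_ip hX).
rewrite ip_mul //; exact: le_lt_trans (ip_hyp_le he hX) (ltrN10 _).
Qed.

Lemma cross_mul A X Y : SOplus21 A ->
  cross (A *m X) (A *m Y) = A *m cross X Y *m invmx A.
Proof.
move=> hA; rewrite /cross !sharp_mul // mulmxBr mulmxBl !mulmxA //.
Qed.

Lemma pairing_conj A P Q : A \in unitmx ->
  pairing (A *m P *m invmx A) (A *m Q *m invmx A) = pairing P Q.
Proof.
move=> uA; rewrite /pairing mxtrace_mulC -!mulmxA mulKmx // mxtrace_mulC -!mulmxA.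
by rewrite mulVmx // mulmx1 mxtrace_mulC.
Qed.

Lemma pairingDl P Q S : pairing (P + Q) S = pairing P S + pairing Q S.
Proof. by rewrite /pairing mulmxDl mxtraceD. Qed.
Lemma pairingZl a P Q : pairing (a *: P) Q = a * pairing P Q.
Proof. by rewrite /pairing -scalemxAl mxtraceZ. Qed.
Lemma pairingC P Q : pairing P Q = pairing Q P.
Proof. exact: mxtrace_mulC. Qed.
Lemma pairingDr P Q S : pairing P (Q + S) = pairing P Q + pairing P S.
Proof. by rewrite pairingC pairingDl !(pairingC P). Qed.
Lemma pairingZr a P Q : pairing P (a *: Q) = a * pairing P Q.
Proof. by rewrite pairingC pairingZl pairingC. Qed.

Lemma mxtrace_mul_sharp X Y : \tr (X *m sharp Y) = ip Y X.
Proof. by rewrite mxtrace_mulC /mxtrace big_ord_recl big_ord0 addr0. Qed.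

Lemma mul_col_row X Y Z (r : 'rV[R]_3) :
  (X *m sharp Y) *m (Z *m r) = ip Y Z *: (X *m r).
Proof.
rewrite -mulmxA (mulmxA (sharp Y)) (mx11_scalar (sharp Y *m Z)) mul_scalar_mx.
by rewrite -scalemxAr.
Qed.

Lemma pairing_cross X Y Z w :
  pairing (cross X Y) (cross Z w) =
  2 * (ip X w * ip Y Z - ip X Z * ip Y w).
Proof.
rewrite /pairing /cross mulmxBl !mulmxBr !mul_col_row !raddfB /= !mxtraceZ.
rewrite !mxtrace_mul_sharp (ipC Z Y) (ipC w X) (ipC Z X) (ipC w Y); ring.
Qed.

Lemma pairing_beta X v w : hyperboloid X -> tangent X v -> tangent X w ->
  pairing (beta X v) (beta X w) = 2 * ip v w.
Proof.
move=> hX tv tw; rewrite /beta pairing_cross (hyp_ip hX) (ipC v) tv mul0r; ring.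
Qed.

Lemma crossE X Y i j :
  cross X Y i j = Y i 0 * sharp X 0 j - X i 0 * sharp Y 0 j.
Proof.
by rewrite /cross; move: (sharp X) (sharp Y) => p q; rewrite !mxE !big_ord1.
Qed.

Lemma beta_lin X a v w : beta X (a *: v + w) = a *: beta X v + beta X w.
Proof.
apply/matrixP => i j; rewrite /beta crossE sharpE [RHS]mxE [X in _ = X + _]mxE !crossE !sharpE !mxE.
by case: ifP => _; ring.
Qed.

Lemma cross_so21 X Y : so21 (cross X Y).
Proof.
rewrite /so21 /= /cross linearB /= mulmxBl mulmxBr /sharp !trmx_mul !trmxK.
by rewrite esharp_tr !mulmxA addrC addrA subrK subrr.
Qed.

Lemma tangentZ X a v : tangent X v -> tangent X (a *: v).
Proof. by rewrite /tangent /= => h; rewrite ipZr h mulr0. Qed.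
Lemma tangentD X v w : tangent X v -> tangent X w -> tangent X (v + w).
Proof. by rewrite /tangent /= => h h'; rewrite ipDr h h' addr0. Qed.

(** The Lorentzian cross product of [X] and [v]: when [v] is tangent at [X],
    its rotation by a right angle in the tangent plane. *)
Definition rot X v : 'cV[R]_3 := \col_i
  [:: X 1 0 * v ord_max 0 - X ord_max 0 * v 1 0;
      X ord_max 0 * v 0 0 - X 0 0 * v ord_max 0;
      X 1 0 * v 0 0 - X 0 0 * v 1 0]`_i.

Lemma tangent_rot X v : tangent X (rot X v).
Proof. by rewrite /tangent /= ipE !mxE /=; ring. Qed.
Lemma ip_rot X v : ip v (rot X v) = 0.
Proof. by rewrite ipE !mxE /=; ring. Qed.
(** The square of a triple product is, up to sign, a Gram determinant. *)
Lemma ip_rot_sq X v w : ip (rot X v) w ^+ 2 =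
  - (ip X X * (ip v v * ip w w - ip v w ^+ 2)
     - ip X v * (ip X v * ip w w - ip v w * ip X w)
     + ip X w * (ip X v * ip v w - ip v v * ip X w)).
Proof. by rewrite !ipE !mxE /=; ring. Qed.

Lemma ip_rot_unit X v w : unit_tangent X v -> tangent X w ->
  ip (rot X v) w ^+ 2 = ip w w - ip v w ^+ 2.
Proof.
by move=> [hX tv v1] tw; rewrite ip_rot_sq (hyp_ip hX) v1 tv tw; ring.
Qed.

Lemma ip_rot_rot X v : unit_tangent X v -> ip (rot X v) (rot X v) = 1.
Proof.
move=> [hX tv v1]; rewrite [LHS](_ : _ = ip X v ^+ 2 - ip X X * ip v v); last first.
  by rewrite !ipE !mxE /=; ring.
by rewrite tv v1 (hyp_ip hX); ring.
Qed.

(** The difference of both sides is tangent and orthogonal to [v] and [rot X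
    v], so [ip_rot_unit] makes its square norm zero. *)
Lemma frame X v w : unit_tangent X v -> tangent X w ->
  w = ip v w *: v + ip (rot X v) w *: rot X v.
Proof.
move=> u tw; have [hX tv v1] := u.
set r := - (ip v w *: v + ip (rot X v) w *: rot X v) + w.
have tr : tangent X r.
  rewrite /r -scaleN1r; apply: tangentD => //.
  apply: tangentZ; apply: tangentD; first exact: tangentZ.
  by apply: tangentZ; exact: tangent_rot.
suff : r = 0 by move/eqP; rewrite /r addrC subr_eq0 => /eqP.
apply: (tangent_ip_eq0 hX tr).
have vr : ip v r = 0 by rewrite /r !ip_lin ip_rot v1; ring.
have := ip_rot_unit u tr; rewrite vr expr0n subr0 => <-.
by rewrite /r !ip_lin (ipC _ v) ip_rot ip_rot_rot //; ring.
Qed.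

End Isometries.

(** * The largest singular value *)

Section SingularValues.
Variable R : realType.
Implicit Types (X v w : 'cV[R]_3).

(** In the orthonormal frame [v], [rot X v] the form [pairing (f w) (f w')]
    has a symmetric matrix with diagonal entries a, d and off-diagonal entry
    b. Its larger eigenvalue is the square of a singular value and is at least
    a, which is the quantity to bound. *)
Lemma largest_singular_value_bound X f v : unit_tangent X v ->
  (forall w, tangent X w -> exists2 w', tangent X w' & f w = beta X w') ->
  (forall (a : R) w w', tangent X w -> tangent X w' -> f (a *: w + w') = a *: f w + f w') ->
  largest_singular_value X f <= Num.sqrt 2 ->
  pairing (f v) (f v) <= 2.
Proof.
move=> u imf linf hs; have [hX tv v1] := u.
set e := rot X v; have te : tangent X e by exact: tangent_rot.
set a := pairing (f v) (f v); set b := pairing (f v) (f e); set d := pairing (f e) (f e).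
have Q0 w : tangent X w -> 0 <= pairing (f w) (f w).
  move=> tw; have [w' tw' ->] := imf w tw.
  by rewrite pairing_beta // mulr_ge0 // (tangent_ip_ge0 hX).
have a0 : 0 <= a by exact: Q0.
have d0 : 0 <= d by exact: Q0.
have t0 : tangent X (0 : 'cV[R]_3) by rewrite /tangent /= ip0r.
have f0 : f 0 = 0.
  have := linf 1 0 0 t0 t0; rewrite !scale1r addr0 => /eqP.
  by rewrite -subr_eq0 opprD addNKr oppr_eq0 => /eqP.
have fZ y : f (y *: e) = y *: f e by rewrite -[y *: e]addr0 linf // f0 addr0.
have Qf x y w : tangent X w -> pairing (f (x *: v + y *: e)) (f w) =
    x * (ip v w * a + ip e w * b) + y * (ip v w * b + ip e w * d).
  move=> tw; have -> : f w = ip v w *: f v + ip e w *: f e.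
    by rewrite {1}(frame u tw) linf ?fZ //; exact: tangentZ.
  rewrite linf ?fZ //; last exact: tangentZ.
  rewrite !(pairingDl, pairingDr, pairingZl, pairingZr) (pairingC (f e) (f v)) -/a -/b -/d.
  ring.
pose D := Num.sqrt (((a - d) / 2) ^+ 2 + b ^+ 2).
have D2 : D ^+ 2 = ((a - d) / 2) ^+ 2 + b ^+ 2 by rewrite sqr_sqrtr // addr_ge0 ?sqr_ge0.
have D0 : 0 <= D by exact: sqrtr_ge0.
pose l := (a + d) / 2 + D.
have al : a <= l.
  have : (a - d) / 2 <= D.
    apply: (le_trans (ler_norm _)); rewrite -(ler_pXn2r (n := 2)) ?nnegrE //.
    by rewrite real_normK ?num_real // D2 lerDl sqr_ge0.
  by rewrite /l; lra.
have l0 : 0 <= l by exact: le_trans al.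
have lE : (l - a) * (l - d) = b ^+ 2.
  have -> : (l - a) * (l - d) = D ^+ 2 - ((a - d) / 2) ^+ 2 by rewrite /l; field.
  by rewrite D2; ring.
(* (b, l - a) is an eigenvector, unless the matrix is diagonal. *)
have [x [y [xy0 E1 E2]]] : exists x y, [/\ x *: v + y *: e != 0,
    a * x + b * y = l * x & b * x + d * y = l * y].
  have nz x y : (x != 0) || (y != 0) -> x *: v + y *: e != 0.
    move=> xy; apply/eqP => h.
    have h1 := congr1 (ip v) h; have h2 := congr1 (ip e) h.
    move: h1 h2; rewrite !ip_lin (ipC e v) ip_rot ip_rot_rot // v1 !ip0r !mulr0 !mulr1.
    by rewrite addr0 add0r => x0 y0; move: xy; rewrite x0 y0 eqxx.
  have [b0|b0] := eqVneq b 0; last first.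
    exists b, (l - a); split; [by rewrite nz // b0 | ring |].
    by rewrite -expr2 -lE; ring.
  move/eqP: lE; rewrite b0 expr0n /= mulf_eq0 !subr_eq0 => /orP[] /eqP ->.
    by exists 1, 0; split; [rewrite nz // oner_eq0 | ring | ring].
  by exists 0, 1; split; [rewrite nz // oner_eq0 orbT | ring | ring].
have txy : tangent X (x *: v + y *: e) by apply: tangentD; exact: tangentZ.
have S1 : singular_value X f (Num.sqrt l).
  split; first exact: sqrtr_ge0.
  exists (x *: v + y *: e); split => // w tw.
  rewrite Qf // sqr_sqrtr // !ip_lin.
  have -> : l * (x * ip v w + y * ip e w) = (l * x) * ip v w + (l * y) * ip e w by ring.
  by rewrite -E1 -E2; ring.
(* A supremum bounds only sets that are bounded above. *)
have bnd : has_ubound (singular_value X f).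
  exists (a + d + `|b| + 1) => c [c0 [w [tw w0 Hw]]].
  have := Hw w tw; rewrite {1}(frame u tw) Qf //.
  have ww0 := tangent_ip_gt0 hX tw w0.
  have := ip_rot_unit u tw; rewrite -/e; set p := ip v w; set q := ip e w => qE.
  have wE : ip w w = p ^+ 2 + q ^+ 2 by rewrite qE; ring.
  rewrite wE in ww0 *; move=> E.
  have bpq : b * (2 * (p * q)) <= `|b| * (p ^+ 2 + q ^+ 2).
    apply: (le_trans (ler_norm _)); rewrite normrM ler_wpM2l //.
    rewrite ler_norml; apply/andP; split; rewrite -subr_ge0.
      by rewrite (_ : _ - _ = (p + q) ^+ 2) ?sqr_ge0 //; ring.
    by rewrite (_ : _ - _ = (p - q) ^+ 2) ?sqr_ge0 //; ring.
  have p2 := sqr_ge0 p; have q2 := sqr_ge0 q.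
  have ap : 0 <= a * q ^+ 2 by exact: mulr_ge0.
  have dp : 0 <= d * p ^+ 2 by exact: mulr_ge0.
  have cM : c ^+ 2 <= a + d + `|b|.
    by rewrite -(ler_pM2r ww0) -E; lra.
  have b0 := normr_ge0 b.
  case: (leP c 1) => c1; first by lra.
  have : c <= c ^+ 2 by rewrite expr2 ler_peMr // ltW.
  by lra.
have : Num.sqrt l <= Num.sqrt 2.
  by apply: le_trans hs; apply: ub_le_sup.
rewrite ler_sqrt // => l2; exact: le_trans al l2.
Qed.

(** If [f v] is [beta X w], the left-hand side is twice the product of [v] and
    [w], which is at most the sum of their square norms; both norms are at
    most 1 by the preceding bound. *)
Lemma largest_singular_value_pairing X f v : unit_tangent X v ->
  (forall w, tangent X w -> exists2 w', tangent X w' & f w = beta X w') ->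
  (forall (a : R) w w', tangent X w -> tangent X w' -> f (a *: w + w') = a *: f w + f w') ->
  largest_singular_value X f <= Num.sqrt 2 ->
  pairing (f v) (beta X v) <= 2.
Proof.
move=> u imf linf hs; have := largest_singular_value_bound u imf linf hs.
have [hX tv v1] := u; have [w tw ->] := imf v tv.
rewrite !pairing_beta // => h.
have tN : tangent X (w + (-1) *: v) by apply: tangentD => //; exact: tangentZ.
have := tangent_ip_ge0 hX tN; rewrite !ip_lin v1 (ipC v w); lra.
Qed.

Lemma singular_value_beta X : hyperboloid X ->
  largest_singular_value X (beta X) <= Num.sqrt 2.
Proof.
move=> hX; rewrite /largest_singular_value.
have sub c : singular_value X (beta X) c -> c <= Num.sqrt 2.
  move=> [c0 [v [tv v0 /(_ v tv)]]]; rewrite pairing_beta //.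
  have vv := tangent_ip_gt0 hX tv v0.
  move/(mulIf (lt0r_neq0 vv)) => ->; rewrite sqrtr_sqr; exact: ler_norm.
have [->|/set0P ne] := eqVneq (singular_value X (beta X)) set0.
  by rewrite sup0 sqrtr_ge0.
by apply: ge_sup.
Qed.

End SingularValues.

(** * Smooth functions in the chart of the hyperboloid *)

Section SmoothCalculus.
Variable R : realType.
Implicit Types (f g : R * R -> R) (k : nat).

Lemma Ck_continuous k f : Ck k f -> continuous f.
Proof. by case: k => [|k] []. Qed.

Lemma CkS k f : Ck k.+1 f -> Ck k f.
Proof.
elim: k f => [|k IH] f; first by case.
case=> cf [df Df]; split => //; split => // v; exact: IH.
Qed.

Lemma Ck_D k f g : Ck k f -> Ck k g -> Ck k (f + g).
Proof.
elim: k f g => [|k IH] f g.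
  by move=> [cf _] [cg _]; split => // x; apply: cvgD; [exact: cf|exact: cg].
move=> [cf [df Df]] [cg [dg Dg]]; split; last split.
- by move=> x; apply: cvgD; [exact: cf|exact: cg].
- by move=> x v; exact: derivableD.
- move=> v; rewrite [X in Ck k X](_ : _ = (fun x => 'D_v f x) + (fun x => 'D_v g x)).
    by apply: IH; [exact: Df|exact: Dg].
  by apply/funext => x; rewrite deriveD.
Qed.

Lemma Ck_M k f g : Ck k f -> Ck k g -> Ck k (f * g).
Proof.
elim: k f g => [|k IH] f g.
  by move=> [cf _] [cg _]; split => // x; apply: cvgM; [exact: cf|exact: cg].
move=> /[dup] Cf [cf [df Df]] /[dup] Cg [cg [dg Dg]]; split; last split.
- by move=> x; apply: cvgM; [exact: cf|exact: cg].
- by move=> x v; exact: derivableM.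
- move=> v; rewrite [X in Ck k X](_ : _ =
    f * (fun x => 'D_v g x) + g * (fun x => 'D_v f x)).
    by apply: Ck_D; apply: IH; [exact: CkS|exact: Dg|exact: CkS|exact: Df].
  by apply/funext => x; rewrite deriveM.
Qed.

Lemma Ck_cst k (c : R) : Ck k (cst c : R * R -> R).
Proof.
elim: k c => [|k IH] c; first by split => // x; exact: cvg_cst.
split; first by move=> x; exact: cvg_cst.
split; first by move=> x v; exact: derivable_cst.
move=> v; rewrite [X in Ck k X](_ : _ = cst 0) //.
by apply/funext => x; rewrite derive_cst.
Qed.

(** All the difference quotients along the line are equal to [l v]. *)
Lemma derive_linear f (l : R * R -> R) (x v : R * R) :
  (forall h : R, f (h *: v + x) - f x = h * l v) ->
  derivable f x v /\ 'D_v f x = l v.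
Proof.
move=> H.
have E : (fun h => h^-1 *: ((f \o shift x) (h *: v) - f x)) @ 0^' --> l v.
  apply: cvg_near_cst; near=> h; rewrite /= H /GRing.scale /= mulrA mulVf ?mul1r //.
  by near: h; exact: nbhs_dnbhs_neq.
by split; [apply/cvg_ex; exists (l v)|exact: cvg_lim].
Unshelve. all: by end_near. Qed.

Lemma smooth_fst : smooth2 (fun p : R * R => p.1).
Proof.
move=> k; have D x v := @derive_linear (fun p => p.1) (fun p => p.1) x v.
have D' x v : derivable (fun p : R * R => p.1) x v /\ 'D_v (fun p : R * R => p.1) x = v.1.
  by apply: D => h /=; rewrite addrK.
have c : continuous (fun p : R * R => p.1) by move=> p; exact: cvg_fst.
case: k => [|k]; split => //; split=> [x v|v]; first exact: (D' x v).1.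
rewrite [X in Ck k X](_ : _ = cst v.1); first exact: Ck_cst.
by apply/funext => x; exact: (D' x v).2.
Qed.

Lemma smooth_snd : smooth2 (fun p : R * R => p.2).
Proof.
move=> k; have D x v := @derive_linear (fun p => p.2) (fun p => p.2) x v.
have D' x v : derivable (fun p : R * R => p.2) x v /\ 'D_v (fun p : R * R => p.2) x = v.2.
  by apply: D => h /=; rewrite addrK.
have c : continuous (fun p : R * R => p.2) by move=> p; exact: cvg_snd.
case: k => [|k]; split => //; split=> [x v|v]; first exact: (D' x v).1.
rewrite [X in Ck k X](_ : _ = cst v.2); first exact: Ck_cst.
by apply/funext => x; exact: (D' x v).2.
Qed.

Lemma smoothD f g : smooth2 f -> smooth2 g -> smooth2 (fun p => f p + g p).
Proof. by move=> sf sg k; exact: Ck_D. Qed.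
Lemma smoothM f g : smooth2 f -> smooth2 g -> smooth2 (fun p => f p * g p).
Proof. by move=> sf sg k; exact: Ck_M. Qed.
Lemma smooth_cst (c : R) : smooth2 (fun _ => c).
Proof. by move=> k; exact: Ck_cst. Qed.
Lemma smoothN f : smooth2 f -> smooth2 (fun p => - f p).
Proof.
move=> sf; rewrite (_ : (fun p => - f p) = (fun p => (-1) * f p)).
  by apply: smoothM => //; exact: smooth_cst.
by apply/funext => p; rewrite mulN1r.
Qed.

Let q (p : R * R) : R := 1 + p.1 ^+ 2 + p.2 ^+ 2.

Let q_gt0 p : 0 < q p.
Proof. by rewrite /q -addrA ltr_pwDl // addr_ge0 // sqr_ge0. Qed.

Let r (p : R * R) : R := (Num.sqrt (q p))^-1.

Let qc : continuous q.
Proof.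
have : smooth2 q.
  by apply: smoothD; [apply: smoothD; [exact: smooth_cst|]|];
    apply: smoothM; exact: smooth_fst || exact: smooth_snd.
by move=> /(_ 0%N) [].
Qed.

Let hc : continuous (fun p => Num.sqrt (q p)).
Proof.
move=> p; apply: (@continuous_cvg _ _ _ _ _ q Num.sqrt (q p) _ (@qc p)).
exact: sqrt_continuous.
Qed.

Let rc : continuous r.
Proof. by move=> p; apply: cvgV; [rewrite gt_eqF // sqrtr_gt0|exact: hc]. Qed.

Let r_derive x v : derivable r x v /\
  'D_v r x = - (x.1 * v.1 + x.2 * v.2) * (r x * r x * r x).
Proof.
set h := fun p => Num.sqrt (q p).
have h0 p : 0 < h p by rewrite sqrtr_gt0.
have h2 p : h p ^+ 2 = q p by rewrite sqr_sqrtr // ltW.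
have E : (fun t : R => t^-1 *: ((r \o shift x) (t *: v) - r x)) @ 0^' -->
    - (x.1 * v.1 + x.2 * v.2) * (r x * r x * r x).
  have lim : (fun t : R => - (2 * (x.1 * v.1 + x.2 * v.2) + t * (v.1 ^+ 2 + v.2 ^+ 2)) *
      (r (t *: v + x) * r x * (h (t *: v + x) + h x)^-1)) @ 0^' -->
      - (2 * (x.1 * v.1 + x.2 * v.2) + 0 * (v.1 ^+ 2 + v.2 ^+ 2)) *
      (r (0 *: v + x) * r x * (h (0 *: v + x) + h x)^-1).
    have idc : (fun t : R => t) @ 0^' --> (0 : R) by apply: cvg_within_filter; exact: cvg_id.
    have shc : (fun t : R => t *: v + x) @ 0^' --> 0 *: v + x.
      by apply: cvgD; [apply: cvgZr_tmp|exact: cvg_cst].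
    apply: cvgM.
      by apply: cvgN; apply: cvgD; [exact: cvg_cst|apply: cvgM => //; exact: cvg_cst].
    apply: cvgM; first apply: cvgM.
    - by apply: (@continuous_cvg _ _ _ _ _ _ r _ _ shc); exact: rc.
    - exact: cvg_cst.
    - apply: cvgV; first by rewrite gt_eqF // addr_gt0.
      by apply: cvgD; [apply: (@continuous_cvg _ _ _ _ _ _ h _ _ shc); exact: hc|exact: cvg_cst].
  move: lim; rewrite scale0r add0r mul0r addr0.
  have -> : - (2 * (x.1 * v.1 + x.2 * v.2)) * (r x * r x * (h x + h x)^-1) =
            - (x.1 * v.1 + x.2 * v.2) * (r x * r x * r x).
    rewrite /r -/(h x); have hx := h0 x; move: (h x) hx => a hx.
    by field; rewrite !gt_eqF // addr_gt0.
  apply: cvg_trans; apply: near_eq_cvg; near=> t.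
  have t0 : t != 0 by near: t; exact: nbhs_dnbhs_neq.
  rewrite /= /GRing.scale /= /r -!/(h _).
  set y := (t *: v + x : R * R).
  have hy := h0 y; have hx := h0 x.
  have yE : h y ^+ 2 - h x ^+ 2 =
     t * (2 * (x.1 * v.1 + x.2 * v.2) + t * (v.1 ^+ 2 + v.2 ^+ 2)).
    by rewrite !h2 /q /y /= /GRing.scale /=; ring.
  (* Rationalizing the difference of the square roots. *)
  set S := _ + t * _ in yE *.
  have key : (h y)^-1 - (h x)^-1 = - (t * S) * ((h y)^-1 * (h x)^-1 * (h y + h x)^-1).
    rewrite -yE; move: (h y) (h x) hy hx => b a hb ha.
    by field; rewrite !gt_eqF // addr_gt0.
  by rewrite key !mulrA mulrN mulrA mulVf // mul1r.
by split; [apply/cvg_ex; eexists; exact: E|exact: cvg_lim].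
Unshelve. all: by end_near. Qed.

Let r_smooth : smooth2 r.
Proof.
elim => [|k IH]; first by split.
split; first exact: rc.
split=> [x v|v]; first exact: (r_derive x v).1.
rewrite [X in Ck k X](_ : _ =
   (fun x => - (x.1 * v.1 + x.2 * v.2)) * (r * r * r)); last first.
  by apply/funext => x; rewrite (r_derive x v).2.
apply: Ck_M; last by do !apply: Ck_M.
apply: smoothN; apply: smoothD; apply: smoothM;
  by [exact: smooth_fst|exact: smooth_snd|exact: smooth_cst].
Qed.

Lemma smooth_hchart i : smooth2 (fun p : R * R => hchart p i 0).
Proof.
have hE p : Num.sqrt (q p) = q p * r p.
  rewrite /r -{2}(sqr_sqrtr (ltW (q_gt0 p))) expr2 mulfK // gt_eqF //.
  by rewrite sqrtr_gt0.
have sq : smooth2 q.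
  by apply: smoothD; [apply: smoothD; [exact: smooth_cst|]|];
    apply: smoothM; exact: smooth_fst || exact: smooth_snd.
case: i => -[|[|[|//]]] hi.
- rewrite (_ : (fun p => _) = fst); first exact: smooth_fst.
  by apply/funext => p; rewrite mxE.
- rewrite (_ : (fun p => _) = snd); first exact: smooth_snd.
  by apply/funext => p; rewrite mxE.
- rewrite (_ : (fun p => _) = (fun p => q p * r p)); first exact: smoothM.
  by apply/funext => p; rewrite mxE /= -hE.
Qed.

Lemma smooth_dhchart w i : smooth2 (fun p : R * R => dhchart p w i 0).
Proof.
case: i => -[|[|[|//]]] hi.
- rewrite (_ : (fun p => _) = (fun=> w.1)); first exact: smooth_cst.
  by apply/funext => p; rewrite mxE.
- rewrite (_ : (fun p => _) = (fun=> w.2)); first exact: smooth_cst.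
  by apply/funext => p; rewrite mxE.
- rewrite (_ : (fun p => _) = (fun p => (p.1 * w.1 + p.2 * w.2) * r p)).
    apply: smoothM => //; apply: smoothD; apply: smoothM;
    by [exact: smooth_fst|exact: smooth_snd|exact: smooth_cst].
  by apply/funext => p; rewrite mxE.
Qed.

End SmoothCalculus.

(** * Lie algebra valued forms on the surface *)

Section Forms.
Variables (R : realType) (pi1 : groupType) (sigma : pi1 -> 'M[R]_3).
Implicit Types (X Y v w : 'cV[R]_3) (phi : 'cV[R]_3 -> 'cV[R]_3 -> 'M[R]_3).

Lemma hchart_inv X : hyperboloid X -> hchart (X 0 0, X 1 0) = X.
Proof.
move=> hX; apply: cV3P; rewrite mxE //= -hyp_sq // sqrtr_sqr ger0_norm //.
by have := hyp_ge1 hX; lra.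
Qed.

Lemma dhchart_tangent (p w : R * R) : tangent (hchart p) (dhchart p w).
Proof.
rewrite /tangent /= ipE !mxE /=; set h := Num.sqrt _.
have h0 : 0 < h.
  rewrite sqrtr_gt0; have := sqr_ge0 p.1; have := sqr_ge0 p.2; lra.
by field; rewrite gt_eqF.
Qed.

Lemma dhchart_inv X v : hyperboloid X -> tangent X v ->
  dhchart (X 0 0, X 1 0) (v 0 0, v 1 0) = v.
Proof.
move=> hX; rewrite /tangent /= ipE => tv.
have z1 := hyp_ge1 hX.
apply: cV3P; rewrite mxE //= -hyp_sq // sqrtr_sqr ger0_norm; last by lra.
have -> : X 0 0 * v 0 0 + X 1 0 * v 1 0 = v ord_max 0 * X ord_max 0 by lra.
by rewrite mulfK // gt_eqF //; lra.
Qed.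

Hypothesis hM : closed_hyperbolic_surface sigma.

Lemma sigma_so g : SOplus21 (sigma g). Proof. exact: chs_range hM g. Qed.

Lemma sigma_unit g : sigma g \in unitmx. Proof. exact/so_unit/sigma_so. Qed.

Lemma sigma1 : sigma 1%g = 1%:M.
Proof.
have := chs_hom hM 1%g 1%g; rewrite mul1g => h.
by rewrite -[LHS](mulKmx (sigma_unit 1%g)) -h mulVmx ?sigma_unit.
Qed.

Lemma sigmaVK g X : sigma (g^-1)%g *m (sigma g *m X) = X.
Proof. by rewrite mulmxA -(chs_hom hM) mulVg sigma1 mul1mx. Qed.

Lemma sigma_comp g h X : sigma g *m (sigma h *m X) = sigma (g * h)%g *m X.
Proof. by rewrite mulmxA -(chs_hom hM). Qed.

Lemma hyp_sigma g X : hyperboloid X -> hyperboloid (sigma g *m X).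
Proof. exact/hyp_mul/sigma_so. Qed.

Lemma ip_sigma g X Y : ip (sigma g *m X) (sigma g *m Y) = ip X Y.
Proof. exact/ip_mul/sigma_so. Qed.

Lemma distH_sigma g X Y : distH (sigma g *m X) (sigma g *m Y) = distH X Y.
Proof. by rewrite /distH ip_sigma. Qed.

Lemma unit_tangent_sigma g X v :
  unit_tangent X v -> unit_tangent (sigma g *m X) (sigma g *m v).
Proof.
move=> [hX tv v1]; split; rewrite ?ip_sigma //; first exact: hyp_sigma.
exact: tangent_mul (sigma_so g) tv.
Qed.

(** The distance in the quotient is an infimum over the group, and one of its
    terms is the right-hand side. *)
Lemma distM_le g h X Y : hyperboloid X -> hyperboloid Y ->
  distM sigma X Y <= distH (sigma g *m X) (sigma h *m Y).
Proof.
move=> hX hY; apply: ge_inf.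
  by exists 0 => _ [k _ <-]; apply: distH_ge0 => //; exact: hyp_sigma.
exists (g^-1 * h)%g => //.
by rewrite -(distH_sigma g) sigma_comp mulgA mulgV mul1g.
Qed.

Lemma ad_form0 phi X : ad_form sigma phi -> hyperboloid X -> phi X 0 = 0.
Proof.
move=> fphi hX; have t0 : tangent X (0 : 'cV[R]_3) by rewrite /tangent /= ip0r.
have := af_linear fphi 1 hX t0 t0; rewrite !scale1r addr0 => /eqP.
by rewrite -subr_eq0 opprD addNKr oppr_eq0 => /eqP.
Qed.

Lemma ad_formZ phi X (a : R) v : ad_form sigma phi -> hyperboloid X -> tangent X v ->
  phi X (a *: v) = a *: phi X v.
Proof.
move=> fphi hX tv; have t0 : tangent X (0 : 'cV[R]_3) by rewrite /tangent /= ip0r.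
by have := af_linear fphi a hX tv t0; rewrite ad_form0 // !addr0.
Qed.

Lemma ad_form_mul psi phi : smooth_function sigma psi -> ad_form sigma phi ->
  ad_form sigma (fun X v => psi X *: phi X v).
Proof.
move=> fpsi fphi; split.
- move=> X v hX tv; have := af_so21 fphi hX tv; rewrite /so21 /= => h.
  by rewrite linearZ /= -scalemxAl -scalemxAr -scalerDr h scaler0.
- by move=> X a v w hX tv tw; rewrite (af_linear fphi) // scalerDr !scalerA mulrC.
- move=> g X v hX tv; rewrite (sf_inv fpsi) // (af_equiv fphi) //.
  by rewrite -scalemxAr -scalemxAl.
- move=> w i j; rewrite (_ : (fun p => _) = (fun p : R * R => psi (hchart p) *
      phi (hchart p) (dhchart p w) i j)); last by apply/funext => p; rewrite mxE.
  by apply: smoothM; [exact: sf_smooth fpsi|exact: af_smooth fphi w i j].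
Qed.

Lemma ad_form_beta : ad_form sigma (@beta R).
Proof.
split.
- by move=> X v _ _; exact: cross_so21.
- by move=> X a v w _ _ _; exact: beta_lin.
- by move=> g X v _ _; exact: cross_mul (sigma_so g).
- move=> w i j; rewrite (_ : (fun p => _) = (fun p : R * R =>
     hchart p i 0 * sharp (dhchart p w) 0 j - dhchart p w i 0 * sharp (hchart p) 0 j));
    last by apply/funext => p; rewrite /beta crossE.
  have s1 : smooth2 (fun p : R * R => sharp (dhchart p w) 0 j).
    rewrite (_ : (fun p => _) = (fun p => if j == ord_max then - dhchart p w j 0
      else dhchart p w j 0)); last by apply/funext => p; rewrite sharpE.
    by case: (j == ord_max); [apply: smoothN|]; exact: smooth_dhchart.
  have s2 : smooth2 (fun p : R * R => sharp (hchart p) 0 j).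
    rewrite (_ : (fun p => _) = (fun p => if j == ord_max then - hchart p j 0
      else hchart p j 0)); last by apply/funext => p; rewrite sharpE.
    by case: (j == ord_max); [apply: smoothN|]; exact: smooth_hchart.
  apply: smoothD; [|apply: smoothN]; apply: smoothM => //;
    [exact: smooth_hchart|exact: smooth_dhchart].
Qed.

Lemma beta_is_id : is_id_part (@beta R) (@beta R).
Proof.
move=> X v hX tv; split; first by exists v.
by move=> w tw; rewrite subrr /pairing mul0mx mxtrace0.
Qed.

End Forms.

(** * The density of a form along a lamination *)

Section Density.
Variables (R : realType) (pi1 : groupType) (sigma : pi1 -> 'M[R]_3).
Variable leaf : set (set 'cV[R]_3).
Hypothesis hM : closed_hyperbolic_surface sigma.
Hypothesis hleaf : geodesic_lamination sigma leaf.
Implicit Types (X Y v w e : 'cV[R]_3) (phi : 'cV[R]_3 -> 'cV[R]_3 -> 'M[R]_3).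

(** At a point of the lamination there are two such vectors, opposite to each
    other. *)
Definition leaf_dir X e := unit_tangent X e /\ leaf (geodesic_line X e).

Lemma leaf_dir_ex X : lam_support leaf X -> exists e, leaf_dir X e.
Proof.
move=> [l ll lX]; have [Y [v [hY tv v1 lE]]] := gl_geodesic hleaf ll.
have u : unit_tangent Y v by [].
move: lX; rewrite lE => -[t _ tX]; exists (dgam Y v t).
rewrite -/(gam Y v t) in tX; rewrite -tX; split; first exact: gam_unit.
by rewrite geodesic_line_shift -lE.
Qed.

(** The leaves with directions [e] and [e'] meet at [X], hence coincide. *)
Lemma leaf_dir_uniq X e e' : leaf_dir X e -> leaf_dir X e' -> e = e' \/ e = - e'.
Proof.
move=> [ue le] [ue' le']; apply: (line_dir_uniq ue ue').
have X0 (w : 'cV[R]_3) : geodesic_line X w X.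
  by exists 0 => //; rewrite -/(gam X w 0) gam0.
rewrite (gl_disjoint hleaf le le') //; exists X; split; exact: X0.
Qed.

Lemma leaf_dir_sigma g X e : leaf_dir X e -> leaf_dir (sigma g *m X) (sigma g *m e).
Proof.
move=> [ue le]; split; first exact: unit_tangent_sigma.
have := gl_inv hleaf g le; congr leaf.
apply/seteqP; split => [_ [_ [t _ <-] <-]|_ [t _ <-]].
  by exists t => //; rewrite mulmxDr -!scalemxAr.
exists (cosh t *: X + sinh t *: e); first by exists t.
by rewrite mulmxDr -!scalemxAr.
Qed.

Lemma lam_support_sigma g X :
  lam_support leaf X -> lam_support leaf (sigma g *m X).
Proof.
move=> /leaf_dir_ex [e /(leaf_dir_sigma g) [_ le]].
by exists (geodesic_line (sigma g *m X) (sigma g *m e)) => //;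
  exists 0 => //; rewrite -/(gam _ _ 0) gam0.
Qed.

Lemma lam_support_sigmaE g X :
  lam_support leaf (sigma g *m X) -> lam_support leaf X.
Proof. by move=> /(lam_support_sigma (g^-1)%g); rewrite (sigmaVK hM). Qed.

Definition some_dir X := xget 0 [set e | leaf_dir X e].

Lemma some_dirP X : lam_support leaf X -> leaf_dir X (some_dir X).
Proof. by move=> /leaf_dir_ex [e he]; rewrite /some_dir; case: xgetP => // /(_ e). Qed.

Lemma lam_hyp X : lam_support leaf X -> hyperboloid X.
Proof. by move=> /leaf_dir_ex [e [[]]]. Qed.

(** The square in the direction makes this independent of the orientation of
    the leaf. For a form [phi] the functional of the theorem integrates
    [density phi] against arclength along the leaves and the transverse
    measure. *)
Definition density phi X : R := pairing (phi X (some_dir X)) (beta X (some_dir X)).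

Lemma beta_opp X v : beta X (- v) = - beta X v.
Proof.
have := beta_lin X (-1) v 0; rewrite !scaleN1r addr0 => ->.
by rewrite [beta X 0](_ : _ = 0) ?addr0 // /beta /cross /sharp mulmx0 trmx0 mulmx0 mul0mx subrr.
Qed.

Lemma densityE phi X e : ad_form sigma phi -> leaf_dir X e ->
  density phi X = pairing (phi X e) (beta X e).
Proof.
move=> fphi le; have [[hX te _] ll] := le.
have lX : lam_support leaf X.
  by exists (geodesic_line X e) => //; exists 0 => //; rewrite -/(gam _ _ 0) gam0.
have [->|->] := leaf_dir_uniq le (some_dirP lX); first by [].
have td : tangent X (some_dir X) by have [[]] := some_dirP lX.
have -> : phi X (- some_dir X) = (-1) *: phi X (some_dir X).
  by rewrite -scaleN1r (ad_formZ _ fphi).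
by rewrite beta_opp -[- beta _ _]scaleN1r pairingZl pairingZr mulrA mulrNN !mul1r.
Qed.

Lemma density_sigma phi g X : ad_form sigma phi -> lam_support leaf X ->
  density phi (sigma g *m X) = density phi X.
Proof.
move=> fphi lX; have le := some_dirP lX; have [[hX te _] _] := le.
rewrite (densityE fphi (leaf_dir_sigma g le)) (af_equiv fphi) //.
by rewrite /beta cross_mul ?pairing_conj ?(sigma_unit hM) //; exact: (sigma_so hM).
Qed.

Lemma density_beta X : lam_support leaf X -> density (@beta R) X = 2.
Proof.
move=> lX; have [[hX te e1] _] := some_dirP lX.
by rewrite /density pairing_beta // e1 mulr1.
Qed.

Lemma density_mul (psi : 'cV[R]_3 -> R) phi X :
  density (fun X v => psi X *: phi X v) X = psi X * density phi X.
Proof. by rewrite /density pairingZl. Qed.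

Lemma density_le2 phi X : lam_support leaf X ->
  ad_form sigma phi -> is_id_part phi phi ->
  largest_singular_value X (phi X) <= Num.sqrt 2 -> density phi X <= 2.
Proof.
move=> lX fphi idphi hs; have [u _] := some_dirP lX; have [hX te _] := u.
apply: largest_singular_value_pairing => //.
- by move=> w tw; have [[w' tw' ->] _] := idphi X w hX tw; exists w'.
- by move=> a w w' tw tw'; exact: (af_linear fphi).
Qed.

End Density.

(** * Arclength and speed along the plaques of a flow-box *)

Section Clamp.
Variable R : realType.
Implicit Types a b t x y : R.

Definition clamp a b t : R := Num.min (Num.max t a) b.

Lemma clamp_in a b t : a <= b -> a <= clamp a b t <= b.
Proof.
move=> ab; rewrite /clamp.
by case: (leP t a) => h1; [case: (leP a b)|case: (leP t b)] => h2; apply/andP; split; lra.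
Qed.

Lemma clamp_id a b t : a <= t <= b -> clamp a b t = t.
Proof. by move=> /andP[at_ tb]; rewrite /clamp max_l // min_l. Qed.

Lemma clamp_homo a b x y : a <= b -> x <= y -> clamp a b x <= clamp a b y.
Proof.
move=> ab xy; rewrite /clamp.
by case: (leP x a) => h1; case: (leP y a) => h2; [case: (leP a b)|case: (leP a b); case: (leP y b)|
  case: (leP a b); case: (leP x b)|case: (leP x b); case: (leP y b)]; lra.
Qed.

Lemma clamp_lip a b x y : a <= b -> x <= y -> clamp a b y - clamp a b x <= y - x.
Proof.
move=> ab xy; rewrite /clamp.
by case: (leP x a) => h1; case: (leP y a) => h2; [case: (leP a b)|case: (leP a b); case: (leP y b)|
  case: (leP a b); case: (leP x b)|case: (leP x b); case: (leP y b)]; lra.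
Qed.

(** The constant [K + 1] avoids a separate treatment of [K = 0]. *)
Lemma lipschitz_continuous (f : R -> R) (K : R) : 0 <= K ->
  (forall x y, x <= y -> `|f y - f x| <= K * (y - x)) -> continuous f.
Proof.
move=> K0 lf x; apply/cvgrPdist_lt => e e0.
have K1 : 0 < K + 1 by rewrite ltr_wpDl.
have eK : 0 < e / (K + 1) by rewrite divr_gt0.
near=> y.
have xy : `|x - y| < e / (K + 1) by near: y; exact: cvgr_dist_lt.
have le1 : `|f x - f y| <= K * `|x - y|.
  case: (leP x y) => h.
    by rewrite distrC (distrC x) (ger0_norm (_ : 0 <= y - x)) ?subr_ge0 ?lf.
  by rewrite (ger0_norm (_ : 0 <= x - y)) ?subr_ge0 ?lf // ltW.
apply: le_lt_trans le1 _; move: xy; rewrite ltr_pdivlMr //.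
by have := normr_ge0 (x - y); lra.
Unshelve. all: by end_near. Qed.

Lemma is_derive_cosh (x : R) : is_derive x 1 (@cosh R) (sinh x).
Proof.
rewrite (_ : @cosh R = fun t => 2^-1 * (expR t + expR (- t))); last first.
  by apply/funext => t; rewrite /cosh mulrC.
apply: is_derive_eq; rewrite /sinh /GRing.scale /=; ring.
Qed.

Lemma is_derive_sinh (x : R) : is_derive x 1 (@sinh R) (cosh x).
Proof.
rewrite (_ : @sinh R = fun t => 2^-1 * (expR t - expR (- t))); last first.
  by apply/funext => t; rewrite /sinh mulrC.
apply: is_derive_eq; rewrite /cosh /GRing.scale /=; ring.
Qed.

Lemma distH_xx (X : 'cV[R]_3) : hyperboloid X -> distH X X = 0.
Proof.
by move=> hX; rewrite /distH (hyp_ip hX) opprK -(@cosh0 R) arccosh_cosh normr0.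
Qed.

End Clamp.

Section FlowBoxGeometry.
Variables (R : realType) (pi1 : groupType) (sigma : pi1 -> 'M[R]_3).
Variable leaf : set (set 'cV[R]_3).
Hypothesis hM : closed_hyperbolic_surface sigma.
Hypothesis hleaf : geodesic_lamination sigma leaf.
Variable B : flow_box sigma leaf.
Local Notation a := (fb_a B).
Local Notation b := (fb_b B).
Local Notation c := (fb_c B).
Local Notation d := (fb_d B).
Local Notation F := (fb_F B).
Local Notation C := (fb_C B).

Definition fb_K : R := sval (cid2 (fb_bilip B)).

Lemma fb_K_gt0 : 0 < fb_K. Proof. by rewrite /fb_K; case: cid2. Qed.

Lemma fb_lip t s t' s' : a <= t <= b -> c <= s <= d -> a <= t' <= b -> c <= s' <= d ->
  distH (F t s) (F t' s') <= fb_K * Num.max `|t - t'| `|s - s'|.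
Proof.
move=> ht hs ht' hs'; rewrite /fb_K; case: cid2 => /= K K0 h.
by have [] := h t s t' s'; rewrite ?in_itv.
Qed.

Lemma fb_hyp t s : a <= t <= b -> c <= s <= d -> hyperboloid (F t s).
Proof. by move=> ht hs; apply: fb_H; rewrite in_itv. Qed.

Lemma fb_antilip g h t s t' s' : a <= t <= b -> c <= s <= d -> a <= t' <= b -> c <= s' <= d ->
  Num.max `|t - t'| `|s - s'| <= fb_K * distH (sigma g *m F t s) (sigma h *m F t' s').
Proof.
move=> ht hs ht' hs'; have K0 := fb_K_gt0.
apply: (@le_trans _ _ (fb_K * distM sigma (F t s) (F t' s'))).
  move: K0; rewrite /fb_K; case: cid2 => /= K _ H _.
  by have [] := H t s t' s'; rewrite ?in_itv.
by rewrite ler_pM2l //; apply: distM_le => //; exact: fb_hyp.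
Qed.

Lemma fb_inj g h t s t' s' : a <= t <= b -> c <= s <= d -> a <= t' <= b -> c <= s' <= d ->
  sigma g *m F t s = sigma h *m F t' s' -> t = t' /\ s = s'.
Proof.
move=> ht hs ht' hs' e; have := fb_antilip g h ht hs ht' hs'.
rewrite e distH_xx ?mulr0; last by apply: (hyp_sigma hM); exact: fb_hyp.
rewrite ge_max !normr_le0 !subr_eq0 => /andP[/eqP -> /eqP ->] //.
Qed.

Lemma fb_C_itv s : C s -> c < s < d.
Proof. by move=> /(@fb_C_sub _ _ _ _ B); rewrite /= in_itv. Qed.

Lemma fb_C_itvW s : C s -> c <= s <= d.
Proof. by move=> /fb_C_itv /andP[/ltW -> /ltW ->]. Qed.

Lemma fb_ab_le : a <= b. Proof. exact/ltW/fb_ab. Qed.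

Lemma fb_lam t s : C s -> a <= t <= b -> lam_support leaf (F t s).
Proof. by move=> Cs ht; apply/(@fb_support _ _ _ _ B); rewrite ?in_itv ?fb_C_itvW. Qed.

(** A plaque lies on a geodesic. The arclength parameter of its points is a
    continuous injective function of [t], hence monotone, and increasing once
    the geodesic is suitably oriented; clamping [t] extends it to the whole
    line. *)
Lemma fb_arclength s : C s -> exists X v u, [/\ unit_tangent X v, leaf (geodesic_line X v),
  (forall t, a <= t <= b -> F t s = gam X v (u t)),
  {homo u : x y / x <= y} &
  forall x y, x <= y -> u y - u x <= fb_K * (y - x)].
Proof.
move=> Cs; have K0 := fb_K_gt0; have ab := fb_ab_le.
have hs := fb_C_itvW Cs.
have [l ll lF] := fb_leaf Cs.
have [X [v [hX tv v1 lE]]] := gl_geodesic hleaf ll.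
have uXv : unit_tangent X v by [].
have : forall t, exists u, a <= t <= b -> F t s = gam X v u.
  move=> t; case: (boolP (a <= t <= b)) => h; last by exists 0.
  have := lF t; rewrite in_itv /= h lE => /(_ isT) [u _ <-].
  by exists u.
move=> /choice [u0 Fu].
have u0d t t' : a <= t <= b -> a <= t' <= b -> `|u0 t - u0 t'| = distH (F t s) (F t' s).
  by move=> ht ht'; rewrite !Fu // distH_gam.
pose u t := u0 (clamp a b t).
have ud t t' : `|u t - u t'| = distH (F (clamp a b t) s) (F (clamp a b t') s).
  by apply: u0d; exact: clamp_in.
have lip x y : x <= y -> `|u y - u x| <= fb_K * (y - x).
  move=> xy; rewrite ud; apply: (le_trans (fb_lip _ _ _ _)); rewrite ?clamp_in //.
  rewrite ler_pM2l // subrr normr0 max_l ?normr_ge0 //.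
  by rewrite ger0_norm ?subr_ge0 ?clamp_homo // clamp_lip.
have cu : continuous u by apply: lipschitz_continuous lip; exact: ltW.
have inju : {in `[a, b] &, injective u}.
  move=> t t'; rewrite !in_itv /= => ht ht' e.
  have := ud t t'; rewrite e subrr normr0 !clamp_id // => h0.
  have := fb_antilip 1%g 1%g ht hs ht' hs; rewrite (distH_sigma hM) -h0 mulr0.
  by rewrite ge_max !normr_le0 !subr_eq0 => /andP[/eqP].
have mono (w : R -> R) : w a <= w b -> (forall t t', `|w t - w t'| = `|u t - u t'|) ->
    (forall t, w t = w (clamp a b t)) -> {homo w : x y / x <= y}.
  move=> wab wu wc x y xy; rewrite wc (wc y).
  have cw : continuous w.
    by apply: (@lipschitz_continuous _ _ fb_K) (ltW K0) _ => p q pq; rewrite wu; exact: lip.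
  have iw : {in `[a, b] &, injective w}.
    move=> t t' ht ht' e; apply: inju => //; apply/eqP; rewrite -subr_eq0 -normr_eq0.
    by rewrite -wu e subrr normr0.
  have := segment_continuous_inj_le wab (continuous_subspaceT cw) iw.
  by move=> -> //; rewrite ?in_itv ?clamp_in ?clamp_homo.
have cc t : clamp a b (clamp a b t) = clamp a b t by rewrite [LHS]clamp_id // clamp_in.
case: (leP (u a) (u b)) => uab.
  exists X, v, u; split => //; first by rewrite -lE.
  - by move=> t ht; rewrite /u clamp_id //; exact: Fu.
  - by apply: mono => // t; rewrite /u cc.
  - by move=> x y /lip; apply: le_trans; exact: ler_norm.
exists X, (- v), (fun t => - u t); split.
- by split => //; rewrite /tangent /= !ip_lin ?opprK // tv oppr0.
- rewrite (_ : geodesic_line X (- v) = l) // lE.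
  apply/seteqP; split => _ [t _ <-]; exists (- t) => //;
    by rewrite coshN sinhN scaleNr ?scalerN ?opprK.
- move=> t ht; rewrite /u clamp_id // Fu //.
  by rewrite /gam coshN sinhN scaleNr scalerN opprK.
- apply: mono => [|t t'|t]; first by rewrite lerN2 ltW.
    by rewrite -opprD normrN.
  by rewrite /u cc.
- move=> x y xy; rewrite -opprD; apply: (le_trans (ler_norm _)).
  by rewrite normrN; exact: lip.
Qed.

Lemma fb_dFE s t X v (u : R -> R) : (forall t, a <= t <= b -> F t s = gam X v (u t)) ->
  a < t < b -> derivable u t 1 ->
  fb_dF B t s = derive1 u t *: dgam X v (u t).
Proof.
move=> FE /andP[at_ tb] du; apply/matrixP => i j; rewrite ord1 {j} !mxE derive1E.
have du' : is_derive t 1 u (derive1 u t) by rewrite derive1E; apply: DeriveDef.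
have H : is_derive t 1 (fun y => cosh (u y) * X i 0 + sinh (u y) * v i 0)
    (derive1 u t * (sinh (u t) * X i 0 + cosh (u t) * v i 0)).
  have dc := @is_derive1_comp _ (@cosh R) u t _ _ (is_derive_cosh (u t)) du'.
  have ds := @is_derive1_comp _ (@sinh R) u t _ _ (is_derive_sinh (u t)) du'.
  have -> : (fun y => cosh (u y) * X i 0 + sinh (u y) * v i 0) =
    X i 0 *: (@cosh R \o u) + v i 0 *: (@sinh R \o u).
    apply/funext => y; change (cosh (u y) * X i 0 + sinh (u y) * v i 0 =
      X i 0 * cosh (u y) + v i 0 * sinh (u y)); ring.
  have D := is_deriveD (is_deriveZ (X i 0) dc) (is_deriveZ (v i 0) ds).
  apply: is_derive_eq D _; rewrite /GRing.scale /=.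
  by move: (derive1 u t) (sinh (u t)) (cosh (u t)) => p q r'; ring.
rewrite -(@derive_val _ _ _ _ _ _ _ H); apply: near_eq_derive.
near=> y; rewrite FE ?mxE //; apply/andP; split; apply: ltW; near: y.
  exact: lt_nbhsr.
exact: lt_nbhsl.
Unshelve. all: by end_near. Qed.

Local Notation leb := (@lebesgue_measure R).

(** By [lipschitz_FTC] the arclength parameter [u] of a plaque is almost
    everywhere differentiable and is the integral of its derivative. At such a
    parameter the box moves with velocity [derive1 u t] times the unit tangent
    vector, and the two factors of the generator and of the form combine to
    the density. *)
Lemma fb_speed_ex s : exists r : R -> R, C s ->
  [/\ measurable_fun [set: R] r, forall x, 0 <= r x,
    forall x y, a <= x -> x <= y -> y <= b ->
      leb.-integrable `[x, y]%classic (EFin \o r) /\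
      \int[leb]_(t in `[x, y]%classic) r t = distH (F x s) (F y s) &
    {ae leb, forall t, `]a, b[%classic t -> hnorm (fb_dF B t s) = r t /\
      forall phi, ad_form sigma phi ->
        pairing (phi (F t s) (fb_dF B t s)) (fb_generator B t s) =
        density leaf phi (F t s) * r t}].
Proof.
case: (pselect (C s)) => [Cs|]; last by exists (fun=> 0).
have [X [v [u [uXv ll FE mu lu]]]] := fb_arclength Cs.
have K0 := fb_K_gt0; have hs := fb_C_itvW Cs.
have [r [mr r0 ri rd]] := lipschitz_FTC (fb_ab B) (ltW K0) mu lu.
exists r => _; split => //.
  move=> x y ax xy yb; have [i1 ->] := ri _ _ ax xy yb; split => //.
  have hx : a <= x <= b by rewrite ax (le_trans xy yb).
  have hy : a <= y <= b by rewrite yb (le_trans ax xy).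
  by rewrite (FE x hx) (FE y hy) (distH_gam _ _ uXv) distrC ger0_norm // subr_ge0; exact: mu.
apply: filterS rd; first exact: (ae_filter_ringOfSetsType leb).
move=> t ht /[dup] /ht [du u't]; rewrite /= in_itv /= => tab.
have tab' : a <= t <= b by case/andP: tab => /ltW -> /ltW ->.
have dF := fb_dFE FE tab du; rewrite u't in dF.
have u1 := gam_unit (u t) uXv.
have [hG tG d1] := u1.
have hn : hnorm (fb_dF B t s) = r t.
  by rewrite dF /hnorm ipZl ipZr d1 mulr1 -expr2 sqrtr_sqr ger0_norm.
split; first exact: hn.
move=> phi fphi.
rewrite /fb_generator /fb_unit hn dF (FE t tab').
have ld : leaf_dir leaf (gam X v (u t)) (dgam X v (u t)).
  by split => //; rewrite geodesic_line_shift.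
rewrite (densityE hleaf fphi ld) (ad_formZ _ fphi) // pairingZl mulrC.
have [->|r1] := eqVneq (r t) 0; first by rewrite !mulr0.
by rewrite scalerA mulVf // scale1r.
Qed.

Definition fb_speed s : R -> R := sval (cid (fb_speed_ex s)).

Lemma fb_speedP s : C s ->
  [/\ measurable_fun [set: R] (fb_speed s), forall x, 0 <= fb_speed s x,
    forall x y, a <= x -> x <= y -> y <= b ->
      leb.-integrable `[x, y]%classic (EFin \o fb_speed s) /\
      \int[leb]_(t in `[x, y]%classic) fb_speed s t = distH (F x s) (F y s) &
    {ae leb, forall t, `]a, b[%classic t -> hnorm (fb_dF B t s) = fb_speed s t /\
      forall phi, ad_form sigma phi ->
        pairing (phi (F t s) (fb_dF B t s)) (fb_generator B t s) =
        density leaf phi (F t s) * fb_speed s t}].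
Proof. by rewrite /fb_speed; case: cid. Qed.

End FlowBoxGeometry.

(** * Riemann sums with uncovered points *)

Section RealIntegrals.
Context d (T : measurableType d) (R : realType) (mu : {measure set T -> \bar R}).
Implicit Types (D A : set T) (f g r q : T -> R).

Lemma Rintegral_sum D (I : Type) (s : seq I) (f : I -> T -> R) : measurable D ->
  (forall i, mu.-integrable D (EFin \o f i)) ->
  mu.-integrable D (EFin \o (fun x => \sum_(i <- s) f i x)) /\
  \int[mu]_(x in D) (\sum_(i <- s) f i x) = \sum_(i <- s) \int[mu]_(x in D) f i x.
Proof.
move=> mD intf.
have intS s' : mu.-integrable D (EFin \o (fun x => \sum_(i <- s') f i x)).
  rewrite (_ : _ \o _ = (fun x => \sum_(i <- s') (EFin \o f i) x)%E).
    by apply: integrable_sum => // i _; exact: intf.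
  by apply/funext => x /=; rewrite sumEFin.
split; first exact: intS.
elim: s => [|i s IH].
  under eq_Rintegral do rewrite big_nil.
  by rewrite big_nil Rintegral_cst // mul0r.
under eq_Rintegral do rewrite big_cons.
by rewrite RintegralD ?intf ?intS // IH big_cons.
Qed.

Lemma integrable_scale D (k : R) r : measurable D ->
  mu.-integrable D (EFin \o r) -> mu.-integrable D (EFin \o (fun x => k * r x)).
Proof. by move=> mD ir; exact: (integrableZl mD k ir). Qed.

Lemma integrable_mul_indic D A r : measurable D -> measurable A ->
  mu.-integrable D (EFin \o r) ->
  mu.-integrable D (EFin \o (fun x => \1_A x * r x)).
Proof.
move=> mD mA ir.
rewrite (_ : _ \o _ = (EFin \o \1_A) \* (EFin \o r))%E; last first.
  by apply/funext => x /=; rewrite EFinM.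
apply: integrableMr => //.
exists 1; split; rewrite ?num_real // => x x1 y _ /=.
by rewrite (le_trans _ (ltW x1)) // indicE; case: (_ \in _); rewrite ?normr1 ?normr0.
Qed.

Lemma Rintegral_mul_indic D A r : A `<=` D ->
  \int[mu]_(x in D) (\1_A x * r x) = \int[mu]_(x in A) r x.
Proof.
move=> AD; rewrite -[in RHS](setIidr AD) Rintegral_mkcondr; apply: eq_Rintegral => x _.
by rewrite patchE indicE; case: (_ \in _); rewrite ?mul1r ?mul0r.
Qed.

Lemma indic_sum_at (I : finType) (S : I -> set T) (c : I -> R) x i :
  (forall i j x, S i x -> S j x -> i = j) -> S i x ->
  \sum_j c j * \1_(S j) x = c i.
Proof.
move=> dis Six; rewrite (bigD1 i) //= big1 => [|j ji].
  by rewrite indicE mem_set // mulr1 addr0.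
rewrite indicE memNset ?mulr0 // => Sjx; move: ji; rewrite (dis _ _ _ Six Sjx) eqxx //.
Qed.

Lemma indic_sum_out (I : finType) (S : I -> set T) (c : I -> R) x :
  (forall i, ~ S i x) -> \sum_j c j * \1_(S j) x = 0.
Proof. by move=> h; rewrite big1 // => j _; rewrite indicE memNset ?mulr0. Qed.

(** The cells of a flow-box, once transported to another one, are pairwise
    disjoint but cover only the part of a plaque on which the integrand is not
    small; this is why uncovered points are admitted. The lengths [l] may
    carry a small relative error, which sums up to a multiple of the total
    length. *)
Lemma riemann_estimate D (I : finType) (S : I -> set T) (c l : I -> R) q r (e M : R) :
  measurable D -> 0 <= e -> 0 <= M -> mu.-integrable D (EFin \o r) -> (forall x, 0 <= r x) ->
  mu.-integrable D (EFin \o (fun x => q x * r x)) ->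
  (forall i, measurable (S i)) -> (forall i, S i `<=` D) ->
  (forall i j x, S i x -> S j x -> i = j) ->
  (forall i, `|c i| <= M) ->
  (forall i x, S i x -> `|q x - c i| <= e) ->
  (forall x, D x -> (forall i, ~ S i x) -> `|q x| <= e) ->
  (forall i, `|\int[mu]_(x in S i) r x - l i| <= e * \int[mu]_(x in S i) r x) ->
  `|\int[mu]_(x in D) (q x * r x) - \sum_i c i * l i|
    <= e * (1 + M) * \int[mu]_(x in D) r x.
Proof.
move=> mD e0 M0 ir r0 iq mS SD dis cM qc q0 rl.
set L := \int[mu]_(x in D) r x.
have iS i : mu.-integrable D (EFin \o (fun x => \1_(S i) x * r x)).
  exact: integrable_mul_indic.
have iZ k i : mu.-integrable D (EFin \o (fun x => k * (\1_(S i) x * r x))).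
  exact: integrable_scale.
have sumE (k : I -> R) : mu.-integrable D (EFin \o (fun x => \sum_i (k i * (\1_(S i) x * r x)))) /\
    \int[mu]_(x in D) (\sum_i (k i * (\1_(S i) x * r x))) =
    \sum_i k i * \int[mu]_(x in S i) r x.
  have [h1 h2] := @Rintegral_sum D I (index_enum I) (fun i x => k i * (\1_(S i) x * r x)) mD
    (fun i => iZ (k i) i).
  split => //; rewrite h2; apply: eq_bigr => i _.
  by rewrite RintegralZl // Rintegral_mul_indic.
have [ic Ec] := sumE c; have [i1 E1] := sumE (fun=> 1).
have part1 : `|\int[mu]_(x in D) (q x * r x) - \sum_i c i * \int[mu]_(x in S i) r x| <= e * L.
  have ier : mu.-integrable D (EFin \o (fun x => e * r x)).
    exact: integrable_scale.
  rewrite -Ec -RintegralB //.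
  have iB : mu.-integrable D (EFin \o (fun x => q x * r x - \sum_i (c i * (\1_(S i) x * r x)))).
    exact: (integrableB mD iq ic).
  apply: (le_trans (le_normr_Rintegral _ iB)) => //.
  rewrite -RintegralZl //; apply: le_Rintegral => //.
    exact: (integrable_abse iB).
  move=> x Dx; under eq_bigr do rewrite mulrA.
  rewrite -mulr_suml -mulrBl normrM (ger0_norm (r0 x)) ler_wpM2r //.
  case: (pselect (exists i, S i x)) => [[i Six]|nS].
    by rewrite (indic_sum_at c dis Six); exact: qc.
  have nS' i : ~ S i x by move=> h; apply: nS; exists i.
  by rewrite indic_sum_out // subr0; exact: q0.
have part2 : \sum_i \int[mu]_(x in S i) r x <= L.
  have -> : \sum_i \int[mu]_(x in S i) r x = \sum_i 1 * \int[mu]_(x in S i) r x.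
    by apply: eq_bigr => i _; rewrite mul1r.
  rewrite -E1; apply: le_Rintegral => // x Dx; under eq_bigr do rewrite mulrA.
  rewrite -mulr_suml -[leRHS]mul1r ler_wpM2r //.
  case: (pselect (exists i, S i x)) => [[i Six]|nS].
    by rewrite (indic_sum_at (fun=> 1) dis Six).
  by rewrite indic_sum_out // => i h; apply: nS; exists i.
have part3 : `|\sum_i c i * \int[mu]_(x in S i) r x - \sum_i c i * l i| <= e * M * L.
  rewrite -sumrB; apply: (le_trans (ler_norm_sum _ _ _)).
  apply: (@le_trans _ _ (\sum_i M * e * \int[mu]_(x in S i) r x)).
    apply: ler_sum => i _; rewrite -mulrBr normrM -mulrA.
    by apply: ler_pM.
  by rewrite -mulr_sumr (mulrC M) ler_wpM2l // mulr_ge0.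
have -> : e * (1 + M) * L = e * L + e * M * L by ring.
rewrite -[X in `|X|](subrKA (\sum_i c i * \int[mu]_(x in S i) r x)).
apply: (le_trans (ler_normD _ _)); exact: lerD.
Qed.

End RealIntegrals.

(** * Uniform continuity and subdivision of intervals *)

Section Heine.
Variable R : realType.

Lemma heine (f : R * R -> R) (A : set (R * R)) (e : R) : compact A -> continuous f -> 0 < e ->
  exists2 dl : R, 0 < dl & forall p p', A p ->
    `|p.1 - p'.1| < dl -> `|p.2 - p'.2| < dl -> `|f p - f p'| < e.
Proof.
move=> cA cf e0.
have e2 : 0 < e / 2 by rewrite divr_gt0.
pose P (dl : R) (p : R * R) := forall p',
  `|p.1 - p'.1| < dl -> `|p.2 - p'.2| < dl -> `|f p - f p'| < e.
have H : \forall dl \near (0 : R)^'+, A `<=` P dl.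
  move/compact_near_coveringP : cA => /(_ R (0 : R)^'+ P _); apply => p Ap.
  have /cvgrPdist_lt /(_ _ e2) := cf p.
  move=> /nbhs_ballP [r /= r0 br].
  exists (ball p (r / 2), [set dl : R | 0 < dl < r / 2]).
    split => /=; first by apply: nbhsx_ballx; rewrite divr_gt0.
    by near=> dl; apply/andP; split; near: dl; [exact: nbhs_right_gt|
      apply: nbhs_right_lt; rewrite divr_gt0].
  move=> [p' dl] /= [pp' /andP[dl0 dlr]] p'' h1 h2.
  have b1 : ball p r p'.
    by apply: le_ball pp'; rewrite ler_pdivrMr // ler_pMr // ler1n.
  have b2 : ball p r p''.
    move: pp' => [] /=; rewrite /ball /= => q1 q2; split; rewrite /ball /=.
      by move: (ler_normD (p.1 - p'.1) (p'.1 - p''.1)); rewrite subrKA; lra.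
    by move: (ler_normD (p.2 - p'.2) (p'.2 - p''.2)); rewrite subrKA; lra.
  have f1 := br _ b1; have f2 := br _ b2.
  have := ler_normD (f p' - f p) (f p - f p''); rewrite subrKA (distrC (f p') (f p)); move: f1 f2.
  by rewrite /=; lra.
have [dl [dl0 Hd]] : exists dl : R, 0 < dl /\ A `<=` P dl.
  apply: (@filter_ex _ (0 : R)^'+); near=> dl; split; near: dl => //.
  exact: nbhs_right_gt.
by exists dl => // p p' Ap; exact: Hd.
Unshelve. all: by end_near. Qed.

End Heine.

Section Partition.
Variable R : realType.
Implicit Types a b t : R.

Definition tau a b (N : nat) (k : nat) : R := a + k%:R * ((b - a) / N.+1%:R).

Lemma tau_itv a b N k : a < b -> (k <= N.+1)%N -> a <= tau a b N k <= b.
Proof.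
move=> ab kN; have h0 : 0 < (b - a) / N.+1%:R by rewrite divr_gt0 // subr_gt0.
rewrite /tau; apply/andP; split; first by rewrite lerDl mulr_ge0 // ltW.
by rewrite -lerBrDl mulrA ler_pdivrMr // [leRHS]mulrC ler_wpM2r ?subr_ge0 ?(ltW ab) // ler_nat.
Qed.

Lemma tauS a b N k : tau a b N k.+1 = tau a b N k + (b - a) / N.+1%:R.
Proof. by rewrite /tau -addn1 natrD; ring. Qed.

(** A choice of one cell for each point makes the cells disjoint, although the
    closed intervals share endpoints. *)
Lemma cell_index a b N : a < b -> exists idx : R -> 'I_N.+1,
  (forall t, a <= t <= b -> tau a b N (idx t) <= t <= tau a b N (idx t).+1) /\
  (forall t (k : 'I_N.+1), tau a b N k < t < tau a b N k.+1 -> idx t = k).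
Proof.
move=> ab; set h := (b - a) / N.+1%:R.
have h0 : 0 < h by rewrite divr_gt0 // subr_gt0.
pose k t := minn (Num.truncn ((t - a) / h)) N.
exists (fun t => inord (k t)); split.
  move=> t /andP[at_ tb].
  have t0 : 0 <= (t - a) / h by rewrite divr_ge0 ?subr_ge0 // ltW.
  have kE : nat_of_ord (inord (k t) : 'I_N.+1) = k t by rewrite inordK // ltnS geq_minr.
  have /andP[lo hi] := truncn_itv t0.
  rewrite kE tauS /tau -/h; apply/andP; split.
    rewrite -lerBrDl -ler_pdivlMr //; apply: le_trans lo; rewrite ler_nat; exact: geq_minl.
  rewrite -addrA -{2}[h]mul1r -mulrDl -lerBlDl natr1 -ler_pdivrMr // /k.
  case: (leqP (Num.truncn ((t - a) / h)) N) => hN; first by rewrite ltW.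
  by rewrite ler_pdivrMr // mulrC mulfVK ?pnatr_eq0 //; lra.
move=> t j /andP[]; rewrite tauS /tau -/h => lo hi.
have at_ : 0 <= (t - a) / h.
  apply: divr_ge0; last exact: ltW.
  rewrite subr_ge0; apply/ltW/(le_lt_trans _ lo); rewrite lerDl.
  by apply: mulr_ge0; [exact: ler0n|exact: ltW].
suff -> : k t = j by rewrite inord_val.
rewrite /k (_ : Num.truncn _ = j); first by apply/minn_idPl; rewrite -ltnS.
apply/eqP; rewrite truncn_eq //; apply/andP; split.
  by rewrite ler_pdivlMr //; lra.
by rewrite ltr_pdivrMr // -natr1 mulrDl mul1r; lra.
Qed.

End Partition.

(** * Continuity of expressions on the hyperboloid *)

Section ContinuousCalculus.
Variables (R : realType) (T : topologicalType).
Implicit Types (f g : T -> R).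

Lemma contD f g : continuous f -> continuous g -> continuous (fun p => f p + g p).
Proof. by move=> cf cg p; apply: cvgD; [exact: cf|exact: cg]. Qed.
Lemma contN f : continuous f -> continuous (fun p => - f p).
Proof. by move=> cf p; apply: cvgN; exact: cf. Qed.
Lemma contM f g : continuous f -> continuous g -> continuous (fun p => f p * g p).
Proof. by move=> cf cg p; apply: cvgM; [exact: cf|exact: cg]. Qed.
Lemma cont_cst (k : R) : continuous (fun _ : T => k).
Proof. by move=> p; exact: cvg_cst. Qed.
Lemma contV f : (forall p, f p != 0) -> continuous f -> continuous (fun p => (f p)^-1).
Proof. by move=> f0 cf p; apply: cvgV => //; exact: cf. Qed.
Lemma cont_comp (U V : topologicalType) (f : T -> U) (g : U -> V) :
  continuous f -> continuous g -> continuous (fun p => g (f p)).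
Proof. by move=> cf cg p; apply: continuous_comp; [exact: cf|exact: cg]. Qed.

Definition cont3 (W : T -> 'cV[R]_3) := forall i, continuous (fun p => W p i 0).
Definition contmx (P : T -> 'M[R]_3) := forall i j, continuous (fun p => P p i j).

Lemma cont_ip V W : cont3 V -> cont3 W -> continuous (fun p => ip (V p) (W p)).
Proof.
move=> cV cW; rewrite (_ : (fun p => _) = (fun p => V p 0 0 * W p 0 0 +
  V p 1 0 * W p 1 0 + - (V p ord_max 0 * W p ord_max 0))); last first.
  by apply/funext => p; rewrite ipE.
by apply: contD; [apply: contD|apply: contN]; apply: contM; exact: cV || exact: cW.
Qed.

Lemma cont_sum3 (h : 'I_3 -> T -> R) :
  (forall i, continuous (h i)) -> continuous (fun p => \sum_(i < 3) h i p).
Proof.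
move=> ch; rewrite (_ : (fun p => _) = (fun p => h 0 p + h 1 p + h ord_max p)).
  by apply: contD; [apply: contD|]; exact: ch.
by apply/funext => p; rewrite sum_ord3.
Qed.

Lemma cont_pairing P Q : contmx P -> contmx Q -> continuous (fun p => pairing (P p) (Q p)).
Proof.
move=> cP cQ.
have -> : (fun p => pairing (P p) (Q p)) =
    (fun p => \sum_(i < 3) \sum_(j < 3) (P p i j * Q p j i)).
  by apply/funext => p; rewrite /pairing /mxtrace; apply: eq_bigr => i _; rewrite mxE.
by apply: cont_sum3 => i; apply: cont_sum3 => j; apply: contM; [exact: cP|exact: cQ].
Qed.

Lemma cont_beta V W : cont3 V -> cont3 W -> contmx (fun p => beta (V p) (W p)).
Proof.
move=> cV cW i j; rewrite (_ : (fun p => _) = (fun p => V p i 0 * sharp (W p) 0 j +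
  - (W p i 0 * sharp (V p) 0 j))); last by apply/funext => p; rewrite /beta crossE.
have cs U : cont3 U -> continuous (fun p => sharp (U p) 0 j).
  move=> cU; rewrite (_ : (fun p => _) = (fun p => if j == ord_max then - U p j 0 else U p j 0)).
    by case: (j == ord_max); [apply: contN|]; exact: cU.
  by apply/funext => p; rewrite sharpE.
apply: contD; [|apply: contN]; apply: contM; solve [exact: cV|exact: cW|exact: cs].
Qed.

Lemma cont3Z f W : continuous f -> cont3 W -> cont3 (fun p => f p *: W p).
Proof.
move=> cf cW i; rewrite (_ : (fun p => _) = (fun p => f p * W p i 0)).
  by apply: contM => //; exact: cW.
by apply/funext => p; rewrite mxE.
Qed.

Lemma cont3B V W : cont3 V -> cont3 W -> cont3 (fun p => V p - W p).
Proof.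
move=> cV cW i; rewrite (_ : (fun p => _) = (fun p => V p i 0 + - W p i 0)).
  by apply: contD; [exact: cV|apply: contN; exact: cW].
by apply/funext => p; rewrite !mxE.
Qed.

Lemma cont_arccosh f : (forall p, 1 <= f p) -> continuous f ->
  continuous (fun p => arccosh (f p)).
Proof.
move=> f1 cf p.
have c2 : continuous (fun p => f p ^+ 2 - 1).
  by apply: contD; [exact: contM|exact: cont_cst].
have cs : continuous (fun p => f p + Num.sqrt (f p ^+ 2 - 1)).
  apply: contD => // x; exact: (continuous_comp (c2 x) (@sqrt_continuous R _)).
apply: (continuous_comp (cs p)); apply: continuous_ln.
by rewrite ltr_wpDr ?sqrtr_ge0 // (lt_le_trans _ (f1 p)).
Qed.

(** By linearity it suffices to evaluate [phi] on the two coordinate fields of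
    the chart, where continuity is part of smoothness. *)
Lemma ad_form_cont (pi1 : groupType) (sigma : pi1 -> 'M[R]_3) phi V W :
  ad_form sigma phi -> (forall p, hyperboloid (V p)) -> (forall p, tangent (V p) (W p)) ->
  cont3 V -> cont3 W -> contmx (fun p => phi (V p) (W p)).
Proof.
move=> fphi hV tW cV cW i j.
pose x p := (V p 0 0, V p 1 0) : R * R.
have cx : continuous x by move=> p; exact: (cvg_pair (@cV 0 p) (@cV 1 p)).
have cD w : continuous (fun p => phi (hchart (x p)) (dhchart (x p) w) i j).
  apply: (cont_comp (f := x) (g := fun y : R * R => phi (hchart y) (dhchart y w) i j)) => //.
  exact: (Ck_continuous (af_smooth fphi w i j 0%N)).
rewrite (_ : (fun p => _) = (fun p =>
   W p 0 0 * phi (hchart (x p)) (dhchart (x p) (1, 0)) i j +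
   W p 1 0 * phi (hchart (x p)) (dhchart (x p) (0, 1)) i j)).
  by apply: contD; apply: contM => //; exact: cW.
apply/funext => p.
have -> : W p = W p 0 0 *: dhchart (x p) (1, 0) + W p 1 0 *: dhchart (x p) (0, 1).
  rewrite -[LHS](dhchart_inv (hV p) (tW p)) -/(x p).
  by apply: cV3P; rewrite !mxE /=; ring.
rewrite /x (hchart_inv (hV p)) -/(x p).
have tx w : tangent (V p) (dhchart (x p) w).
  by rewrite -[in tangent (V p)](hchart_inv (hV p)); exact: dhchart_tangent.
rewrite (af_linear fphi) //; last exact: tangentZ.
by rewrite (ad_formZ _ fphi) // !mxE /= !mulr1 !mulr0 !addr0 !add0r.
Qed.

End ContinuousCalculus.

(** * Integrals over sets that differ by a null set *)

Section NullDomain.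
Context d (T : measurableType d) (R : realType) (mu : {measure set T -> \bar R}).

Lemma eq_Rintegral_ae_dom (D E : set T) (f g : T -> R) :
  {ae mu, forall x, (f \_ D) x = (g \_ E) x} ->
  \int[mu]_(x in D) f x = \int[mu]_(x in E) g x.
Proof.
move=> h; rewrite Rintegral_mkcond [RHS]Rintegral_mkcond.
apply: eq_Rintegral_ae; apply: (@filterS _ _ (ae_filter_ringOfSetsType mu) _ _ _ h).
by move=> x hx _.
Qed.

End NullDomain.

Section Sandwich.
Variable R : realType.
Local Notation leb := (@lebesgue_measure R).

Lemma sandwich_measurable (x y : R) (S : set R) :
  (forall t, x < t < y -> S t) -> (forall t, S t -> x <= t <= y) -> measurable S.
Proof.
move=> h1 h2; apply: is_interval_measurable => u v Su Sv z /andP[uz zv].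
have /andP[xu _] := h2 _ Su; have /andP[_ vy] := h2 _ Sv.
move: uz zv; rewrite le_eqVlt => /orP[/eqP <- //|uz].
rewrite le_eqVlt => /orP[/eqP -> //|zv].
by apply: h1; rewrite (le_lt_trans xu uz) (lt_le_trans zv vy).
Qed.

Lemma ae_neq (x : R) : {ae leb, forall t, t != x}.
Proof.
exists [set x]; split; [exact: measurable_set1|exact: lebesgue_measure_set1|].
by move=> t /= /negP; rewrite negbK => /eqP.
Qed.

Lemma sandwich_integral (x y : R) (S : set R) (r : R -> R) :
  (forall t, x < t < y -> S t) -> (forall t, S t -> x <= t <= y) ->
  \int[leb]_(t in S) r t = \int[leb]_(t in `[x, y]%classic) r t.
Proof.
move=> h1 h2; apply: eq_Rintegral_ae_dom.
have FF := ae_filter_ringOfSetsType leb.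
near=> t.
have tx : t != x by near: t; exact: ae_neq.
have ty : t != y by near: t; exact: ae_neq.
rewrite !patchE; case: ifPn => [/set_mem /h2 xty|/negP tS]; first by rewrite mem_set //= in_itv.
case: ifPn => // /set_mem /=; rewrite in_itv /= => /andP[xt ty'].
by exfalso; apply: tS; apply/mem_set/h1; rewrite !lt_neqAle xt ty' (eq_sym x) tx ty.
Unshelve. all: by end_near. Qed.

End Sandwich.

(** * Integrals over a flow-box *)

Section BoxIntegral.
Variables (R : realType) (pi1 : groupType) (sigma : pi1 -> 'M[R]_3).
Variable leaf : set (set 'cV[R]_3).
Hypothesis hM : closed_hyperbolic_surface sigma.
Hypothesis hleaf : geodesic_lamination sigma leaf.
Variable B : flow_box sigma leaf.
Local Notation a := (fb_a B).
Local Notation b := (fb_b B).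
Local Notation c := (fb_c B).
Local Notation d := (fb_d B).
Local Notation F := (fb_F B).
Local Notation C := (fb_C B).
Local Notation K := (fb_K B).
Local Notation leb := (@lebesgue_measure R).
Local Notation speed := (fb_speed hM hleaf B).

Definition box_map (p : R * R) := F (clamp a b p.1) (clamp c d p.2).

Let ab : a <= b. Proof. exact: fb_ab_le. Qed.
Let cd : c <= d. Proof. exact/ltW/fb_cd. Qed.

Lemma box_map_id t s : a <= t <= b -> c <= s <= d -> box_map (t, s) = F t s.
Proof. by move=> ht hs; rewrite /box_map /= !clamp_id. Qed.

Lemma box_map_hyp p : hyperboloid (box_map p).
Proof. by apply: fb_hyp; exact: clamp_in. Qed.

Lemma clamp_dist (x y u v : R) : x <= y -> `|clamp x y u - clamp x y v| <= `|u - v|.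
Proof.
move=> xy; case: (leP u v) => uv.
  rewrite distrC (distrC u) !ger0_norm ?subr_ge0 ?clamp_homo //; exact: clamp_lip.
by rewrite !ger0_norm ?subr_ge0 ?clamp_homo ?clamp_lip ?(ltW uv).
Qed.

Lemma box_map_lip p p' : distH (box_map p) (box_map p') <= K * Num.max `|p.1 - p'.1| `|p.2 - p'.2|.
Proof.
apply: le_trans (fb_lip _ _ _ _) _; rewrite ?clamp_in // ler_pM2l ?fb_K_gt0 //.
by rewrite ge_max !le_max !clamp_dist ?orbT.
Qed.

Lemma box_map_cont : cont3 box_map.
Proof.
move=> i p; apply/cvgrPdist_lt => e e0.
pose z := box_map p ord_max 0.
pose f (p' : R * R) := 2 * z * (expR (K * (`|p.1 - p'.1| + `|p.2 - p'.2|)) - 1).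
have cf : continuous f.
  apply: contM; first exact: cont_cst.
  apply: contD; last exact: cont_cst.
  apply: (cont_comp (g := @expR R)); last exact: continuous_expR.
  apply: contM; first exact: cont_cst.
  have c1 : continuous (fun p' : R * R => `|p.1 - p'.1|).
    apply: (cont_comp (g := fun x : R => `|x|)); last exact: norm_continuous.
    by apply: contD; [exact: cont_cst|apply: contN => q; exact: cvg_fst].
  have c2 : continuous (fun p' : R * R => `|p.2 - p'.2|).
    apply: (cont_comp (g := fun x : R => `|x|)); last exact: norm_continuous.
    by apply: contD; [exact: cont_cst|apply: contN => q; exact: cvg_snd].
  exact: contD.
have f0 : f p = 0 by rewrite /f !subrr normr0 addr0 mulr0 expR0 subrr mulr0.
have /cvgrPdist_lt /(_ _ e0) := cf p; rewrite f0; apply: filterS => p'.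
rewrite sub0r normrN => fe; apply: le_lt_trans fe; rewrite distrC.
apply: (le_trans (coord_distH i (box_map_hyp p) (box_map_hyp p'))); apply: le_trans (ler_norm _).
have z1 : 1 <= z := hyp_ge1 (box_map_hyp p).
apply: ler_wpM2l; first by rewrite -/z mulr_ge0 //; exact: le_trans ler01 z1.
rewrite lerD2r ler_expR; apply: (le_trans (box_map_lip p p')); rewrite ler_pM2l ?fb_K_gt0 //.
by rewrite ge_max lerDl lerDr !normr_ge0.
Qed.

Let Fa (p : R * R) := box_map (a, p.2).
Let Fb (p : R * R) := box_map (b, p.2).

Let cont3_fix (t : R) : cont3 (fun p : R * R => box_map (t, p.2)).
Proof.
move=> i; apply: (cont_comp (f := fun p : R * R => (t, p.2)) (g := fun p => box_map p i 0));
  last exact: box_map_cont.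
by move=> p; exact: (cvg_pair (cvg_cst t) (@cvg_snd _ _ _ _ _)).
Qed.

(** A combination of the ends of the plaque that is orthogonal to [box_map p];
    along the lamination it spans the direction of the leaf. *)
Definition chord_dir (p : R * R) : 'cV[R]_3 :=
  ip (box_map p) (Fa p) *: Fb p - ip (box_map p) (Fb p) *: Fa p.

(** The direction of a leaf is only defined along the lamination and up to
    sign. This expression of the density makes sense on the whole rectangle of
    parameters, where it is visibly continuous. *)
Definition density_ext (phi : 'cV[R]_3 -> 'cV[R]_3 -> 'M[R]_3) (p : R * R) : R :=
  pairing (phi (box_map p) (chord_dir p)) (beta (box_map p) (chord_dir p))
    / (ip (Fa p) (Fb p) ^+ 2 - 1).

Let FaFb p : ip (Fa p) (Fb p) < -1.
Proof.
apply: ip_hyp_neq; [exact: box_map_hyp|exact: box_map_hyp|].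
rewrite /Fa /Fb /box_map /= => e.
have [] := @fb_inj _ _ _ _ hM B 1%g 1%g _ _ _ _ (clamp_in a ab) (clamp_in p.2 cd)
  (clamp_in b ab) (clamp_in p.2 cd) (congr1 _ e).
by move=> + _; rewrite !clamp_id ?lexx ?ab // => E; have := fb_ab B; rewrite E ltxx.
Qed.

Lemma density_ext_cont phi : ad_form sigma phi -> continuous (density_ext phi).
Proof.
move=> fphi; apply: contM; last first.
  apply: contV => [p|].
    by have := FaFb p => h; rewrite gt_eqF // subr_gt0 -sqrrN expr_gt1 //; lra.
  by apply: contD; [apply: contM; apply: cont_ip; exact: cont3_fix|exact: cont_cst].
have cw : cont3 chord_dir.
  by apply: cont3B; apply: cont3Z; try (apply: cont_ip; [exact: box_map_cont|]); exact: cont3_fix.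
apply: cont_pairing; last by apply: cont_beta => //; exact: box_map_cont.
apply: ad_form_cont fphi box_map_hyp _ box_map_cont cw => p.
by rewrite /tangent /= /chord_dir !ip_lin mulrC subrr.
Qed.

(** On the geodesic that carries the plaque the addition formulas turn
    [chord_dir] into [sinh (u a - u b)] times the unit tangent vector, and the
    denominator of [density_ext] is the square of this factor. *)
Lemma density_extE phi t s : ad_form sigma phi -> C s -> a <= t <= b ->
  density leaf phi (F t s) = density_ext phi (t, s).
Proof.
move=> fphi Cs ht; have hs := fb_C_itvW Cs.
have [X [v [u [uXv ll FE _ _]]]] := fb_arclength hM hleaf Cs.
have h0 := FaFb (t, s).
have FaE : Fa (t, s) = gam X v (u a) by rewrite /Fa box_map_id ?lexx ?ab ?FE ?lexx ?ab.
have FbE : Fb (t, s) = gam X v (u b) by rewrite /Fb box_map_id ?lexx ?ab ?FE ?lexx ?ab.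
have GE : box_map (t, s) = gam X v (u t) by rewrite box_map_id // FE.
set x := u t in GE; set k := sinh (u a - u b).
have wE : chord_dir (t, s) = k *: dgam X v x.
  rewrite /chord_dir FaE FbE GE !ip_gam // /k.
  have -> : gam X v (u b) = cosh (u b - x) *: gam X v x + sinh (u b - x) *: dgam X v x.
    by rewrite -gam_add addrC subrK.
  have -> : gam X v (u a) = cosh (u a - x) *: gam X v x + sinh (u a - x) *: dgam X v x.
    by rewrite -gam_add addrC subrK.
  rewrite (_ : u a - u b = (u a - x) + - (u b - x)); last by ring.
  rewrite (sinh_add (u a - x) (- (u b - x))) coshN sinhN.
  rewrite -(coshN (x - u a)) -(coshN (x - u b)) !opprB.
  by apply/matrixP => i j; rewrite !mxE; ring.
have k2 : ip (Fa (t, s)) (Fb (t, s)) ^+ 2 - 1 = k ^+ 2.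
  by rewrite FaE FbE ip_gam // sqrrN cosh2 /k; ring.
have k0 : k ^+ 2 != 0.
  by rewrite -k2 gt_eqF // subr_gt0 -sqrrN expr_gt1 //; lra.
have ld : leaf_dir leaf (gam X v x) (dgam X v x).
  by split; [exact: gam_unit|rewrite geodesic_line_shift].
have [[hG tG _] _] := ld.
rewrite /density_ext k2 wE GE FE // -/x (densityE hleaf fphi ld).
rewrite (ad_formZ _ fphi) // (_ : beta _ (k *: _) = k *: beta (gam X v x) (dgam X v x)).
  by rewrite pairingZl pairingZr mulrA -expr2 mulrAC mulfV // mul1r.
by rewrite (ad_formZ _ (ad_form_beta hM)).
Qed.

(** Continuity along the part of the lamination in the box, in the form of a
    continuous extension to the parameter plane. *)
Definition box_continuous (q : 'cV[R]_3 -> R) := exists2 qt : R * R -> R, continuous qt &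
  forall t s, C s -> a <= t <= b -> q (F t s) = qt (t, s).

Lemma box_continuous_density phi : ad_form sigma phi -> box_continuous (density leaf phi).
Proof.
move=> fphi; exists (density_ext phi); first exact: density_ext_cont.
by move=> t s Cs ht; exact: density_extE.
Qed.

Let rect_compact : compact (`[a, b]%classic `*` `[c, d]%classic).
Proof. by apply: compact_setX; exact: segment_compact. Qed.

Lemma box_bounded q : box_continuous q ->
  exists2 M : R, 0 <= M & forall t s, C s -> a <= t <= b -> `|q (F t s)| <= M.
Proof.
move=> [qt cq qE].
have := compact_bounded (continuous_compact (continuous_subspaceT cq) rect_compact).
move=> [M [Mr hM']]; exists (`|M| + 1); first by rewrite addr_ge0.
move=> t s Cs ht; rewrite qE //.
apply: hM'; first by rewrite (le_lt_trans (ler_norm _)) // ltrDl.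
by exists (t, s) => //; split; rewrite /= in_itv //=; exact: fb_C_itvW.
Qed.

Lemma box_unif q (e : R) : box_continuous q -> 0 < e -> exists2 dl : R, 0 < dl &
  forall t s t' s', C s -> C s' -> a <= t <= b -> a <= t' <= b ->
    `|t - t'| < dl -> `|s - s'| < dl -> `|q (F t s) - q (F t' s')| < e.
Proof.
move=> [qt cq qE] e0; have [dl dl0 H] := heine rect_compact cq e0.
exists dl => // t s t' s' Cs Cs' ht ht' h1 h2; rewrite !qE //; apply: H => //.
by split; rewrite /= in_itv //=; exact: fb_C_itvW.
Qed.

Definition cell_len (w : R) (p : R * R) := distH (box_map p) (box_map (p.1 + w, p.2)).

Lemma cell_len_cont w : continuous (cell_len w).
Proof.
rewrite /cell_len /distH; apply: cont_arccosh.
  move=> p; have := ip_hyp_le (box_map_hyp p) (box_map_hyp (p.1 + w, p.2)); lra.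
apply: contN; apply: cont_ip; first exact: box_map_cont.
move=> i; apply: (cont_comp (f := fun p : R * R => (p.1 + w, p.2)) (g := fun p => box_map p i 0));
  last exact: box_map_cont.
have c1 : continuous (fun p : R * R => p.1 + w).
  by apply: contD; [move=> p; exact: cvg_fst|exact: cont_cst].
have c2 : continuous (fun p : R * R => p.2) by move=> p; exact: cvg_snd.
by move=> p; exact: (cvg_pair (@c1 p) (@c2 p)).
Qed.

Definition plaque_int (q : 'cV[R]_3 -> R) (s : R) : R :=
  \int[leb]_(t in `[a, b]%classic) (q (F t s) * speed s t).

Lemma speed_int s : C s -> leb.-integrable `[a, b]%classic (EFin \o speed s) /\
  \int[leb]_(t in `[a, b]%classic) speed s t <= K * (b - a).
Proof.
move=> Cs; have [_ _ h _] := fb_speedP hM hleaf Cs.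
have [h1 ->] := h a b (lexx a) ab (lexx b); split => //.
have ia : a <= a <= b by rewrite lexx.
have ib : a <= b <= b by rewrite lexx andbT.
apply: (le_trans (fb_lip ia (fb_C_itvW Cs) ib (fb_C_itvW Cs))).
rewrite subrr normr0 max_l ?normr_ge0 // distrC ger0_norm ?subr_ge0 //.
Qed.

Lemma plaque_integrable q s : box_continuous q -> C s ->
  leb.-integrable `[a, b]%classic (EFin \o (fun t => q (F t s) * speed s t)).
Proof.
move=> bq Cs; have [M M0 qM] := box_bounded bq; have [qt cq qE] := bq.
have [ir _] := speed_int Cs.
have iqt : leb.-integrable `[a, b]%classic (EFin \o (fun t => qt (t, s) * speed s t)).
  rewrite (_ : _ \o _ = (EFin \o (fun t => qt (t, s))) \* (EFin \o speed s))%E //.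
  apply: integrableMr => //.
    apply: measurable_funTS; apply: continuous_measurable_fun.
    have ct : continuous (fun t : R => (t, s) : R * R).
      by move=> t; exact: (cvg_pair (@cvg_id _ _) (cvg_cst s)).
    exact: (cont_comp ct cq).
  exists M; split; rewrite ?num_real // => x Mx t /=; rewrite in_itv /= => ht.
  by rewrite -qE // (le_trans (qM _ _ Cs ht)) // ltW.
apply: eq_integrable iqt => // t /set_mem /=; rewrite in_itv /= => ht.
by rewrite /= qE.
Qed.

Lemma plaque_bound q s M : box_continuous q -> C s ->
  (forall t, a <= t <= b -> `|q (F t s)| <= M) -> `|plaque_int q s| <= M * (K * (b - a)).
Proof.
move=> bq Cs qM; have [ir rK] := speed_int Cs.
have [_ r0 _ _] := fb_speedP hM hleaf Cs.
have iq := plaque_integrable bq Cs.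
have M0 : 0 <= M by apply: le_trans (qM a _); rewrite ?lexx.
apply: (le_trans (le_normr_Rintegral _ iq)) => //.
apply: (@le_trans _ _ (M * \int[leb]_(t in `[a, b]%classic) speed s t)); last first.
  by rewrite ler_wpM2l.
rewrite -RintegralZl //; apply: le_Rintegral => //.
- exact: (integrable_abse iq).
- exact: integrable_scale.
- move=> t /=; rewrite in_itv /= => ht.
  by rewrite normrM (ger0_norm (r0 t)) ler_wpM2r // qM.
Qed.

(** The hypothesis bounds the oscillation of [q] on each of [N.+1] equal
    cells, and the speed integrates to the length of a cell. *)
Lemma plaque_riemann q s (e M : R) N : box_continuous q -> C s -> 0 <= e -> 0 <= M ->
  (forall t, a <= t <= b -> `|q (F t s)| <= M) ->
  (forall t t', a <= t <= b -> a <= t' <= b -> `|t - t'| <= (b - a) / N.+1%:R ->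
    `|q (F t s) - q (F t' s)| <= e) ->
  `|plaque_int q s - \sum_(k < N.+1) q (F (tau a b N k) s) *
     distH (F (tau a b N k) s) (F (tau a b N k.+1) s)| <= e * (1 + M) * (K * (b - a)).
Proof.
move=> bq Cs e0 M0 qM osc; have [ir rK] := speed_int Cs.
have [_ r0 ri _] := fb_speedP hM hleaf Cs.
have [idx [i1 i2]] := cell_index N (fb_ab B).
have ti k : (k <= N.+1)%N -> a <= tau a b N k <= b by apply: tau_itv; exact: fb_ab.
pose S (k : 'I_N.+1) := [set t | a <= t <= b /\ idx t = k].
have S1 (k : 'I_N.+1) t : tau a b N k < t < tau a b N k.+1 -> S k t.
  move=> h; split; last exact: i2.
  have /andP[l _] := ti k (ltnW (ltn_ord k)); have /andP[_ r] := ti k.+1 (ltn_ord k).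
  case/andP: h => h1 h2; rewrite (le_trans l (ltW h1)) //; exact: le_trans (ltW h2) r.
have S2 (k : 'I_N.+1) t : S k t -> tau a b N k <= t <= tau a b N k.+1.
  by move=> [ht <-]; exact: i1.
have tt (k : nat) : tau a b N k <= tau a b N k.+1.
  by rewrite tauS lerDl divr_ge0 // subr_ge0.
have SI (k : 'I_N.+1) : \int[leb]_(t in S k) speed s t =
    distH (F (tau a b N k) s) (F (tau a b N k.+1) s).
  rewrite (sandwich_integral _ (S1 k) (S2 k)).
  have /andP[l _] := ti k (ltnW (ltn_ord k)); have /andP[_ r] := ti k.+1 (ltn_ord k).
  by have [_ ->] := ri _ _ l (tt k) r.
apply: (@le_trans _ _ (e * (1 + M) * \int[leb]_(t in `[a, b]%classic) speed s t)); last first.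
  by rewrite ler_wpM2l // mulr_ge0 // addr_ge0.
apply: (@riemann_estimate _ _ R leb `[a, b]%classic 'I_N.+1 S
  (fun k : 'I_N.+1 => q (F (tau a b N k) s))
  (fun k : 'I_N.+1 => distH (F (tau a b N k) s) (F (tau a b N k.+1) s))
  (fun t => q (F t s)) (speed s) e M) => //.
- exact: plaque_integrable.
- by move=> k; exact: sandwich_measurable (S1 k) (S2 k).
- by move=> k t [ht _]; rewrite /= in_itv.
- by move=> k j t [_ <-] [_ <-].
- by move=> k; apply: qM; apply: ti; exact: ltnW.
- move=> k t Skt; apply: osc; [by case: Skt|by apply: ti; exact: ltnW|].
  have := S2 _ _ Skt; rewrite tauS => /andP[l r].
  by rewrite ger0_norm ?subr_ge0 // lerBlDl.
- move=> t; rewrite /= in_itv /= => ht; have := i1 t ht => h nS; exfalso.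
  by apply: (nS (idx t)).
- move=> k; rewrite SI subrr normr0 mulr_ge0 //; apply: distH_ge0; apply: fb_hyp;
    solve [exact: fb_C_itvW|apply: ti; exact: ltnW|exact: ti].
Qed.

(** A pointwise limit of Riemann sums, which are continuous in [s]. *)
Lemma plaque_measurable q : box_continuous q -> measurable_fun C (plaque_int q).
Proof.
move=> bq; have mC : measurable C by apply: closed_measurable; exact: fb_C_closed.
have [M M0 qM] := box_bounded bq; have [qt cq qE] := bq.
pose S N s := \sum_(k < N.+1) qt (tau a b N k, s) * cell_len ((b - a) / N.+1%:R) (tau a b N k, s).
apply: (@measurable_fun_cvg _ _ _ _ S).
  move=> N; apply: measurable_funTS; apply: measurable_sum => k.
  have cs : continuous (fun s : R => (tau a b N k, s) : R * R).
    by move=> s; exact: (cvg_pair (cvg_cst _) (@cvg_id _ _)).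
  apply: continuous_measurable_fun; apply: contM.
    exact: (cont_comp (f := fun s : R => (tau a b N k, s)) (g := qt)).
  apply: (cont_comp (f := fun s : R => (tau a b N k, s)) (g := cell_len _)) => //.
  exact: cell_len_cont.
move=> s Cs; apply/cvgrPdist_le => e e0.
pose L := (1 + M) * (K * (b - a)) + 1.
have KL : 0 <= (1 + M) * (K * (b - a)).
  by apply: mulr_ge0; [lra|apply: mulr_ge0; rewrite ?subr_ge0 // ltW // fb_K_gt0].
have L0 : 0 < L by rewrite /L; lra.
have eL : 0 < e / L by rewrite divr_gt0.
have [dl dl0 H] := box_unif bq eL.
near=> N.
have hN : (b - a) / N.+1%:R < dl.
  have hN : (b - a) / dl < N%:R by near: N; exact: nbhs_infty_gtr.
  rewrite ltr_pdivrMr // mulrC -ltr_pdivrMr //; apply: (lt_le_trans hN).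
  by rewrite ler_nat.
have SE : S N s = \sum_(k < N.+1) q (F (tau a b N k) s) *
     distH (F (tau a b N k) s) (F (tau a b N k.+1) s).
  apply: eq_bigr => k _; have ti j : (j <= N.+1)%N -> a <= tau a b N j <= b.
    by apply: tau_itv; exact: fb_ab.
  rewrite /cell_len /= -tauS !box_map_id ?fb_C_itvW ?ti ?(ltnW (ltn_ord k)) // qE // ti //.
  exact: ltnW.
rewrite SE; apply: (@le_trans _ _ (e / L * (1 + M) * (K * (b - a)))).
  apply: plaque_riemann => //; first exact: ltW.
    by move=> t ht; exact: qM.
  move=> t t' ht ht' tt'; apply/ltW/H => //; first exact: le_lt_trans hN.
  by rewrite subrr normr0.
rewrite -mulrA -ler_pdivlMl ?divr_gt0 // invf_div mulrAC -mulrA divff ?gt_eqF // mulr1.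
by rewrite /L lerDl ler01.
Unshelve. all: by end_near. Qed.

Variable mu : transverse_measure sigma leaf.

Lemma plaque_int_integrable q : box_continuous q ->
  (mu B).-integrable C (EFin \o plaque_int q).
Proof.
move=> bq; have [M M0 qM] := box_bounded bq.
apply: measurable_bounded_integrable => //.
- by apply: closed_measurable; exact: fb_C_closed.
- by rewrite ltey_eq fin_num_measure //; apply: closed_measurable; exact: fb_C_closed.
- exact: plaque_measurable.
exists (M * (K * (b - a))); split; rewrite ?num_real // => x Mx s Cs.
apply: le_trans (ltW Mx); apply: plaque_bound => // t ht; exact: qM.
Qed.

Definition box_int (q : 'cV[R]_3 -> R) : R := \int[mu B]_(s in C) plaque_int q s.

Let ae_C : {ae mu B, forall s, C s}.
Proof.
exists (~` C); split => //; last exact: tm_supp.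
by apply: measurableC; apply: closed_measurable; exact: fb_C_closed.
Qed.

Let C_cd : C `<=` `[c, d]%classic.
Proof. by move=> s Cs; rewrite /= in_itv /=; exact: fb_C_itvW. Qed.

Let box_outer (A1 A2 : R -> R) : (forall s, C s -> A1 s = A2 s) ->
  \int[mu B]_(s in `[c, d]%classic) A1 s = \int[mu B]_(s in C) A2 s.
Proof.
move=> h; apply: eq_Rintegral_ae_dom; apply: (@filterS _ _ (ae_filter_ringOfSetsType _) _ _ _ ae_C).
by move=> s Cs; rewrite !patchE !mem_set ?h //; exact: C_cd.
Qed.

(** The two sides differ on null sets only: the complement of [C] for the
    transverse measure, and the ends of a plaque and the parameters at which
    the box has no derivative for Lebesgue measure. *)
Lemma form_integralE phi : ad_form sigma phi ->
  fb_form_integral mu B phi = box_int (density leaf phi).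
Proof.
move=> fphi; apply: box_outer => s Cs; apply: eq_Rintegral_ae_dom.
have FF := ae_filter_ringOfSetsType leb.
have [_ _ _ ae1] := fb_speedP hM hleaf Cs.
near=> t.
have ta : t != a by near: t; exact: ae_neq.
have tb : t != b by near: t; exact: ae_neq.
rewrite !patchE; case: ifPn => [/set_mem tab|/negP tn].
  rewrite mem_set; last by move: tab; rewrite /= !in_itv /= => /andP[/ltW -> /ltW ->].
  have : `]a, b[%classic t -> hnorm (fb_dF B t s) = fb_speed hM hleaf B s t /\
      forall phi, ad_form sigma phi ->
        pairing (phi (F t s) (fb_dF B t s)) (fb_generator B t s) =
        density leaf phi (F t s) * fb_speed hM hleaf B s t by near: t.
  by move=> /(_ tab) [_ ->].
case: ifPn => // /set_mem /=; rewrite in_itv /= => /andP[h1 h2].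
by exfalso; apply/tn/mem_set; rewrite /= in_itv /= !lt_neqAle h1 h2 (eq_sym a) ta tb.
Unshelve. all: by end_near. Qed.

Lemma length_integralE (psi : 'cV[R]_3 -> R) :
  fb_length_integral mu B psi = box_int psi.
Proof.
apply: box_outer => s Cs; apply: eq_Rintegral_ae.
have FF := ae_filter_ringOfSetsType leb.
have [_ _ _ ae1] := fb_speedP hM hleaf Cs.
near=> t.
have ta : t != a by near: t; exact: ae_neq.
have tb : t != b by near: t; exact: ae_neq.
have H : `]a, b[%classic t -> hnorm (fb_dF B t s) = fb_speed hM hleaf B s t /\
      forall phi, ad_form sigma phi ->
        pairing (phi (F t s) (fb_dF B t s)) (fb_generator B t s) =
        density leaf phi (F t s) * fb_speed hM hleaf B s t by near: t.
rewrite /= in_itv /= => /andP[h1 h2].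
have [|-> //] := H.
by rewrite /= in_itv /= !lt_neqAle h1 h2 (eq_sym a) ta tb.
Unshelve. all: by end_near. Qed.

End BoxIntegral.

(** * Closed sets of Hausdorff dimension zero *)

Section TotallyDisconnected.
Variable R : realType.
Local Notation leb := (@lebesgue_measure R).

(** A covering set of diameter r <= 1 lies in an interval of length 2 r, and r
    <= r ^ a since a <= 1; so the Lebesgue measure of an interval in [E] is at
    most twice the content. *)
Lemma hausdorff_content_lebesgue (a : R) (E : set R) (x y : R) :
  0 < a <= 1 -> x < y -> (forall z, x < z < y -> E z) ->
  (((y - x) / 2)%:E <= hausdorff_content a 1 E)%E.
Proof.
move=> /andP[a0 a1] xy xyE; apply: le_ereal_inf_tmp => _ [r [U [EU rU]] <-].
have : forall i, exists v, U i `<=` `[v - r i, v + r i]%classic.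
  move=> i; case: (pselect (exists v, U i v)) => [[v Uv]|nU]; last first.
    by exists 0 => u Uu; exfalso; apply: nU; exists u.
  exists v => u Uu; rewrite /= in_itv /=; have [_] := rU i.
  by move=> /(_ u v Uu Uv); rewrite ler_norml; lra.
move=> /choice [v hv].
pose V i : set R := `[v i - r i, v i + r i]%classic.
have r0 i : 0 <= r i by have [/andP[]] := rU i.
have r1 i : r i <= 1 by have [/andP[]] := rU i.
have xV : `]x, y[%classic `<=` \bigcup_i V i.
  move=> z /=; rewrite in_itv /= => /xyE /EU [i _ Ui]; exists i => //; exact: hv.
have sub := outer_measure_sigma_subadditive ((wlength (@idfun R))^*)%mu V.
have le1 := le_outer_measure ((wlength (@idfun R))^*)%mu _ _ xV.
have {sub le1} : (leb `]x, y[%classic <= \sum_(i <oo) leb (V i))%E := le_trans le1 sub.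
rewrite lebesgue_measure_itv /= lte_fin xy -EFinB => le2.
have le3 : (\sum_(i <oo) leb (V i) <= \sum_(i <oo) 2%:E * (r i `^ a)%:E)%E.
  apply: lee_nneseries => [i _ _|i _]; first exact: measure_ge0.
  rewrite /V lebesgue_measure_itv /= lte_fin -EFinM.
  have ri : r i <= r i `^ a.
    have [->|ri0] := eqVneq (r i) 0; first exact: powR_ge0.
    by apply: ger1_powR => //; rewrite r1 lt_neqAle eq_sym ri0 r0.
  case: ifP => _; last by rewrite lee_fin mulr_ge0 // powR_ge0.
  by rewrite -EFinB lee_fin; lra.
have := le_trans le2 le3; rewrite nneseriesZl; last first.
  by move=> i _; rewrite lee_fin powR_ge0.
by rewrite -lee_pdivrMl // -EFinM mulrC.
Qed.

(** Dimension 0 makes the measure of [E] in some dimension a < 1 vanish. *)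
Lemma no_interval (E : set R) : hausdorff_dim E = 0%E ->
  forall x y, x < y -> exists2 z, x < z < y & ~ E z.
Proof.
move=> dim x y xy; apply: contrapT => nz.
have xyE z : x < z < y -> E z by move=> h; apply: contrapT => nE; apply: nz; exists z.
have : (hausdorff_dim E < 1%:E)%E by rewrite dim lte_fin.
move=> /ereal_inf_lt [_ [a [a0 aE] <-]]; rewrite lte_fin => a1.
have h1 : (hausdorff_content a 1 E <= 0)%E.
  by rewrite -aE; apply: ereal_sup_ubound; exists 1 => //=.
have h2 : (((y - x) / 2)%:E <= hausdorff_content a 1 E)%E.
  by apply: hausdorff_content_lebesgue => //; rewrite a0 ltW.
have := le_trans h2 h1; rewrite lee_fin; lra.
Qed.

(** Points outside [C], one in each cell of a fine grid, cut [C] into pieces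
    that are relatively closed; a piece is named by the set of cut points to
    its left. *)
Lemma small_pieces (C : set R) (c d e : R) : closed C -> C `<=` `[c, d]%classic -> 0 < e ->
  (forall x y, x < y -> exists2 z, x < z < y & ~ C z) ->
  exists M (kap : R -> {ffun 'I_M -> bool}),
    (forall l, compact (C `&` [set s | kap s = l])) /\
    (forall s s', C s -> C s' -> kap s = kap s' -> `|s - s'| < e).
Proof.
move=> cC Ccd e0 cut; pose h := e / 2.
have h0 : 0 < h by rewrite divr_gt0.
have : forall j : nat, exists x, c + j%:R * h < x < c + j.+1%:R * h /\ ~ C x.
  move=> j; have [|z hz nC] := cut (c + j%:R * h) (c + j.+1%:R * h); last by exists z.
  by rewrite ltrD2l ltr_pM2r // ltr_nat.
move=> /choice [x hx].
have [M hM] : exists M : nat, d - c < M%:R * h.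
  exists (Num.truncn ((d - c) / h)).+1; rewrite -ltr_pdivrMr //.
  have [dc|dc] := leP 0 ((d - c) / h); first by have /andP[] := truncn_itv dc.
  exact: lt_trans dc (ltr0Sn _ _).
exists M, (fun s => [ffun j : 'I_M => x j < s]); split.
  move=> l; have cpt := @segment_compact R c d.
  apply: (subclosed_compact _ cpt); last by move=> s [Cs _]; exact: Ccd.
  have -> : C `&` [set s | [ffun j : 'I_M => x j < s] = l] =
     C `&` \bigcap_(j in [set: 'I_M]) [set s | if l j then x j <= s else s <= x j].
    apply/seteqP; split => s [Cs hs]; split => //.
      by move=> j _ /=; rewrite -hs ffunE; case: ltP => // /ltW.
    apply/ffunP => j; rewrite ffunE; have := hs j I => /=.
    have xs : x j != s by apply/eqP => E; have [_] := hx j; rewrite E.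
    case: (l j) => h1; first by rewrite lt_neqAle xs.
    by apply/negbTE; rewrite -leNgt.
  apply: closedI => //; apply: closed_bigI => j _.
  by case: (l j); [exact: closed_ge|exact: closed_le].
have key s s' : C s -> C s' -> (forall j : 'I_M, (x j < s) = (x j < s')) -> s' - s < e.
  move=> Cs Cs' E; rewrite ltNge; apply/negP => ess'.
  have := Ccd _ Cs; have := Ccd _ Cs'; rewrite /= !in_itv /= => /andP[_ sd'] /andP[cs _].
  have t0 : 0 <= (s - c) / h by rewrite divr_ge0 ?subr_ge0 // ltW.
  set j := (Num.truncn ((s - c) / h)).
  have /andP[j1 j2] := truncn_itv t0; rewrite -/j in j1 j2.
  have {}j1 : j%:R * h <= s - c by rewrite -ler_pdivlMr.
  have {}j2 : s - c < j.+1%:R * h by rewrite -ltr_pdivrMr.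
  have j3 : j.+1%:R * h = j%:R * h + h by rewrite -natr1 mulrDl mul1r.
  have j4 : j.+2%:R * h = j%:R * h + h + h by rewrite -natr1 mulrDl mul1r j3.
  have he : h + h = e by rewrite /h; field.
  have [/andP[x1 x2] _] := hx j.+1.
  have jM : (j.+1 < M)%N.
    have : j.+1%:R * h < M%:R * h by lra.
    by rewrite ltr_pM2r // ltr_nat.
  have /= := E (Ordinal jM).
  have -> : (x j.+1 < s) = false by apply/negbTE; rewrite -leNgt; lra.
  by move=> /esym/negbT; rewrite -leNgt; lra.
move=> s s' Cs Cs' E.
have E' j : (x (j : 'I_M) < s) = (x j < s').
  by have := congr1 (fun f : {ffun 'I_M -> bool} => f j) E; rewrite !ffunE.
rewrite ltr_norml; apply/andP; split; last exact: key.
by rewrite ltrNl opprB; exact: key.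
Qed.

(** The fibre through [x] is closed, and so is the union of the finitely many
    other fibres. *)
Lemma connected_fintype_const (T : finType) (x y : R) (f : R -> T) : x <= y ->
  (forall z, closed (`[x, y]%classic `&` [set t | f t = z])) ->
  forall t, x <= t <= y -> f t = f x.
Proof.
move=> xy cl t ht.
have xin : `[x, y]%classic x by rewrite /= in_itv /= lexx.
have E : `[x, y]%classic `&` [set t | f t = f x] = `[x, y]%classic; last first.
  have tin : `[x, y]%classic t by rewrite /= in_itv.
  by move: tin; rewrite -E => -[].
apply: (@segment_connected R x y).
- by exists x.
- exists (~` \bigcup_(z in [set z | z != f x]) (`[x, y]%classic `&` [set t | f t = z])).
    by apply: closed_openC; apply: closed_bigcup => [|z _]; [exact: finite_finset|exact: cl].
  apply/seteqP; split => u [u1 u2]; split => //.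
    by move=> [z /= zx [_ /= fz]]; move: zx; rewrite -fz u2 eqxx.
  by apply: contrapT => fu; apply: u2; exists (f u) => //=; apply/eqP.
- by exists (`[x, y]%classic `&` [set t | f t = f x]); rewrite ?setIA ?setIid.
Qed.

End TotallyDisconnected.

(** * Proper discontinuity *)

Section ProperDiscontinuity.
Variables (R : realType) (pi1 : groupType) (sigma : pi1 -> 'M[R]_3).
Hypothesis hM : closed_hyperbolic_surface sigma.

Lemma so_transpose (A : 'M[R]_3) : SOplus21 A -> A *m esharp R *m A^T = esharp R.
Proof.
move=> hA; have uA := so_unit hA; have [e _ _] := hA.
have e2 : esharp R *m esharp R = 1%:M.
  apply/matrixP => i j; rewrite mxE sum_ord3 !esharpE mxE.
  case: i => -[|[|[|//]]] hi; case: j => -[|[|[|//]]] hj /=;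
    by rewrite ?mulr1n ?mulr0n ?mul0r ?mulr0 ?mulN1r ?mulrN1 ?opprK ?addr0 ?add0r ?mulr1.
have -> : A^T = esharp R *m invmx A *m esharp R.
  by rewrite -so_inv_tr // -mulmxA e2 mulmx1.
by rewrite !mulmxA -(mulmxA A) e2 mulmx1 mulmxV // mul1mx.
Qed.

(** The image Z of the base point (0, 0, 1) satisfies ip Z (A X) = - X_3,
    which bounds the height of Z by [2 * m ^+ 2]; this height is the last
    entry of [A], and it bounds all the others through the orthogonality
    relations of rows and columns. *)
Lemma so_entry_bound (A : 'M[R]_3) X (m : R) : SOplus21 A -> hyperboloid X ->
  X ord_max 0 <= m -> (A *m X) ord_max 0 <= m ->
  forall i j, `|A i j| <= 2 * m ^+ 2.
Proof.
move=> hA hX Xm AXm.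
pose e3 : 'cV[R]_3 := \col_i (i == ord_max)%:R.
have he : hyperboloid e3 by split; rewrite ?ipE !mxE /= ?mulr0 ?mulr1 ?add0r.
have hZ := hyp_mul hA he; have hY := hyp_mul hA hX.
have ZE k : (A *m e3) k 0 = A k ord_max.
  by rewrite !mxE sum_ord3 !mxE /= !mulr0 mulr1 !add0r.
have X1 := hyp_ge1 hX; have Y1 := hyp_ge1 hY; have z1 := hyp_ge1 hZ.
have Zsq := hyp_sq hZ; have Ysq := hyp_sq hY.
have ZY : ip (A *m e3) (A *m X) = - X ord_max 0.
  by rewrite ip_mul // ipE !mxE /=; ring.
rewrite ipE in ZY; rewrite !ZE in ZY Zsq z1.
set Y := A *m X in Y1 Ysq ZY AXm.
set z := A ord_max ord_max in z1 ZY Zsq.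
have zb : z <= 2 * m ^+ 2.
  have zXY : z <= 2 * Y ord_max 0 * X ord_max 0.
    set y := Y ord_max 0 in Y1 Ysq ZY *; set w := X ord_max 0 in X1 ZY *.
    set p := A 0 ord_max * Y 0 0 + A 1 ord_max * Y 1 0.
    have -> : w = z * y - p by rewrite /p; lra.
    suff : 2 * y * p <= z * (2 * y ^+ 2 - 1) by rewrite !expr2; lra.
    have y2 : 1 <= y ^+ 2 by rewrite expr_ge1 //; lra.
    have q0 : 0 <= z * (2 * y ^+ 2 - 1) by apply: mulr_ge0; lra.
    case: (leP (2 * y * p) 0) => h; first by lra.
    rewrite -(ler_pXn2r (n := 2)) ?nnegrE ?(ltW h) //.
    have p2 : p ^+ 2 <= (z ^+ 2 - 1) * (y ^+ 2 - 1).
      rewrite Zsq Ysq -subr_ge0 (_ : _ - _ =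
        (A 0 ord_max * Y 1 0 - A 1 ord_max * Y 0 0) ^+ 2) ?sqr_ge0 // /p; ring.
    have p3 : 4 * y ^+ 2 * p ^+ 2 <= 4 * y ^+ 2 * ((z ^+ 2 - 1) * (y ^+ 2 - 1)).
      by apply: ler_wpM2l => //; lra.
    have r0 : 0 <= y ^+ 2 * (y ^+ 2 - 1) by apply: mulr_ge0; lra.
    have z20 := sqr_ge0 z.
    have -> : (2 * y * p) ^+ 2 = 4 * y ^+ 2 * p ^+ 2 by ring.
    apply: (le_trans p3); rewrite -subr_ge0.
    have -> : (z * (2 * y ^+ 2 - 1)) ^+ 2 - 4 * y ^+ 2 * ((z ^+ 2 - 1) * (y ^+ 2 - 1)) =
      z ^+ 2 + 4 * (y ^+ 2 * (y ^+ 2 - 1)) by ring.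
    by lra.
  apply: (le_trans zXY); rewrite -mulrA ler_pM2l // expr2.
  by apply: ler_pM => //; lra.
have z0 : 0 <= z by lra.
have row i : A i 0 ^+ 2 + A i 1 ^+ 2 - A i ord_max ^+ 2 = esharp R i i.
  rewrite -(so_transpose hA) /esharp mul_mx_diag [RHS]mxE sum_ord3 !mxE /=; ring.
have sq i j : A i j ^+ 2 <= z ^+ 2.
  have s0 k l := sqr_ge0 (A k l).
  have r0 := row 0; have r1 := row 1; have r2 := row ord_max.
  move: r0 r1 r2; rewrite !esharpE !eqxx /= !mulr1n.
  have a0 := s0 0 0; have a1 := s0 0 1; have a2 := s0 0 ord_max.
  have b0 := s0 1 0; have b1 := s0 1 1; have b2 := s0 1 ord_max.
  have c0 := s0 ord_max 0; have c1 := s0 ord_max 1.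
  move=> r0 r1 r2.
  have three (k : 'I_3) : k = 0 \/ k = 1 \/ k = ord_max.
    by case: k => -[|[|[|//]]] hk; [left|right;left|right;right]; apply: val_inj.
  by case: (three i) => [|[]] ->; case: (three j) => [|[]] ->; move: r2; rewrite -?/z; lra.
move=> i j; apply: le_trans zb.
by rewrite -(ler_pXn2r (n := 2)) ?nnegrE // real_normK ?num_real.
Qed.

(** The matrices of such elements have bounded entries. A label records the
    cells of a fine grid that contain the entries; when [g] and [h] have the
    same label, [g^-1 * h] is close to the identity, hence trivial by
    discreteness. *)
Lemma finite_label (m : R) : exists (T : finType) (lab : pi1 -> T), forall g h,
  (exists X, [/\ hyperboloid X, X ord_max 0 <= m & (sigma g *m X) ord_max 0 <= m]) ->
  (exists X, [/\ hyperboloid X, X ord_max 0 <= m & (sigma h *m X) ord_max 0 <= m]) ->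
  lab g = lab h -> g = h.
Proof.
pose Mb := 2 * m ^+ 2; have Mb0 : 0 <= Mb by rewrite mulr_ge0 // sqr_ge0.
have [e e0 disc] := chs_discrete hM.
(* Three products of an entry, at most [Mb], with a difference below [eta]
   add up to less than [e]. *)
pose eta := e / (3 * Mb + 1).
have M1 : 0 < 3 * Mb + 1 by lra.
have eta0 : 0 < eta by rewrite divr_gt0.
pose P := Num.truncn (2 * Mb / eta).
pose lab (g : pi1) : {ffun 'I_3 * 'I_3 -> 'I_P.+1} :=
  [ffun p => inord (Num.truncn ((sigma g p.1 p.2 + Mb) / eta))].
exists {ffun 'I_3 * 'I_3 -> 'I_P.+1}, lab => g h [X [hX Xm gXm]] [Y [hY Ym hYm]] E.
have bg := so_entry_bound (sigma_so hM g) hX Xm gXm.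
have bh := so_entry_bound (sigma_so hM h) hY Ym hYm.
have bgV : forall i j, `|sigma (g^-1)%g i j| <= Mb.
  apply: (so_entry_bound (sigma_so hM _) (hyp_sigma hM g hX) gXm).
  by rewrite (sigmaVK hM).
have cell (x : R) : `|x| <= Mb -> 0 <= (x + Mb) / eta /\
    (Num.truncn ((x + Mb) / eta) < P.+1)%N.
  rewrite ler_norml => /andP[x1 x2]; have t0 : 0 <= (x + Mb) / eta.
    by apply: divr_ge0; [lra|exact: ltW].
  split => //; rewrite ltnS; apply: le_truncn.
  by rewrite ler_pM2r ?invr_gt0 //; lra.
have close i j : `|sigma h i j - sigma g i j| < eta.
  have := congr1 (fun f : {ffun 'I_3 * 'I_3 -> 'I_P.+1} => val (f (i, j))) E.
  have [g0 gP] := cell _ (bg i j); have [h0 hP] := cell _ (bh i j).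
  rewrite /lab !ffunE /= !inordK // => En.
  have /andP[g1 g2] := truncn_itv g0; have /andP[h1 h2] := truncn_itv h0.
  rewrite -En -!natr1 in h1 h2 g2.
  have : `|(sigma h i j + Mb) / eta - (sigma g i j + Mb) / eta| < 1.
    by rewrite ltr_norml; lra.
  rewrite -mulrBl normrM (gtr0_norm (_ : 0 < eta^-1)) ?invr_gt0 // ltr_pdivrMr // mul1r.
  by rewrite (_ : _ - _ = sigma h i j - sigma g i j) //; ring.
suff : (g^-1 * h)%g = 1%g.
  by move/(congr1 (fun k => (g * k)%g)); rewrite /= mulgA mulgV mul1g mulg1 => ->.
apply: disc => i j.
have -> : sigma (g^-1 * h)%g i j - (1%:M : 'M[R]_3) i j =
   (sigma (g^-1)%g *m (sigma h - sigma g)) i j.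
  by rewrite mulmxBr -!(chs_hom hM) mulVg (sigma1 hM) !mxE.
rewrite mxE sum_ord3.
have bd k : `|sigma (g^-1)%g i k * (sigma h - sigma g) k j| <= Mb * eta.
  by rewrite normrM; apply: ler_pM => //; rewrite !mxE ltW.
apply: (le_lt_trans (ler_normD _ _)).
apply: (le_lt_trans (lerD (ler_normD _ _) (lexx _))).
apply: (le_lt_trans (lerD (lerD (bd 0) (bd 1)) (bd ord_max))).
have : eta * (3 * Mb + 1) = e by rewrite /eta divfK // gt_eqF.
by rewrite mulrDr mulr1 => eE; lra.
Qed.

End ProperDiscontinuity.

(** * Transition from one flow-box to another *)

Section Transition.
Variables (R : realType) (pi1 : groupType) (sigma : pi1 -> 'M[R]_3).
Variable leaf : set (set 'cV[R]_3).
Hypothesis hM : closed_hyperbolic_surface sigma.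
Hypothesis hleaf : geodesic_lamination sigma leaf.
Implicit Types A B : flow_box sigma leaf.

Lemma box_height B : exists m : R, forall t s,
  fb_a B <= t <= fb_b B -> fb_c B <= s <= fb_d B -> fb_F B t s ord_max 0 <= m.
Proof.
have cpt : compact (`[fb_a B, fb_b B]%classic `*` `[fb_c B, fb_d B]%classic).
  by apply: compact_setX; exact: segment_compact.
have := compact_bounded (continuous_compact
  (continuous_subspaceT (@box_map_cont _ _ _ _ B ord_max)) cpt).
move=> [M [Mr hM']]; exists (`|M| + 1) => t s ht hs.
apply: le_trans (ler_norm _) _; apply: hM'.
  by rewrite (le_lt_trans (ler_norm _)) // ltrDl.
by exists (t, s); [split; rewrite /= in_itv|rewrite box_map_id].
Qed.

Lemma box_transfer_lip A B g g' t s t' s' u w u' w' :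
  fb_a A <= t <= fb_b A -> fb_c A <= s <= fb_d A ->
  fb_a A <= t' <= fb_b A -> fb_c A <= s' <= fb_d A ->
  fb_a B <= u <= fb_b B -> fb_c B <= w <= fb_d B ->
  fb_a B <= u' <= fb_b B -> fb_c B <= w' <= fb_d B ->
  fb_F A t s = sigma g *m fb_F B u w -> fb_F A t' s' = sigma g' *m fb_F B u' w' ->
  Num.max `|u - u'| `|w - w'| <= fb_K B * fb_K A * Num.max `|t - t'| `|s - s'|.
Proof.
move=> ht hs ht' hs' hu hw hu' hw' e e'.
apply: (le_trans (fb_antilip hM g g' hu hw hu' hw')).
by rewrite -e -e' -mulrA ler_pM2l ?fb_K_gt0 //; exact: fb_lip.
Qed.

Lemma fb_lam_C B t s : fb_a B <= t <= fb_b B -> fb_c B <= s <= fb_d B ->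
  lam_support leaf (fb_F B t s) -> fb_C B s.
Proof. by move=> ht hs lX; apply/(fb_support (t := t)); rewrite ?in_itv. Qed.

(** Every point of the segment has a counterpart in [B], which depends on it
    in a Lipschitz way since both boxes are bi-Lipschitz. The transverse
    coordinate of the counterpart moves in a closed set without intervals, so
    it is constant by the intermediate value theorem. The group element takes
    finitely many values by [finite_label], each of them on a closed set
    because the action is free, so it is constant too. *)
Lemma plaque_transition A B s x y : fb_C A s -> fb_a A <= x -> x <= y -> y <= fb_b A ->
  (forall t, x <= t <= y -> fb_region B (fb_F A t s)) ->
  exists w g (th : R -> R), fb_C B w /\ forall t, x <= t <= y ->
    fb_a B <= th t <= fb_b B /\ fb_F A t s = sigma g *m fb_F B (th t) w.
Proof.
move=> Cs ax xy yb reg; have hs := fb_C_itvW Cs.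
have inA t : x <= t <= y -> fb_a A <= t <= fb_b A.
  by case/andP => h1 h2; rewrite (le_trans ax h1) (le_trans h2 yb).
have cl t : x <= clamp x y t <= y by exact: clamp_in.
have : forall t, exists p : pi1 * (R * R), [/\ fb_a B <= p.2.1 <= fb_b B,
    fb_c B <= p.2.2 <= fb_d B &
    fb_F A (clamp x y t) s = sigma p.1 *m fb_F B p.2.1 p.2.2].
  move=> t; have [g [u [w [hu hw e]]]] := reg _ (cl t).
  by exists (g, (u, w)); rewrite !in_itv in hu hw.
move=> /choice [p hp].
pose G t := (p t).1; pose th t := (p t).2.1; pose w t := (p t).2.2.
have hth t : fb_a B <= th t <= fb_b B by have [] := hp t.
have hw t : fb_c B <= w t <= fb_d B by have [] := hp t.
have e t : fb_F A (clamp x y t) s = sigma (G t) *m fb_F B (th t) (w t) by have [] := hp t.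
have K0 : 0 <= fb_K B * fb_K A by rewrite mulr_ge0 // ltW // fb_K_gt0.
have lip t t' : t <= t' ->
    `|th t' - th t| <= fb_K B * fb_K A * (t' - t) /\ `|w t' - w t| <= fb_K B * fb_K A * (t' - t).
  move=> tt'; have := box_transfer_lip (inA _ (cl t')) hs (inA _ (cl t)) hs
    (hth t') (hw t') (hth t) (hw t) (e t') (e t).
  rewrite ge_max subrr normr0 max_l ?normr_ge0 // => /andP[h1 h2].
  have h3 : fb_K B * fb_K A * `|clamp x y t' - clamp x y t| <= fb_K B * fb_K A * (t' - t).
    by apply: ler_wpM2l => //; rewrite ger0_norm ?subr_ge0 ?clamp_homo ?clamp_lip.
  by split; [exact: le_trans h1 h3|exact: le_trans h2 h3].
have cth : continuous th by apply: (lipschitz_continuous K0) => t t' /lip [].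
have cw : continuous w by apply: (lipschitz_continuous K0) => t t' /lip [].
have Cw t : fb_C B (w t).
  apply: (fb_lam_C (hth t) (hw t)); apply: (lam_support_sigmaE hM hleaf (g := G t)).
  by rewrite -e; apply: fb_lam => //; exact: inA.
have wE t : x <= t <= y -> w t = w x.
  move=> /andP[xt ty]; apply: contrapT => ne.
  (* Between two distinct values there is a point outside the transversal. *)
  have mm : Num.min (w x) (w t) < Num.max (w x) (w t).
    by case: (ltgtP (w x) (w t)) => // E; case: ne.
  have [z /andP[z1 z2] nCz] := no_interval (fb_C_dim B) mm.
  have [|v _ vz] := IVT (v := z) xt (continuous_subspaceT cw); first by rewrite !ltW.
  by apply: nCz; rewrite -vz.
have [mA hmA] := box_height A; have [mB hmB] := box_height B.
have [T [lab labP]] := finite_label hM (Num.max mA mB).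
have ret t : exists X, [/\ hyperboloid X, X ord_max 0 <= Num.max mA mB &
    (sigma (G t) *m X) ord_max 0 <= Num.max mA mB].
  exists (fb_F B (th t) (w t)); split; first exact: fb_hyp.
    by rewrite le_max hmB ?orbT.
  by rewrite -e le_max hmA // inA.
have Gc : forall t, x <= t <= y -> lab (G t) = lab (G x).
  apply: connected_fintype_const => // z.
  case: (pselect (exists t0, x <= t0 <= y /\ lab (G t0) = z)) => [[t0 [ht0 lz]]|nz]; last first.
    rewrite (_ : _ `&` _ = set0); first exact: closed0.
    apply/seteqP; split => // t [/=]; rewrite in_itv /= => ht lt; case: nz; by exists t.
  pose f i (t : R) := box_map A (t, s) i 0 - (sigma (G t0) *m box_map B (th t, w x)) i 0.
  have -> : `[x, y]%classic `&` [set t | lab (G t) = z] =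
      `[x, y]%classic `&` \bigcap_(i in [set: 'I_3]) (f i @^-1` [set r | r = 0]).
    apply/seteqP; split => t [tin ht]; split => //; move: (tin); rewrite /= in_itv /= => txy.
      move=> i _ /=; have E : G t = G t0 by apply: labP; rewrite ?ret // ht lz.
      by rewrite /f box_map_id ?inA // box_map_id -?(wE _ txy) // -{1}(clamp_id txy) e E subrr.
    have E : fb_F A t s = sigma (G t0) *m fb_F B (th t) (w t).
      apply/matrixP => i j; rewrite ord1; have /= := ht i I.
      rewrite /f box_map_id ?inA // box_map_id -?(wE _ txy) // => /eqP.
      by rewrite subr_eq0 => /eqP.
    have E2 := e t; rewrite clamp_id // E in E2.
    rewrite /= -lz; congr lab.
    have hX : hyperboloid (fb_F B (th t) (w t)) by exact: fb_hyp.
    suff : ((G t)^-1 * G t0)%g = 1%g.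
      by move/(congr1 (fun k => (G t * k)%g)); rewrite /= mulgA mulgV mul1g mulg1.
    by apply: (chs_free hM hX); rewrite -(sigma_comp hM) E2 (sigmaVK hM).
  apply: closedI; first exact: interval_closed.
  apply: closed_bigI => i _; apply: preimage_closed; last exact: closed_eq.
  move=> t _; have pairc (h : R -> R) (k : R) :
      continuous h -> continuous (fun t : R => (h t, k) : R * R).
    by move=> ch u; exact: (cvg_pair (@ch u) (cvg_cst k)).
  have c1 : continuous (fun t : R => box_map A (t, s) i 0).
    apply: (cont_comp (f := fun t : R => (t, s) : R * R) (g := fun p => box_map A p i 0)).
      by apply: pairc => u; exact: cvg_id.
    exact: box_map_cont.
  have c2 k : continuous (fun t : R => sigma (G t0) i k * box_map B (th t, w x) k 0).
    apply: contM; first exact: cont_cst.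
    apply: (cont_comp (f := fun t : R => (th t, w x) : R * R) (g := fun p => box_map B p k 0)).
      exact: pairc.
    exact: box_map_cont.
  have cf : continuous (f i).
    apply: contD => //; apply: contN.
    rewrite (_ : (fun p => _) =
      (fun t : R => \sum_(k < 3) sigma (G t0) i k * box_map B (th t, w x) k 0)).
      exact: cont_sum3.
    by apply/funext => u; rewrite mxE.
  exact: cf.
exists (w x), (G x), th; split; first exact: Cw.
move=> t txy; split; first exact: hth.
have GE : G t = G x by apply: labP; rewrite ?ret // Gc.
by rewrite -GE -(wE _ txy) -e clamp_id.
Qed.

Variable mu : transverse_measure sigma leaf.

(** A small piece of [A] inside the region of [B] reappears in [B] as a strip
    with the same transverse measure and the same lengths: [H] is the set of
    plaques met by the strip, which meets the plaque [w] at the parameters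
    between [u] and [v]. Two plaques of the piece on a common plaque of [B]
    would occupy disjoint parts of it; but their midpoints are closer to each
    other than to the ends of these parts, because of the bound on the mesh
    [e]. So distinct plaques go to distinct plaques, and the compatibility of
    the transverse measure applies. *)
Lemma piece_transfer A B x y (K : set R) (e : R) :
  fb_a A <= x -> x < y -> y <= fb_b A -> compact K -> K `<=` fb_C A ->
  (forall s s', K s -> K s' -> `|s - s'| < e) ->
  2 * (fb_K A * fb_K B) ^+ 2 * e <= y - x ->
  (forall t s, x <= t <= y -> K s -> fb_region B (fb_F A t s)) ->
  exists H : set R, [/\ compact H, H `<=` fb_C B, mu A K = mu B H,
    forall t1 s1 g t w, x <= t1 <= y -> K s1 -> fb_a B <= t <= fb_b B ->
      fb_c B <= w <= fb_d B -> fb_F A t1 s1 = sigma g *m fb_F B t w -> H w &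
    forall w, H w -> exists s1 u v, [/\ K s1, [/\ fb_a B <= u, u <= v & v <= fb_b B],
      distH (fb_F B u w) (fb_F B v w) = distH (fb_F A x s1) (fb_F A y s1),
      forall t, u < t < v -> exists t1 g, x < t1 < y /\ fb_F A t1 s1 = sigma g *m fb_F B t w &
      forall t t1 s1' g, fb_a B <= t <= fb_b B -> x <= t1 <= y -> K s1' ->
        fb_F A t1 s1' = sigma g *m fb_F B t w -> u <= t <= v]].
Proof.
move=> ax xy yb cK KC Ke mesh reg.
set kA := fb_K A in mesh *; set kB := fb_K B in mesh *.
have kA0 : 0 < kA by exact: fb_K_gt0.
have kB0 : 0 < kB by exact: fb_K_gt0.
have k0 : 0 < kA * kB by exact: mulr_gt0.
have inA t : x <= t <= y -> fb_a A <= t <= fb_b A.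
  by case/andP => h1 h2; rewrite (le_trans ax h1) (le_trans h2 yb).
have : forall s, exists p : R * pi1 * (R -> R), K s -> fb_C B p.1.1 /\
   forall t, x <= t <= y -> fb_a B <= p.2 t <= fb_b B /\
     fb_F A t s = sigma p.1.2 *m fb_F B (p.2 t) p.1.1.
  move=> s; case: (pselect (K s)) => [Ks|nK]; last by exists (0, 1%g, id).
  have [w [g [th h]]] := plaque_transition (KC _ Ks) ax (ltW xy) yb (fun t ht => reg t s ht Ks).
  by exists (w, g, th).
move=> /choice [p hp].
pose h s := (p s).1.1; pose G s := (p s).1.2; pose th s := (p s).2.
have Ch s : K s -> fb_C B (h s) by move=> /hp [].
have hh s : K s -> fb_c B <= h s <= fb_d B by move=> /Ch /fb_C_itvW.
have hth s t : K s -> x <= t <= y -> fb_a B <= th s t <= fb_b B.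
  by move=> /hp [_ H] /H [].
have E s t : K s -> x <= t <= y -> fb_F A t s = sigma (G s) *m fb_F B (th s t) (h s).
  by move=> /hp [_ H] /H [].
have KA s : K s -> fb_c A <= s <= fb_d A by move=> /KC /fb_C_itvW.
have uniq t1 s1 g t w : x <= t1 <= y -> K s1 -> fb_a B <= t <= fb_b B ->
    fb_c B <= w <= fb_d B -> fb_F A t1 s1 = sigma g *m fb_F B t w ->
    t = th s1 t1 /\ w = h s1.
  move=> ht1 Ks1 ht hw e1; apply: (fb_inj hM (g := g) (h := G s1) ht hw); rewrite ?hth ?hh //.
  by rewrite -e1 E.
pose mid := (x + y) / 2.
have midxy : x < mid < y by rewrite /mid; lra.
have midW : x <= mid <= y by case/andP: midxy => /ltW -> /ltW ->.
have xin : x <= x <= y by rewrite lexx ltW.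
have yin : x <= y <= y by rewrite lexx ltW.
have lipth s t t' : K s -> x <= t <= y -> x <= t' <= y ->
    `|th s t - th s t'| <= kB * kA * `|t - t'|.
  move=> Ks ht ht'; have := box_transfer_lip (inA _ ht) (KA _ Ks) (inA _ ht') (KA _ Ks)
    (hth _ _ Ks ht) (hh _ Ks) (hth _ _ Ks ht') (hh _ Ks) (E _ _ Ks ht) (E _ _ Ks ht').
  by rewrite ge_max subrr normr0 (max_l (normr_ge0 _)) => /andP[].
have colipth s t t' : K s -> x <= t <= y -> x <= t' <= y ->
    `|t - t'| <= kA * kB * `|th s t - th s t'|.
  move=> Ks ht ht'.
  have := fb_antilip hM 1%g 1%g (inA _ ht) (KA _ Ks) (inA _ ht') (KA _ Ks).
  rewrite (distH_sigma hM) !E // (distH_sigma hM) ge_max => /andP[+ _] => h1.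
  apply: (le_trans h1); rewrite -mulrA ler_pM2l //.
  apply: (le_trans (fb_lip (hth _ _ Ks ht) (hh _ Ks) (hth _ _ Ks ht') (hh _ Ks))).
  by rewrite subrr normr0 (max_l (normr_ge0 _)).
have liph s s' : K s -> K s' -> `|th s mid - th s' mid| <= kB * kA * `|s - s'| /\
    `|h s - h s'| <= kB * kA * `|s - s'|.
  move=> Ks Ks'; have := box_transfer_lip (inA _ midW) (KA _ Ks) (inA _ midW) (KA _ Ks')
    (hth _ _ Ks midW) (hh _ Ks) (hth _ _ Ks' midW) (hh _ Ks') (E _ _ Ks midW) (E _ _ Ks' midW).
  by rewrite ge_max subrr normr0 (max_r (normr_ge0 _)) => /andP[].
pose u s := Num.min (th s x) (th s y); pose v s := Num.max (th s x) (th s y).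
have cth s : K s -> {within `[x, y]%classic, continuous (th s)}.
  move=> Ks; have cc : continuous (fun t => th s (clamp x y t)).
    apply: (@lipschitz_continuous _ _ (kB * kA)); first by rewrite mulr_ge0 // ltW.
    move=> t t' tt'; apply: (le_trans (lipth _ _ _ Ks (clamp_in _ (ltW xy)) (clamp_in _ (ltW xy)))).
    rewrite ler_pM2l ?mulr_gt0 // ger0_norm ?subr_ge0 ?clamp_homo ?clamp_lip // ltW //.
  apply: (@subspace_eq_continuous _ _ _ (fun t => th s (clamp x y t))).
    by move=> t /set_mem /=; rewrite in_itv /= => ht; rewrite clamp_id.
  exact: continuous_subspaceT.
have ith s : K s -> {in `[x, y] &, injective (th s)}.
  move=> Ks t t'; rewrite !in_itv /= => ht ht' e1; apply/eqP; rewrite -subr_eq0 -normr_le0.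
  by apply: (le_trans (colipth _ _ _ Ks ht ht')); rewrite e1 subrr normr0 mulr0.
have btw s t : K s -> x <= t <= y -> u s <= th s t <= v s.
  move=> Ks ht; have /andP[xt ty] := ht; rewrite /u /v.
  have tin : t \in `[x, y] by rewrite in_itv.
  have xin' : x \in `[x, y] by rewrite in_itv.
  have yin' : y \in `[x, y] by rewrite in_itv.
  case: (leP (th s x) (th s y)) => c.
    have mono := segment_continuous_inj_le c (cth _ Ks) (ith _ Ks).
    by rewrite !mono.
  have mono := segment_continuous_inj_ge (ltW c) (cth _ Ks) (ith _ Ks).
  by apply/andP; split; rewrite mono.
have onto s t : K s -> u s < t < v s -> exists2 t1, x < t1 < y & th s t1 = t.
  move=> Ks /andP[ut tv].
  have [|t1] := IVT (v := t) (ltW xy) (cth _ Ks); first by rewrite !ltW.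
  rewrite in_itv /= => /andP[x1 y1] e1; exists t1 => //.
  rewrite !lt_neqAle x1 y1 !andbT; apply/andP; split; apply/eqP => e2; move: ut tv;
    rewrite -e1 -?e2 /u /v; case: (leP (th s x) (th s y)) => c; rewrite ?ltxx //;
    rewrite ?e2 ?ltxx //.
(* The midpoint of a plaque of the piece is far from the ends in [B]. *)
have margin s : K s -> u s + (y - x) / (2 * (kA * kB)) <= th s mid
    <= v s - (y - x) / (2 * (kA * kB)).
  move=> Ks; have /andP[b1 b2] := btw _ _ Ks midW.
  have hx := colipth _ _ _ Ks midW xin; have hy := colipth _ _ _ Ks midW yin.
  have mx : `|mid - x| = (y - x) / 2 by rewrite ger0_norm /mid; lra.
  have my : `|mid - y| = (y - x) / 2 by rewrite ler0_norm /mid; lra.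
  rewrite mx -ler_pdivrMl // in hx; rewrite my -ler_pdivrMl // in hy.
  have we : (kA * kB)^-1 * ((y - x) / 2) = (y - x) / (2 * (kA * kB)).
    by field; rewrite !gt_eqF.
  rewrite we in hx hy; move: b1 b2 hx hy; rewrite /u /v.
  set wd := (y - x) / _.
  case: (leP (th s x) (th s y)) => c b1 b2 hx hy.
    have n1 : 0 <= th s mid - th s x by lra.
    have n2 : th s mid - th s y <= 0 by lra.
    by rewrite (ger0_norm n1) in hx; rewrite (ler0_norm n2) in hy; apply/andP; split; lra.
  have n1 : th s mid - th s x <= 0 by lra.
  have n2 : 0 <= th s mid - th s y by lra.
  by rewrite (ler0_norm n1) in hx; rewrite (ger0_norm n2) in hy; apply/andP; split; lra.
have w0 : 0 < (y - x) / (2 * (kA * kB)) by rewrite divr_gt0 ?subr_gt0 // mulr_gt0.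
have injh : set_inj K h.
  move=> s s' /set_mem Ks /set_mem Ks' hE.
  have [d1 _] := liph _ _ Ks Ks'; have := margin _ Ks.
  have d2 : kB * kA * `|s - s'| < (y - x) / (2 * (kA * kB)).
    apply: (@lt_le_trans _ _ (kB * kA * e)); first by rewrite ltr_pM2l ?mulr_gt0 // Ke.
    rewrite ler_pdivlMr ?mulr_gt0 //; apply: le_trans mesh.
    by rewrite le_eqVlt; apply/orP; left; apply/eqP; ring.
  have d3 : `|th s mid - th s' mid| < (y - x) / (2 * (kA * kB)) := le_lt_trans d1 d2.
  move: d3; rewrite ltr_norml => /andP[d3 d4] /andP[m1 m2].
  have [|t1 /andP[x1 y1] te] := onto s (th s' mid) Ks; first by apply/andP; split; lra.
  have t1W : x <= t1 <= y by rewrite !ltW.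
  have e1 : sigma (G s)^-1%g *m fb_F A t1 s = sigma (G s')^-1%g *m fb_F A mid s'.
    by rewrite (E _ _ Ks t1W) (E _ _ Ks' midW) !(sigmaVK hM) te hE.
  by have [] := fb_inj hM (inA _ t1W) (KA _ Ks) (inA _ midW) (KA _ Ks') e1.
have ch : {within K, continuous h}.
  apply/subspace_continuousP => s Ks; apply/cvgrPdist_lt => r r0.
  rewrite near_withinE; near=> s' => Ks'.
  have [_ d1] := liph _ _ Ks Ks'; apply: (le_lt_trans d1).
  rewrite -ltr_pdivlMl ?mulr_gt0 //; near: s'; apply: cvgr_dist_lt => //.
  by rewrite mulr_gt0 // invr_gt0 mulr_gt0.
exists (h @` K); split.
- exact: continuous_compact.
- by move=> _ [s Ks <-]; exact: Ch.
- apply: (@tm_compat _ _ _ _ mu A B K h) => //.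
    by move=> _ [s Ks <-]; exact: Ch.
  move=> s Ks; exists mid, (th s mid), (G s); rewrite !in_itv /=; split; last exact: E.
    have /andP[m1 m2] := midxy; rewrite (le_lt_trans ax m1) (lt_le_trans m2 yb) //.
  have /andP[m1 m2] := margin _ Ks.
  have := hth _ _ Ks xin; have := hth _ _ Ks yin.
  move: m1 m2; rewrite /u /v; case: (leP (th s x) (th s y)) => c m1 m2 /andP[p1 p2] /andP[p3 p4];
    by apply/andP; split; lra.
- move=> t1 s1 g t w ht1 Ks1 ht hw e1; have [_ ->] := uniq _ _ _ _ _ ht1 Ks1 ht hw e1.
  by exists s1.
move=> _ [s Ks <-]; exists s, (u s), (v s); split => //.
- have := hth _ _ Ks xin; have := hth _ _ Ks yin; rewrite /u /v.
  by case: (leP (th s x) (th s y)) => c /andP[p1 p2] /andP[p3 p4]; split => //; exact: ltW.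
- rewrite !E // (distH_sigma hM) /u /v; case: (leP (th s x) (th s y)) => // c.
  by rewrite /distH ipC.
- move=> t /(onto _ _ Ks) [t1 ht1 <-]; exists t1, (G s); split => //.
  by apply: E => //; case/andP: ht1 => /ltW -> /ltW ->.
- move=> t t1 s1' g ht ht1 Ks1' e1.
  have [-> /(injh _ _ (mem_set Ks) (mem_set Ks1')) <-] := uniq _ _ _ _ _ ht1 Ks1' ht (hh _ Ks) e1.
  exact: btw.
Unshelve. all: by end_near. Qed.

End Transition.

(** * Independence of the flow-box *)

Section BoxChange.
Variables (R : realType) (pi1 : groupType) (sigma : pi1 -> 'M[R]_3).
Variable leaf : set (set 'cV[R]_3).
Hypothesis hM : closed_hyperbolic_surface sigma.
Hypothesis hleaf : geodesic_lamination sigma leaf.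
Variable mu : transverse_measure sigma leaf.
Variable q : 'cV[R]_3 -> R.
Hypothesis qinv : forall g X, lam_support leaf X -> q (sigma g *m X) = q X.
Implicit Types A B : flow_box sigma leaf.

Local Notation leb := (@lebesgue_measure R).

(** In terms of the lamination only, for the integrals see nothing else of
    [q]. *)
Definition supported B := forall X, lam_support leaf X -> q X != 0 -> fb_region B X.

Lemma measurable_C B : measurable (fb_C B : set (measurableTypeR R)).
Proof. by apply: closed_measurable; exact: fb_C_closed. Qed.

Section Estimate.
Variables (A B : flow_box sigma leaf) (N : nat) (idx : R -> 'I_N.+1).
Variables (M : nat) (kap : R -> {ffun 'I_M -> bool}) (e eta V : R).
Local Notation tk := (tau (fb_a A) (fb_b A) N).
Local Notation len k s := (distH (fb_F A (tk k) s) (fb_F A (tk k.+1) s)).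
Local Notation w := ((fb_b A - fb_a A) / N.+1%:R).
Hypothesis sA : supported A.
Hypothesis e0 : 0 < e.
Hypothesis V0 : 0 <= V.
Hypothesis idx1 : forall t, fb_a A <= t <= fb_b A -> tk (idx t) <= t <= tk (idx t).+1.
Hypothesis idx2 : forall t (k : 'I_N.+1), tk k < t < tk k.+1 -> idx t = k.
Hypothesis kapC : forall l, compact (fb_C A `&` [set s | kap s = l]).
Hypothesis kapE : forall s s', fb_C A s -> fb_C A s' -> kap s = kap s' -> `|s - s'| < eta.
Hypothesis osc : forall t s t' s', fb_C A s -> fb_C A s' ->
  fb_a A <= t <= fb_b A -> fb_a A <= t' <= fb_b A -> `|t - t'| <= w ->
  kap s = kap s' -> `|q (fb_F A t s) - q (fb_F A t' s')| < e.
Hypothesis losc : forall (k : 'I_N.+1) s s', fb_C A s -> fb_C A s' -> kap s = kap s' ->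
  `|len k s - len k s'| <= e * len k s.
Hypothesis qV : forall t s, fb_C A s -> fb_a A <= t <= fb_b A -> `|q (fb_F A t s)| <= V.

(** The cells of [A] on which [q] is not small. By the bound on the
    oscillation [q] vanishes nowhere on the plaques of such a cell, which are
    therefore contained in the region of any box that supports [q]. *)
Definition good (P : 'I_N.+1 * {ffun 'I_M -> bool}) := exists t s,
  [/\ fb_C A s, fb_a A <= t <= fb_b A, idx t = P.1, kap s = P.2 & e <= `|q (fb_F A t s)|].

Definition sample (P : 'I_N.+1 * {ffun 'I_M -> bool}) : R :=
  xget 0 [set s | fb_C A s /\ kap s = P.2].

Definition cell_val P : R :=
  if `[< good P >] then q (fb_F A (tk P.1) (sample P)) else 0.
Definition cell_length P : R :=
  if `[< good P >] then len P.1 (sample P) else 0.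

(** A Riemann sum that involves the box [A] only. *)
Definition box_sum : R := \sum_P cell_val P * cell_length P *
  fine (mu A (fb_C A `&` [set s | kap s = P.2])).

Let tkA k : (k <= N.+1)%N -> fb_a A <= tk k <= fb_b A.
Proof. by apply: tau_itv; exact: fb_ab. Qed.

Let tkAl (k : 'I_N.+1) : fb_a A <= tk k <= fb_b A.
Proof. by apply: tkA; exact: ltnW. Qed.

Let tkS k : tk k.+1 = tk k + w. Proof. exact: tauS. Qed.

Let w0 : 0 < w. Proof. by rewrite divr_gt0 // subr_gt0 fb_ab. Qed.

Lemma sampleP P : good P -> fb_C A (sample P) /\ kap (sample P) = P.2.
Proof.
by move=> [t [s [Cs _ _ ks _]]]; rewrite /sample; case: xgetP => // /(_ s); case.
Qed.

(** By [piece_transfer] the good cells of [A] become disjoint strips of [B]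
    with the same lengths and the same transverse measures, and they cover all
    the points of [B] at which the absolute value of [q] exceeds [e]. So
    [riemann_estimate] applies to each plaque of [B]. *)
Lemma box_estimate : box_continuous B q -> supported B ->
  2 * (fb_K A * fb_K B) ^+ 2 * eta <= w ->
  `|box_int hM hleaf B mu q - box_sum|
    <= e * (1 + V) * (fb_K B * (fb_b B - fb_a B)) * fine (mu B (fb_C B)).
Proof.
move=> bB sB mesh.
have inA (k : 'I_N.+1) t : tk k <= t <= tk k.+1 -> fb_a A <= t <= fb_b A.
  move=> /andP[h1 h2]; have /andP[a1 _] := tkAl k; have /andP[_ b1] := tkA (ltn_ord k).
  by rewrite (le_trans a1 h1) (le_trans h2 b1).
have cellw (k : 'I_N.+1) t t' : tk k <= t <= tk k.+1 -> tk k <= t' <= tk k.+1 -> `|t - t'| <= w.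
  rewrite tkS; move: w => ww /andP[h1 h2] /andP[h3 h4].
  by rewrite ler_norml; apply/andP; split; lra.
have reg P : good P -> forall t s, tk P.1 <= t <= tk P.1.+1 ->
    (fb_C A `&` [set s | kap s = P.2]) s -> fb_region B (fb_F A t s).
  move=> [t' [s' [Cs' ht' i' k' eq']]] t s ht [Cs /= ks].
  apply: sB; first by apply: fb_lam => //; exact: inA ht.
  have h1 : `|t' - t| <= w by apply: (cellw P.1) => //; rewrite -i'; exact: idx1.
  have := osc Cs' Cs ht' (inA _ _ ht) h1 (etrans k' (esym ks)).
  by apply: contraTneq => ->; rewrite subr0 -leNgt.
have : forall P, exists H : set R, good P -> [/\ compact H, H `<=` fb_C B,
    mu A (fb_C A `&` [set s | kap s = P.2]) = mu B H,
    forall t1 s1 g t ww, tk P.1 <= t1 <= tk P.1.+1 -> (fb_C A `&` [set s | kap s = P.2]) s1 ->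
      fb_a B <= t <= fb_b B -> fb_c B <= ww <= fb_d B ->
      fb_F A t1 s1 = sigma g *m fb_F B t ww -> H ww &
    forall ww, H ww -> exists s1 u v, [/\ (fb_C A `&` [set s | kap s = P.2]) s1,
      [/\ fb_a B <= u, u <= v & v <= fb_b B],
      distH (fb_F B u ww) (fb_F B v ww) = len P.1 s1,
      forall t, u < t < v -> exists t1 g, tk P.1 < t1 < tk P.1.+1 /\
        fb_F A t1 s1 = sigma g *m fb_F B t ww &
      forall t t1 s1' g, fb_a B <= t <= fb_b B -> tk P.1 <= t1 <= tk P.1.+1 ->
        (fb_C A `&` [set s | kap s = P.2]) s1' ->
        fb_F A t1 s1' = sigma g *m fb_F B t ww -> u <= t <= v]].
  move=> P; case: (pselect (good P)) => [gP|nP]; last by exists set0.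
  have /andP[a1 _] := tkAl P.1; have /andP[_ b1] := tkA (ltn_ord P.1).
  have [||||||H hH] := @piece_transfer _ _ _ _ hM hleaf mu A B (tk P.1) (tk P.1.+1)
    (fb_C A `&` [set s | kap s = P.2]) eta a1 _ b1; last by exists H => _.
  - by rewrite tkS ltrDl.
  - exact: kapC.
  - by move=> s [].
  - by move=> s s' [Cs ks] [Cs' ks']; apply: kapE => //; rewrite ks ks'.
  - by rewrite tkS addrAC subrr add0r.
  - exact: reg.
move=> /choice [H hH].
have mC := measurable_C.
pose S ww P : set R := [set t | [/\ fb_a B <= t <= fb_b B, good P &
  exists t1 s1 g, [/\ fb_a A <= t1 <= fb_b A, fb_C A s1, idx t1 = P.1, kap s1 = P.2 &
    fb_F A t1 s1 = sigma g *m fb_F B t ww]]].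
have SH ww P t : fb_c B <= ww <= fb_d B -> S ww P t -> H P ww.
  move=> hw [ht gP [t1 [s1 [g [ht1 Cs1 i1 k1 E1]]]]].
  have [_ _ _ hit _] := hH P gP; apply: (hit t1 s1 g t) => //.
  by rewrite -i1; exact: idx1.
have Suv ww P : good P -> H P ww -> exists s1 u v,
    [/\ fb_C A s1 /\ kap s1 = P.2, [/\ fb_a B <= u, u <= v & v <= fb_b B],
      distH (fb_F B u ww) (fb_F B v ww) = len P.1 s1,
      (forall t, u < t < v -> S ww P t) & forall t, S ww P t -> u <= t <= v].
  move=> gP Hw; have [_ _ _ _ /(_ ww Hw)] := hH P gP.
  move=> [s1 [u [v [[Cs1 ks1] [au uv vb] dE onto into]]]]; exists s1, u, v; split => //.
    move=> t /[dup] /andP[ut tv] /onto [t1 [g [ht1 E1]]].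
    have ht1W : tk P.1 <= t1 <= tk P.1.+1 by case/andP: ht1 => /ltW -> /ltW ->.
    split => //; first by rewrite (le_trans au (ltW ut)) (le_trans (ltW tv) vb).
    by exists t1, s1, g; split => //; [exact: inA ht1W|exact: idx2].
  move=> t [ht _ [t1 [s1' [g [ht1 Cs1' i1 k1 E1]]]]].
  by apply: (into t t1 s1' g) => //; rewrite -i1; exact: idx1.
have S0 ww P : fb_c B <= ww <= fb_d B -> ~ (good P /\ H P ww) -> S ww P = set0.
  move=> hw nP; apply/seteqP; split => // t St; apply: nP; split; first by case: St.
  exact: SH St.
have cV P : `|cell_val P| <= V.
  rewrite /cell_val; case: asboolP => [gP|_]; last by rewrite normr0.
  by apply: qV; [have [] := sampleP gP|exact: tkAl].
have inner ww : fb_C B ww ->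
    `|plaque_int hM hleaf B q ww - \sum_P cell_val P * (cell_length P * \1_(H P) ww)|
    <= e * (1 + V) * (fb_K B * (fb_b B - fb_a B)).
  move=> Cw; have hw := fb_C_itvW Cw.
  have [ir rK] := speed_int hM hleaf Cw.
  have [_ r0 ri _] := fb_speedP hM hleaf Cw.
  have qlam t : fb_a B <= t <= fb_b B -> lam_support leaf (fb_F B t ww) by exact: fb_lam.
  apply: (@le_trans _ _ (e * (1 + V) *
    \int[leb]_(t in `[fb_a B, fb_b B]%classic) fb_speed hM hleaf B ww t)); last first.
    by rewrite ler_wpM2l // mulr_ge0 ?(ltW e0) // addr_ge0.
  apply: (@riemann_estimate _ _ R leb `[fb_a B, fb_b B]%classic _ (S ww) cell_val
    (fun P => cell_length P * \1_(H P) ww) (fun t => q (fb_F B t ww))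
    (fb_speed hM hleaf B ww) e V) => //.
  - exact: ltW.
  - exact: plaque_integrable.
  - move=> P; case: (pselect (good P /\ H P ww)) => [[gP Hw]|/(S0 _ _ hw) ->];
      last exact: measurable0.
    by have [s1 [u [v [_ _ _ h1 h2]]]] := Suv ww P gP Hw; exact: sandwich_measurable h1 h2.
  - by move=> P t [ht _ _]; rewrite /= in_itv.
  - move=> [k l] [k' l'] t [_ _ [t1 [s1 [g [ht1 Cs1 /= <- <- E1]]]]]
      [_ _ [t2 [s2 [g' [ht2 Cs2 /= <- <- E2]]]]].
    have E3 : sigma (g^-1)%g *m fb_F A t1 s1 = sigma (g'^-1)%g *m fb_F A t2 s2.
      by rewrite E1 E2 !(sigmaVK hM).
    by have [-> ->] := fb_inj hM ht1 (fb_C_itvW Cs1) ht2 (fb_C_itvW Cs2) E3.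
  - move=> P t [ht gP [t1 [s1 [g [ht1 Cs1 i1 k1 E1]]]]].
    rewrite -(qinv g (qlam t ht)) -E1 /cell_val; case: asboolP => // _.
    have [Cp kp] := sampleP gP; apply/ltW/osc => //; last by rewrite k1 kp.
    apply: (cellw P.1); first by rewrite -i1; exact: idx1.
    by rewrite lexx tkS lerDl ltW.
  - move=> t; rewrite /= in_itv /= => ht nS; rewrite leNgt; apply/negP => qe.
    have q0 : q (fb_F B t ww) != 0.
      by apply/eqP => q0; move: qe; rewrite q0 normr0 ltNge ltW.
    have [g [t1 [s1 [ht1 hs1 E1]]]] := sA (qlam t ht) q0.
    rewrite !in_itv /= in ht1 hs1.
    have E2 : fb_F A t1 s1 = sigma (g^-1)%g *m fb_F B t ww by rewrite E1 (sigmaVK hM).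
    have Cs1 : fb_C A s1.
      apply: (fb_lam_C ht1 hs1); rewrite E2; apply: (lam_support_sigma hM hleaf); exact: qlam.
    apply: (nS (idx t1, kap s1)); split => //; last by exists t1, s1, (g^-1)%g.
    exists t1, s1; split => //; rewrite E2 (qinv _ (qlam t ht)); exact: ltW.
  - move=> P; case: (pselect (good P /\ H P ww)) => [[gP Hw]|nP]; last first.
      rewrite (S0 _ _ hw nP) Rintegral_set0 mulr0 sub0r normrN.
      case: (pselect (good P)) => gP; last first.
        by rewrite /cell_length; case: asboolP => // _; rewrite mul0r normr0.
      by rewrite indicE memNset ?mulr0 ?normr0 // => Hw; apply: nP.
    have [s1 [u [v [[Cs1 ks1] [au uv vb] dE h1 h2]]]] := Suv ww P gP Hw.
    rewrite (sandwich_integral _ h1 h2); have [_ ->] := ri _ _ au uv vb.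
    rewrite dE indicE mem_set // mulr1 /cell_length; case: asboolP => // _.
    by have [Cp kp] := sampleP gP; apply: losc => //; rewrite ks1 kp.
have mH P : good P -> measurable (H P : set (measurableTypeR R)).
  by move=> gP; apply: compact_measurable; have [] := hH P gP.
pose H' P : set R := if `[< good P >] then H P else set0.
have mH' P : measurable (H' P : set (measurableTypeR R)).
  by rewrite /H'; case: asboolP => // gP; exact: mH.
have H'C P : H' P `<=` fb_C B.
  by rewrite /H'; case: asboolP => [gP|_]; [have [] := hH P gP|exact: sub0set].
have ione : (mu B).-integrable (fb_C B) (EFin \o (fun _ : R => 1 : R)).
  apply: finite_measure_integrable_cst => //.
have iH P : (mu B).-integrable (fb_C B) (EFin \o (fun s => \1_(H' P) s * 1)).
  exact: integrable_mul_indic.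
have [isum Esum] := @Rintegral_sum _ _ R (mu B) (fb_C B) _ (index_enum _)
  (fun P s => cell_val P * cell_length P * (\1_(H' P) s * 1)) (mC B)
  (fun P => integrable_scale (cell_val P * cell_length P) (mC B) (iH P)).
have box_sumE : box_sum = \int[mu B]_(s in fb_C B)
    \sum_P cell_val P * cell_length P * (\1_(H' P) s * 1).
  rewrite Esum; apply: eq_bigr => P _.
  rewrite RintegralZl // Rintegral_mul_indic // Rintegral_cst // mul1r /H'.
  rewrite /cell_val /cell_length; case: asboolP => [gP|_]; last by rewrite !mul0r.
  by have [_ _ -> _ _] := hH P gP.
have sumE s : \sum_P cell_val P * (cell_length P * \1_(H P) s) =
    \sum_P cell_val P * cell_length P * (\1_(H' P) s * 1).
  apply: eq_bigr => P _; rewrite mulr1 mulrA /H' /cell_val.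
  by case: asboolP => // _; rewrite !mul0r.
have ip := plaque_int_integrable hM hleaf mu bB.
rewrite box_sumE /box_int -RintegralB //.
have iB : (mu B).-integrable (fb_C B) (EFin \o (fun s => plaque_int hM hleaf B q s -
   \sum_P cell_val P * cell_length P * (\1_(H' P) s * 1))).
  exact: (integrableB (mC B) ip isum).
apply: (le_trans (le_normr_Rintegral _ iB)) => //.
have -> : e * (1 + V) * (fb_K B * (fb_b B - fb_a B)) * fine (mu B (fb_C B)) =
  \int[mu B]_(s in fb_C B) (e * (1 + V) * (fb_K B * (fb_b B - fb_a B))).
  by rewrite Rintegral_cst.
apply: le_Rintegral => //.
- exact: (integrable_abse iB).
- exact: finite_measure_integrable_cst.
- by move=> s Cs; rewrite -sumE; exact: inner.
Qed.

End Estimate.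

(** The sum [box_sum] computed from [A] approximates the integrals over both
    boxes; [box_estimate] is applied to the pairs (A, A) and (A, B). *)
Theorem box_change A B : box_continuous A q -> box_continuous B q -> supported A -> supported B ->
  box_int hM hleaf A mu q = box_int hM hleaf B mu q.
Proof.
move=> bA bB sA sB.
have [V V0 qV] := box_bounded bA.
have ab := fb_ab A.
pose cst D := (1 + V) * (fb_K D * (fb_b D - fb_a D)) * fine (mu D (fb_C D)).
have cst0 D : 0 <= cst D.
  apply: mulr_ge0; last by apply: fine_ge0; exact: measure_ge0.
  apply: mulr_ge0; first by lra.
  by apply: mulr_ge0; rewrite ?subr_ge0 ltW ?fb_K_gt0 ?fb_ab.
suff H e : 0 < e -> `|box_int hM hleaf A mu q - box_int hM hleaf B mu q| <= e * (cst A + cst B).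
  apply/eqP; rewrite -subr_eq0 -normr_le0; apply/ler_addgt0Pr => r r0; rewrite add0r.
  have c1 : 0 < cst A + cst B + 1 by rewrite ltr_wpDl // addr_ge0.
  have := H (r / (cst A + cst B + 1)); rewrite divr_gt0 // => /(_ isT) /le_trans; apply.
  rewrite mulrAC ler_pdivrMr // ler_pM2l //; lra.
move=> e0.
have [d1 d10 u1] := box_unif bA e0.
have [N hN] : exists N : nat, (fb_b A - fb_a A) / N.+1%:R < d1.
  exists (Num.truncn ((fb_b A - fb_a A) / d1)).
  have t0 : 0 <= (fb_b A - fb_a A) / d1 by rewrite divr_ge0 ?subr_ge0 // ltW.
  have /andP[_] := truncn_itv t0; rewrite ltr_pdivrMr // => h.
  by rewrite ltr_pdivrMr // mulrC.
set w := (fb_b A - fb_a A) / N.+1%:R in hN.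
have w0 : 0 < w by rewrite divr_gt0 // subr_gt0.
have [idx [idx1 idx2]] := cell_index N ab.
have kA0 := fb_K_gt0 A; have kB0 := fb_K_gt0 B.
have cpt : compact (`[fb_a A, fb_b A]%classic `*` `[fb_c A, fb_d A]%classic).
  by apply: compact_setX; exact: segment_compact.
have ewK : 0 < e * (w / fb_K A) by rewrite mulr_gt0 // divr_gt0.
have [d2 d20 u2] := heine cpt (@cell_len_cont _ _ _ _ A w) ewK.
(* The mesh keeps the oscillations of [q] and of the lengths of the cells small,
   and makes [piece_transfer] applicable to both pairs of boxes. *)
pose eta := Num.min (Num.min d1 d2)
  (Num.min (w / (2 * (fb_K A * fb_K A) ^+ 2)) (w / (2 * (fb_K A * fb_K B) ^+ 2))).
have p2 (x y : R) : 0 < x -> 0 < y -> 0 < 2 * (x * y) ^+ 2.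
  by move=> x0 y0; rewrite mulr_gt0 // exprn_gt0 // mulr_gt0.
have eta0 : 0 < eta.
  rewrite /eta !lt_min d10 d20 /=; apply/andP.
  by split; apply: divr_gt0 => //; exact: p2.
have etad1 : eta <= d1 by rewrite /eta !ge_min lexx.
have etad2 : eta <= d2 by rewrite /eta !ge_min lexx orbT.
have etaA : 2 * (fb_K A * fb_K A) ^+ 2 * eta <= w.
  by rewrite mulrC -ler_pdivlMr ?p2 // /eta !ge_min lexx !orbT.
have etaB : 2 * (fb_K A * fb_K B) ^+ 2 * eta <= w.
  by rewrite mulrC -ler_pdivlMr ?p2 // /eta !ge_min lexx !orbT.
have Ccd : fb_C A `<=` `[fb_c A, fb_d A]%classic.
  by move=> s Cs; rewrite /= in_itv /=; exact: fb_C_itvW.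
have [M [kap [kapC kapE]]] := small_pieces (@fb_C_closed _ _ _ _ A) Ccd eta0
  (no_interval (fb_C_dim A)).
have tkA k : (k <= N.+1)%N -> fb_a A <= tau (fb_a A) (fb_b A) N k <= fb_b A.
  by apply: tau_itv.
have osc t s t' s' : fb_C A s -> fb_C A s' -> fb_a A <= t <= fb_b A ->
    fb_a A <= t' <= fb_b A -> `|t - t'| <= w -> kap s = kap s' ->
    `|q (fb_F A t s) - q (fb_F A t' s')| < e.
  move=> Cs Cs' ht ht' tw ks; apply: u1 => //; first exact: le_lt_trans hN.
  exact: lt_le_trans (kapE _ _ Cs Cs' ks) etad1.
have losc (k : 'I_N.+1) s s' : fb_C A s -> fb_C A s' -> kap s = kap s' ->
    `|distH (fb_F A (tau (fb_a A) (fb_b A) N k) s) (fb_F A (tau (fb_a A) (fb_b A) N k.+1) s) -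
      distH (fb_F A (tau (fb_a A) (fb_b A) N k) s') (fb_F A (tau (fb_a A) (fb_b A) N k.+1) s')|
    <= e * distH (fb_F A (tau (fb_a A) (fb_b A) N k) s) (fb_F A (tau (fb_a A) (fb_b A) N k.+1) s).
  move=> Cs Cs' ks; set tk := tau _ _ _.
  have hk : fb_a A <= tk k <= fb_b A by apply: tkA; exact: ltnW.
  have hk1 : fb_a A <= tk k.+1 <= fb_b A by exact: tkA.
  have tS : tk k.+1 = tk k + w by exact: tauS.
  have cE r : fb_C A r -> distH (fb_F A (tk k) r) (fb_F A (tk k.+1) r) =
      cell_len A w (tk k, r).
    by move=> Cr; rewrite /cell_len /= -tS !box_map_id //; exact: fb_C_itvW.
  (* The length of a cell is bounded below, so that the absolute error given by
     uniform continuity is a relative error. *)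
  have lo : w / fb_K A <= distH (fb_F A (tk k) s) (fb_F A (tk k.+1) s).
    rewrite ler_pdivrMr // mulrC.
    have := fb_antilip hM 1%g 1%g hk (fb_C_itvW Cs) hk1 (fb_C_itvW Cs).
    rewrite (distH_sigma hM) ge_max tS opprD addNKr normrN (gtr0_norm w0) => /andP[+ _].
    by rewrite -tS.
  apply: (@le_trans _ _ (e * (w / fb_K A))); last by rewrite ler_pM2l.
  rewrite !cE //; apply/ltW/u2.
  - by split; rewrite /= in_itv //=; exact: fb_C_itvW.
  - by rewrite subrr normr0.
  - exact: lt_le_trans (kapE _ _ Cs Cs' ks) etad2.
have eA := @box_estimate A A N idx M kap e eta V sA e0 V0 idx1 idx2 kapC kapE osc losc
  (fun t s => @qV t s) bA sA etaA.
have eB := @box_estimate A B N idx M kap e eta V sA e0 V0 idx1 idx2 kapC kapE osc losc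
  (fun t s => @qV t s) bB sB etaB.
rewrite -(subrKA (box_sum A idx kap e)) mulrDr; apply: (le_trans (ler_normD _ _)).
by apply: lerD; [|rewrite distrC]; rewrite /cst !mulrA // in eA eB *.
Qed.

End BoxChange.

(** * Linearity and monotonicity of the box integral *)

Section BoxLinearity.
Variables (R : realType) (pi1 : groupType) (sigma : pi1 -> 'M[R]_3).
Variable leaf : set (set 'cV[R]_3).
Hypothesis hM : closed_hyperbolic_surface sigma.
Hypothesis hleaf : geodesic_lamination sigma leaf.
Variable mu : transverse_measure sigma leaf.
Variable B : flow_box sigma leaf.
Local Notation leb := (@lebesgue_measure R).
Local Notation bint := (box_int hM hleaf B mu).
Local Notation mu_B := (mu B).

Lemma box_int_ext (q1 q2 : 'cV[R]_3 -> R) :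
  (forall X, lam_support leaf X -> q1 X = q2 X) -> bint q1 = bint q2.
Proof.
move=> h; apply: eq_Rintegral => s /set_mem Cs; apply: eq_Rintegral => t /set_mem.
by rewrite /= in_itv /= => ht; rewrite h //; exact: fb_lam.
Qed.

Lemma box_intZ k q : box_continuous B q -> bint (fun X => k * q X) = k * bint q.
Proof.
move=> bq; have mC := measurable_C B.
rewrite /box_int -RintegralZl //; last exact: plaque_int_integrable.
apply: eq_Rintegral => s /set_mem Cs.
rewrite /plaque_int -RintegralZl //; last exact: plaque_integrable.
by apply: eq_Rintegral => t _; rewrite mulrA.
Qed.

Lemma box_int_sum (I : finType) (q : I -> 'cV[R]_3 -> R) :
  (forall i, box_continuous B (q i)) -> bint (fun X => \sum_i q i X) = \sum_i bint (q i).
Proof.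
move=> bq; have mC := measurable_C B.
have [_ <-] := @Rintegral_sum _ _ R mu_B (fb_C B) I (index_enum I)
  (fun i => plaque_int hM hleaf B (q i)) mC (fun i => plaque_int_integrable hM hleaf mu (bq i)).
apply: eq_Rintegral => s /set_mem Cs.
have [_ <-] := @Rintegral_sum _ _ R leb `[fb_a B, fb_b B]%classic I (index_enum I)
  (fun i t => q i (fb_F B t s) * fb_speed hM hleaf B s t) (measurable_itv _)
  (fun i => plaque_integrable hM hleaf (bq i) Cs).
by apply: eq_Rintegral => t _; rewrite mulr_suml.
Qed.

Lemma box_int_le q1 q2 : box_continuous B q1 -> box_continuous B q2 ->
  (forall X, lam_support leaf X -> q1 X <= q2 X) -> bint q1 <= bint q2.
Proof.
move=> b1 b2 h; have mC := measurable_C B.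
apply: le_Rintegral => //; try exact: plaque_int_integrable.
move=> s Cs; apply: le_Rintegral => //; try exact: plaque_integrable.
move=> t /=; rewrite in_itv /= => ht; have [_ r0 _ _] := fb_speedP hM hleaf Cs.
by rewrite ler_wpM2r // h //; exact: fb_lam.
Qed.

End BoxLinearity.

(** * The mass *)

Section Mass.
Variables (R : realType) (pi1 : groupType) (sigma : pi1 -> 'M[R]_3).
Variable leaf : set (set 'cV[R]_3).
Hypothesis hM : closed_hyperbolic_surface sigma.
Hypothesis hleaf : geodesic_lamination sigma leaf.
Variable mu : transverse_measure sigma leaf.
Variables (n : nat) (B : 'I_n -> flow_box sigma leaf) (psi : 'I_n -> 'cV[R]_3 -> R).
Hypothesis hcover : flow_box_cover B psi.
Implicit Types phi : 'cV[R]_3 -> 'cV[R]_3 -> 'M[R]_3.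

Lemma psi_region i X : hyperboloid X -> psi i X != 0 -> fb_region (B i) X.
Proof.
move=> hX p0; have [g [t [s [ht hs ->]]]] : fb_interior (B i) X.
  by apply: (fc_supp hcover); apply: subset_closure; split.
by exists g, t, s; split => //; [move: ht|move: hs]; rewrite !in_itv /= => /andP[/ltW -> /ltW ->].
Qed.

Lemma density_supported phi (D : flow_box sigma leaf) :
  (forall X v, hyperboloid X -> tangent X v -> ~ fb_region D X -> phi X v = 0) ->
  supported (density leaf phi) D.
Proof.
move=> h X lX /eqP q0; apply: contrapT => nr; apply: q0.
have [[hX td _] _] := some_dirP hleaf lX.
by rewrite /density h // /pairing mul0mx mxtrace0.
Qed.

Lemma psi_form i phi : ad_form sigma phi -> ad_form sigma (fun X v => psi i X *: phi X v).
Proof. exact: ad_form_mul (fc_smooth hcover i). Qed.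

Definition cover_value phi : R :=
  \sum_(i < n) box_int hM hleaf (B i) mu (density leaf (fun X v => psi i X *: phi X v)).

(** Cut the forms of the decomposition by the partition of unity of the given
    cover: each of the resulting forms is supported in two boxes, and
    [box_change] moves its integral from one to the other. *)
Lemma Bdmu_value_unique phi r : ad_form sigma phi -> Bdmu_value mu phi r -> r = cover_value phi.
Proof.
move=> fphi [m [D [phi_ [fphi_ supp dec ->]]]].
have bc D' f : ad_form sigma f -> box_continuous D' (density leaf f) :=
  box_continuous_density hM hleaf D' (phi := f).
transitivity (\sum_(j < m) \sum_(i < n) box_int hM hleaf (B i) mu
    (density leaf (fun X v => psi i X *: phi_ j X v))).
  apply: eq_bigr => j _; rewrite (form_integralE hM hleaf) //.
  transitivity (\sum_(i < n) box_int hM hleaf (D j) mu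
      (density leaf (fun X v => psi i X *: phi_ j X v))).
    rewrite -box_int_sum; last by move=> i; apply: bc; exact: psi_form.
    apply: box_int_ext => X lX.
    under eq_bigr do rewrite density_mul.
    by rewrite -mulr_suml (fc_sum hcover) // mul1r.
  apply: eq_bigr => i _; have fpj := psi_form i (fphi_ j).
  apply: box_change; try exact: bc.
  - by move=> g X lX; exact: density_sigma.
  - apply: density_supported => X v hX tv nr.
    by rewrite supp // scaler0.
  - apply: density_supported => X v hX tv nr.
    case: (eqVneq (psi i X) 0) => [->|p0]; first by rewrite scale0r.
    by case: nr; exact: psi_region.
rewrite exchange_big /=; apply: eq_bigr => i _.
rewrite -box_int_sum; last by move=> j; apply: bc; exact: psi_form.
apply: box_int_ext => X lX; under eq_bigr do rewrite density_mul.
rewrite density_mul -mulr_sumr; congr (_ * _).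
have [[hX td _] _] := some_dirP hleaf lX.
rewrite /density dec // /pairing mulmx_suml raddf_sum.
by [].
Qed.

Lemma Bdmu_value_exists phi : ad_form sigma phi -> Bdmu_value mu phi (cover_value phi).
Proof.
move=> fphi; exists n, B, (fun i X v => psi i X *: phi X v); split.
- by move=> i; exact: psi_form.
- move=> i X v hX tv nr; case: (eqVneq (psi i X) 0) => [->|p0]; first by rewrite scale0r.
  by case: nr; exact: psi_region.
- by move=> X v lX tv; rewrite -scaler_suml (fc_sum hcover) // scale1r.
- by apply: eq_bigr => i _; rewrite (form_integralE hM hleaf) //; exact: psi_form.
Qed.

Lemma BdmuE phi : ad_form sigma phi -> Bdmu mu phi = cover_value phi.
Proof.
move=> fphi; rewrite /Bdmu; case: xgetP => [r _ /(Bdmu_value_unique fphi) //|no].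
by case: (no _ (Bdmu_value_exists fphi)).
Qed.

Lemma box_continuous_psi i : box_continuous (B i) (psi i).
Proof.
have [qt cq qE] := box_continuous_density hM hleaf (B i) (psi_form i (ad_form_beta hM)).
exists (fun p => qt p * 2^-1); first by apply: contM => //; exact: cont_cst.
move=> t s Cs ht; rewrite -qE // density_mul (density_beta hleaf) ?mulfK ?pnatr_eq0 //.
exact: fb_lam.
Qed.

(** The density of [beta] is constant, equal to 2. *)
Lemma cover_value_beta : cover_value (@beta R) = 2 * lamination_length mu B psi.
Proof.
rewrite /lamination_length mulr_sumr; apply: eq_bigr => i _.
rewrite (length_integralE hM hleaf) -box_intZ; last exact: box_continuous_psi.
apply: box_int_ext => X lX.
by rewrite density_mul (density_beta hleaf) // mulrC.
Qed.

(** The bound on the singular values makes the density of [phi] at most 2,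
    that of [beta]. *)
Lemma cover_value_le phi : ad_form sigma phi -> is_id_part phi phi ->
  (forall X, hyperboloid X -> largest_singular_value X (phi X) <= Num.sqrt 2) ->
  cover_value phi <= cover_value (@beta R).
Proof.
move=> fphi idphi hs; apply: ler_sum => i _; apply: box_int_le.
- by apply: box_continuous_density => //; exact: psi_form.
- by apply: box_continuous_density => //; apply: psi_form; exact: ad_form_beta.
move=> X lX; rewrite !density_mul (density_beta hleaf) //.
have hX := lam_hyp hleaf lX.
apply: ler_wpM2l; first exact: fc_ge0 hcover i X hX.
exact: (density_le2 hleaf lX fphi idphi (hs X hX)).
Qed.

End Mass.

Theorem theorem1p3 (R : realType) (pi1 : groupType) (sigma : pi1 -> 'M[R]_3)
  (hM : closed_hyperbolic_surface sigma)
  (leaf : set (set 'cV[R]_3)) (hleaf : geodesic_lamination sigma leaf)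
  (mu : transverse_measure sigma leaf)
  (n : nat) (B : 'I_n -> flow_box sigma leaf) (psi : 'I_n -> 'cV[R]_3 -> R)
  (hcover : flow_box_cover B psi) :
  mass sigma (Bdmu mu) = (2 * lamination_length mu B psi)%:E.
Proof.
have vE := BdmuE hM hleaf mu hcover.
have bE := cover_value_beta hM hleaf mu hcover.
apply/eqP; rewrite eq_le; apply/andP; split.
  apply: ge_ereal_sup => _ [phi [fphi idphi hs] <-].
  rewrite lee_fin vE // -bE; exact: cover_value_le.
have fb := ad_form_beta hM.
apply: ereal_sup_ubound; exists (@beta R); last by rewrite vE // bE.
by split => //; [exact: beta_is_id|exact: singular_value_beta].
Qed.
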